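(* Let $d\ge1$, $\omega\in\Omega_{\langle d]}$ and $\alpha\in\mathbb R$. Let $\omega_\star=(d)$ (that is, $\omega_\star:1\mapsto d$) denote the minimal element of the poset $\Omega_{\langle d]}$. Then the following hold. (1) The stratum $\mathsf R_{\alpha,\omega}\subset\mathbb R^{d-1}_{\mathrm{coef},\alpha}$ is an open ball of codimension $|\omega|'$. (2) For each $\hat\omega\in\Omega_{\langle d]}$, the strata $\{\mathsf R_{\alpha,\omega}\}_{\omega\preceq\hat\omega}$ give rise to a cellular structure on the affine variety $\mathsf R_{\alpha,\hat\omega_\succeq}\subset\mathbb R^{d-1}_{\mathrm{coef},\alpha}$. The attaching maps $\Phi^\partial_{\alpha,\omega}:\partial e_{\alpha,\omega}\to\mathsf R_{\alpha,\omega_\succeq}\setminus\mathsf R_{\alpha,\omega}$ for the cells $e_{\alpha,\omega}$ are the restrictions to $\partial e_{\alpha,\omega}$ of the maps $\Phi_{\alpha,\omega}(D',D'')=V(D'+D''+\tau(D''))$. (3) The space $\mathbb R^{d-1}_{\mathrm{coef},\alpha}$ admits a $1$-parameter flow $\Psi^\alpha_t$ which has a single stationary point $O_\alpha$ (a source), is transversal to each sphere $S^{d-2}_{\mathrm{coef},\alpha}$ centered on $O_\alpha$, and preserves each stratum $\mathsf R_{\alpha,\omega}$, $\omega\in\Omega_{\langle d]}$. Thus the $\Omega_{\langle d]}$-labeled cellular structure on $\mathbb R^{d-1}_{\mathrm{coef},\alpha}$ is a cone over a similar $(\Omega_{\langle d]}\setminus\{\omega_\star\})$-labeled cellular structure on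 the sphere $S^{d-2}_{\mathrm{coef},\alpha}$.
   Context: Combinatorics. $\Omega$ is the set of maps $\omega:\mathbb N=\{1,2,\dots\}\to\mathbb Z_{\ge0}$ with finite support $\mathrm{supp}(\omega)$ such that $\omega(i)\ne0$ implies $\omega(j)\neq 0$ for all $j<i$; such $\omega$ is written as the finite sequence $(\omega(1),\dots,\omega(q))$, $q=|\mathrm{supp}(\omega)|$. Put $|\omega|=\sum_i\omega(i)$ and $|\omega|'=\sum_{i\in\mathrm{supp}(\omega)}(\omega(i)-1)$. An elementary merge $\mathsf M_j$ replaces two adjacent entries $\omega(j),\omega(j+1)$ by the single entry $\omega(j)+\omega(j+1)$; an elementary insert $\mathsf I_j$ inserts a new entry equal to $2$ at some position of the sequence (possibly at the beginning or the end). Write $\omega_1\succeq\omega_2$ if $\omega_2$ can be obtained from $\omega_1$ by a (possibly empty) sequence of elementary merges and inserts. $\Omega_{\langle d]}$ is the set of $\omega\in\Omega$ with $|\omega|\le d$ and $|\omega|\equiv d\pmod 2$. Polynomials. $\mathsf{Sym}^mY=Y^m/S_m$ is the $m$-th symmetric power (points are effective divisors of degree $m$ on $Y$). $\tau$ is complex conjugation on $\mathbb C$, and the Viète homeomorphism $V$ sends a conjugation-invariant divisor of degree $d$ in $\mathbb C$ to the real monic polynomial with that root divisor, i.e. to its coefficient vector in $\mathbb R^d_{\mathrm{coef}}$. A divisor of degree $d$ is $\alpha$-balanced if the sum of its points, counted with multiplicity, equals $\alpha d$. $\mathbb R^{d-1}_{\mathrm{coef},\alpha}\subset\mathbb R^d_{\mathrm{coef}}$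 is the $(d-1)$-dimensional affine space of real monic degree $d$ polynomials whose root divisor is $\alpha$-balanced (so the coefficient of $z^{d-1}$ is fixed), and $O_\alpha$ is the polynomial $(z-\alpha)^d$. The combinatorial type of a polynomial's real divisor is the sequence of multiplicities of its real roots in increasing order. $\mathsf R_{\alpha,\omega}$ is the set of polynomials in $\mathbb R^{d-1}_{\mathrm{coef},\alpha}$ whose real divisor has combinatorial type $\omega$; $\mathsf R_{\alpha,\omega_\succeq}$ is its closure. Cells. Let $\mathbb H=\{z\in\mathbb C:\mathrm{Im}(z)\ge0\}$, $\mathbb H^\circ=\{\mathrm{Im}(z)>0\}$. For $\omega\in\Omega_{\langle d]}$ with $p=|\mathrm{supp}(\omega)|$, $m=(d-|\omega|)/2$, let $\Pi_\omega=\{y\in\mathbb R^p:y_1\le\dots\le y_p\}$, where $y$ represents the real divisor $D'=\sum_i\omega(i)\,y_i$, and $\Pi^\circ_\omega=\{y_1<\dots<y_p\}$. $e_{\alpha,\omega}$ is the set of pairs $(D',D'')\in\Pi_\omega\times\mathsf{Sym}^m\mathbb H$ such that $D'+D''+\tau(D'')$ is $\alpha$-balanced; $\partial e_{\alpha,\omega}$ is the set of those pairs not lying in $\Pi_\omega^\circ\times\mathsf{Sym}^m\mathbb H^\circ$. A cell complex (cellular structure) here means a Hausdorff space $Z$ that is a disjoint union of subsets $e_a^\circ$, each homeomorphic to an open ball $B_a^\circ$ of some dimension $d_a$, such that the homeomorphism $B_a^\circ\to e_a^\circ$ extends to a continuous map $\phi_a:B_a\to Z$, where $B_a$ is either a closed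 ball or an open ball together with an open hemisphere of its boundary sphere, $\phi_a(\partial B_a)$ lies in a union of finitely many cells of dimension less than $d_a$, and $Y\subset Z$ is closed if $\phi_a^{-1}(Y\cap\phi_a(B_a))$ is closed in $B_a$ for each $a$. Closed cells are not required to be closed balls.
   Formalization: Spheres centered on O_α are taken round in the coefficients with respect to powers of z−α; with round spheres in the coefficients of powers of z, transversality in (3) fails (d=3, α²>24: the stratum of polynomials with a double root is tangent to some sphere). *)

(* Defs.v *)
From HB Require Import structures.
From mathcomp Require Import all_boot all_order all_algebra all_fingroup.
From mathcomp Require Import all_classical all_reals all_analysis.
From mathcomp Require Import generic_quotient complex polyrcf.

Set Implicit Arguments.
Unset Strict Implicit.
Unset Printing Implicit Defensive.

Import Order.TTheory GRing.Theory Num.Theory numFieldNormedType.Exports.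

Local Open Scope classical_set_scope.
Local Open Scope ring_scope.
Local Open Scope complex_scope.

(* A finitely supported map whose support is an initial segment of {1, 2, ...}
   is the same thing as a finite sequence of positive integers; positions are
   numbered from 0. *)
Definition Omega_le (d : nat) : set (seq nat) :=
  [set w | [/\ all (fun k => 0 < k)%N w, (sumn w <= d)%N
             & (sumn w = d %[mod 2])%N]].

Definition norm_red (w : seq nat) : nat := (\sum_(k <- w) k.-1)%N.

Definition elem_merge (j : nat) (w : seq nat) : seq nat :=
  take j w ++ (nth 0 w j + nth 0 w j.+1)%N :: drop j.+2 w.

Definition elem_insert (j : nat) (w : seq nat) : seq nat :=
  take j w ++ 2 :: drop j w.

Inductive succeq (w : seq nat) : seq nat -> Prop :=
| succeq_refl : succeq w w
| succeq_merge w' j :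
    succeq w w' -> (j.+1 < size w')%N -> succeq w (elem_merge j w')
| succeq_insert w' j :
    succeq w w' -> (j <= size w')%N -> succeq w (elem_insert j w').

Definition Omega_below (d : nat) (what : seq nat) : set (seq nat) :=
  [set w | Omega_le d w /\ succeq what w].

Definition omega_star (d : nat) : seq nat := [:: d].

Lemma succeq_trans u v w : succeq u v -> succeq v w -> succeq u w.
Proof.
move=> uv; elim=> // w1 j _ IH lt_j; first exact: succeq_merge.
exact: succeq_insert.
Qed.

Lemma succeq_inserts n w : succeq w (nseq n 2 ++ w).
Proof.
elim: n => [|n IHn]; first exact: succeq_refl.
have := @succeq_insert w (nseq n 2 ++ w) 0 IHn (leq0n _).
by rewrite /elem_insert take0 drop0.
Qed.

Lemma succeq_sum a w : succeq (a :: w) [:: sumn (a :: w)].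
Proof.
elim: w a => [|b w IHw] a; first by rewrite /= addn0; exact: succeq_refl.
have step := @succeq_merge (a :: b :: w) (a :: b :: w) 0 (succeq_refl _) isT.
move: step; rewrite /elem_merge /= drop0 => step.
by apply: succeq_trans step _; rewrite /= addnA; exact: (IHw (a + b)%N).
Qed.

Lemma omega_star_min d w : (0 < d)%N -> Omega_le d w ->
  Omega_le d (omega_star d) /\ succeq w (omega_star d).
Proof.
move=> d_gt0 [_ le_wd par]; split; first by split; rewrite //= ?andbT ?addn0.
pose n := ((d - sumn w)./2)%N.
have dE : d = sumn (nseq n 2 ++ w).
  rewrite sumn_cat sumn_nseq mul2n /n -[in LHS](subnK le_wd).
  rewrite -[in LHS](odd_double_half (d - sumn w)) oddB //.
  move: par; rewrite !modn2; case: (odd d); case: (odd (sumn w)) => //.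
apply: succeq_trans (succeq_inserts n w) _; move: dE.
case: (nseq n 2 ++ w) => [dE|a v ->]; first by rewrite dE in d_gt0.
exact: succeq_sum.
Qed.

Section SymmetricPower.
Local Open Scope quotient_scope.
Context (m : nat) (Y : topologicalType).

Definition sym_rel (u v : 'rV[Y]_m) : bool :=
  [exists s : 'S_m, v == col_perm s u].

Lemma sym_rel_refl : reflexive sym_rel.
Proof. by move=> u; apply/existsP; exists 1%g; rewrite col_perm1. Qed.

Lemma sym_rel_sym : symmetric sym_rel.
Proof.
suff H u v : sym_rel u v -> sym_rel v u by move=> u v; apply/idP/idP; apply: H.
move=> /existsP[s /eqP->]; apply/existsP; exists s^-1%g.
by rewrite -col_permM mulVg col_perm1.
Qed.

Lemma sym_rel_trans : transitive sym_rel.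
Proof.
move=> v u x /existsP[s /eqP->] /existsP[t /eqP->]; apply/existsP.
by exists (t * s)%g; rewrite col_permM.
Qed.

Definition sym_equiv := EquivRel sym_rel sym_rel_refl sym_rel_sym sym_rel_trans.

Definition SymPow := {eq_quot sym_equiv}.
HB.instance Definition _ := Topological.copy SymPow (quotient_topology SymPow).
HB.instance Definition _ := Quotient.on SymPow.

(* The points of a divisor, listed with multiplicity; the order of the list is
   that of a chosen representative. *)
Definition points (D : SymPow) : seq Y := [seq repr D 0 j | j <- enum 'I_m].

(* The subspace topology on this set is the quotient topology of A^m / S_m. *)
Definition Sym_in (A : set Y) : set SymPow :=
  [set D | forall z, z \in points D -> A z].

End SymmetricPower.

Section Topology.
Context {R : realType}.

Definition dotp n (x y : 'rV[R]_n) : R := \sum_i x 0 i * y 0 i.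

(* the Euclidean unit balls; the library norm on row vectors is the sup norm *)
Definition eball n : set 'rV[R]_n := [set x | dotp x x < 1].
Definition eclosed_ball n : set 'rV[R]_n := [set x | dotp x x <= 1].

Arguments eball : clear implicits.
Arguments eclosed_ball : clear implicits.

Definition cell_domain n (B : set 'rV[R]_n) : Prop :=
  B = eclosed_ball n \/
  exists2 u : 'rV[R]_n, u != 0 &
    B = eball n `|` [set x | dotp x x = 1 /\ 0 < dotp u x].

Definition is_homeo (T U : topologicalType) (A : set T) (B : set U)
    (f : T -> U) : Prop :=
  [/\ set_bij A B f, {within A, continuous f} &
      exists2 g : U -> T, {within B, continuous g}
                        & forall x, A x -> g (f x) = x].

Definition homeomorphic (T U : topologicalType) (A : set T) (B : set U) :=
  exists f : T -> U, is_homeo A B f.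

Record cellular_structure (T : topologicalType) (Z : set T)
    (I : Type) (J : set I) (cell : I -> set T) (dim : I -> nat)
    (B : forall i, set 'rV[R]_(dim i)) (phi : forall i, 'rV[R]_(dim i) -> T)
    : Prop := {
  cs_hausdorff : hausdorff_space (subspace Z);
  cs_cover : \bigcup_(i in J) cell i = Z;
  cs_disjoint : trivIset J cell;
  cs_domain : forall i, J i -> cell_domain (B i);
  cs_interior : forall i, J i -> is_homeo (eball (dim i)) (cell i) (phi i);
  cs_continuous : forall i, J i -> {within B i, continuous (phi i)};
  cs_image : forall i, J i -> phi i @` B i `<=` Z;
  cs_boundary : forall i, J i -> exists F : set I,
    [/\ finite_set F, F `<=` J, forall j, F j -> (dim j < dim i)%N &
        phi i @` (B i `\` eball (dim i)) `<=` \bigcup_(j in F) cell j];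
  cs_weak : forall Y : set T, Y `<=` Z ->
    (forall i, J i -> closed (B i `&` phi i @^-1` (Y `&` phi i @` B i)
                              : set (subspace (B i)))) ->
    closed (Y : set (subspace Z)) }.

(* X is the open cone with base S and apex O: c collapses S * {0} to O and
   identifies nothing else, and X carries the quotient topology.  Adding [set O]
   makes the cone over the empty base a point. *)
Record is_open_cone (T : topologicalType) (X S : set T) (O : T)
    (c : T * R -> T) : Prop := {
  cone_continuous : {within S `*` [set s | 0 <= s], continuous c};
  cone_apex : forall x, S x -> c (x, 0) = O;
  cone_surj : X = [set O] `|` c @` (S `*` [set s | 0 <= s]);
  cone_inj : set_inj (S `*` [set s | 0 < s]) c;
  cone_neq_apex : forall x s, S x -> 0 < s -> c (x, s) <> O;
  cone_quotient : forall Y : set T, Y `<=` X ->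
    closed (S `*` [set s | 0 <= s] `&` c @^-1` Y
            : set (subspace (S `*` [set s : R | 0 <= s]))) ->
    closed (Y : set (subspace X)) }.

Section Flows.
Context {d : nat}.
Local Notation V := 'rV[R]_d.

Definition velocity (Psi : R -> V -> V) (c : V) : V := 'D_1 (Psi ^~ c) 0.

Record is_flow (E : set V) (Psi : R -> V -> V) : Prop := {
  flow_stable : forall t c, E c -> E (Psi t c);
  flow_0 : forall c, E c -> Psi 0 c = c;
  flow_add : forall s t c, E c -> Psi (s + t) c = Psi s (Psi t c);
  flow_continuous :
    {within [set: R] `*` E, continuous (fun tc : R * V => Psi tc.1 tc.2)};
  flow_derivable : forall t c, E c -> derivable (Psi ^~ c) t 1;
  flow_velocity : {within E, continuous (velocity Psi)} }.

Definition is_source (E : set V) (Psi : R -> V -> V) (O : V) : Prop :=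
  (forall U, nbhs O U -> exists2 W, nbhs O W &
     forall t c, t <= 0 -> W c -> E c -> U (Psi t c)) /\
  (exists2 W, nbhs O W &
     forall c, W c -> E c -> Psi t c @[t --> -oo] --> O).

End Flows.
End Topology.
Arguments eball {R} n _.
Arguments eclosed_ball {R} n _.

Section Polynomials.
Context {R : realType}.
Local Notation C := (R[i]^o).

(* An effective divisor on C is the list of its points with multiplicity, only
   considered up to permutation; the sum of divisors is concatenation. *)

Definition balanced (alpha : R) (D : seq C) : Prop :=
  \sum_(z <- D) z = (alpha * (size D)%:R)%:C.

Definition conj_divisor (D : seq C) : seq C := [seq conjc z | z <- D].

(* R^d_coef: c stands for the polynomial z^d + \sum_(i < d) c_i z^i *)
Definition monic_of d (c : 'rV[R]_d) : {poly R} := 'X^d + rVpoly c.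

(* For a conjugation invariant divisor D of degree d the product below has real
   coefficients. *)
Definition viete d (D : seq C) : 'rV[R]_d :=
  \row_i complex.Re (\prod_(z <- D) ('X - z%:P))`_i.

Definition root_divisor (p : {poly R}) (D : seq C) : Prop :=
  map_poly (fun x : R => x%:C) p = \prod_(z <- D) ('X - z%:P).

(* R^{d-1}_{coef,alpha} inside R^d_coef *)
Definition coef_space d (alpha : R) : set 'rV[R]_d :=
  [set c | exists2 D, root_divisor (monic_of c) D & balanced alpha D].
Arguments coef_space : clear implicits.

Definition O_pt d (alpha : R) : 'rV[R]_d := poly_rV (('X - alpha%:P) ^+ d).
Arguments O_pt : clear implicits.

Definition comb_type (p : {poly R}) : seq nat := [seq mup x p | x <- rootsR p].

Definition stratum d (alpha : R) (w : seq nat) : set 'rV[R]_d :=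
  [set c | coef_space d alpha c /\ comb_type (monic_of c) = w].
Arguments stratum : clear implicits.

(* The Euclidean structure on R^{d-1}_{coef,alpha} is that of the coefficients
   with respect to the powers of z - alpha, the frame centred at O_pt alpha.
   In the frame of the powers of z no flow preserving the strata is transversal
   to all the round spheres: for d = 3 and alpha^2 > 24 the curve of polynomials
   with a multiple root is tangent to some round sphere centred at O_pt alpha. *)
Definition taylor d (alpha : R) (v : 'rV[R]_d) : 'rV[R]_d :=
  poly_rV (rVpoly v \Po ('X + alpha%:P)).

Definition dot_at d (alpha : R) (u v : 'rV[R]_d) : R :=
  dotp (taylor alpha u) (taylor alpha v).

Definition coef_sphere d (alpha r : R) : set 'rV[R]_d :=
  [set c | coef_space d alpha c /\
           dot_at alpha (c - O_pt d alpha) (c - O_pt d alpha) = r ^+ 2].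
Arguments coef_sphere : clear implicits.

(* The tangent space of a sphere of codimension 1 at c is the orthogonal of
   c - O_pt: transversality says that the velocity is not in it. *)
Definition transversal_to_sphere d (alpha r : R)
    (Psi : R -> 'rV[R]_d -> 'rV[R]_d) : Prop :=
  forall c, coef_sphere d alpha r c ->
    dot_at alpha (c - O_pt d alpha) (velocity Psi c) != 0.

Definition Hplane : set C := [set z | 0 <= complex.Im z].
Definition Hplane_int : set C := [set z | 0 < complex.Im z].

Definition Pi_cone p : set 'rV[R]_p :=
  [set y | forall i j : 'I_p, (i <= j)%N -> y 0 i <= y 0 j].
Definition Pi_cone_int p : set 'rV[R]_p :=
  [set y | forall i j : 'I_p, (i < j)%N -> y 0 i < y 0 j].

Definition real_divisor (w : seq nat) (y : 'rV[R]_(size w)) : seq C :=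
  flatten [seq nseq (nth 0%N w i) (y 0 i)%:C | i : 'I_(size w) <- enum 'I_(size w)].

Definition cell_ambient d (w : seq nat) : topologicalType :=
  ('rV[R]_(size w) * SymPow (d - sumn w)./2 C)%type.

Definition cell_divisor d (w : seq nat) (x : cell_ambient d w) : seq C :=
  real_divisor x.1 ++ points x.2 ++ conj_divisor (points x.2).

Definition cell_e d (alpha : R) (w : seq nat) : set (cell_ambient d w) :=
  [set x | [/\ Pi_cone x.1, Sym_in Hplane x.2
             & balanced alpha (cell_divisor x)]].
Arguments cell_e : clear implicits.

Definition cell_bd d (alpha : R) (w : seq nat) : set (cell_ambient d w) :=
  cell_e d alpha w `\`
  [set x : cell_ambient d w | Pi_cone_int x.1 /\ Sym_in Hplane_int x.2].
Arguments cell_bd : clear implicits.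

Definition Phi d (w : seq nat) (x : cell_ambient d w) : 'rV[R]_d :=
  viete d (cell_divisor x).
Arguments Phi : clear implicits.

(* The sets cell w (w in J) are the cells of a cellular structure on Z, each
   pair (e w, bd w) is homeomorphic to a standard pair (B, boundary of B), and
   the characteristic and attaching maps are the restrictions of Phi to e w and
   bd w. *)
Definition cellular_via_Phi d (Z : set 'rV[R]_d) (J : set (seq nat))
    (cell : seq nat -> set 'rV[R]_d) (dim : seq nat -> nat)
    (e bd : forall w, set (cell_ambient d w)) : Prop :=
  exists (B : forall w, set 'rV[R]_(dim w))
         (h : forall w, 'rV[R]_(dim w) -> cell_ambient d w),
    (forall w, J w ->
       is_homeo (B w) (e w) (h w) /\
       h w @` (B w `\` eball (dim w)) = bd w) /\
    @cellular_structure R _ Z _ J cell dim B (fun w => Phi d w \o h w).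

Definition strata_cellular d (alpha : R) (J : set (seq nat))
    (Z : set 'rV[R]_d) : Prop :=
  @cellular_via_Phi d Z J (stratum d alpha)
    (fun w => (d.-1 - norm_red w)%N)
    (fun w => cell_e d alpha w) (fun w => cell_bd d alpha w).

Definition sphere_cellular d (alpha r : R) (J : set (seq nat)) : Prop :=
  let S := coef_sphere d alpha r in
  @cellular_via_Phi d S J (fun w => stratum d alpha w `&` S)
    (fun w => (d.-2 - norm_red w)%N)
    (fun w => cell_e d alpha w `&` Phi d w @^-1` S)
    (fun w => cell_bd d alpha w `&` Phi d w @^-1` S).

(* the cone coordinate s > 0 corresponds to the time ln s of the flow *)
Definition flow_cone d (alpha : R) (Psi : R -> 'rV[R]_d -> 'rV[R]_d)
    (cs : 'rV[R]_d * R) : 'rV[R]_d :=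
  if cs.2 == 0 then O_pt d alpha else Psi (ln cs.2) cs.1.

End Polynomials.
Arguments coef_space {R} d alpha _.
Arguments O_pt {R} d alpha.
Arguments stratum {R} d alpha w _.
Arguments coef_sphere {R} d alpha r _.
Arguments cell_e {R} d alpha w _.
Arguments cell_bd {R} d alpha w _.
Arguments Phi {R} d w x.
Arguments strata_cellular {R} d alpha J Z.
Arguments sphere_cellular {R} d alpha r J.

(* Main.v *)
Require Import Defs.
From HB Require Import structures.
From mathcomp Require Import all_boot all_order all_algebra all_fingroup.
From mathcomp Require Import all_classical all_reals all_analysis.
From mathcomp Require Import generic_quotient complex polyrcf.
From mathcomp Require Import ring lra zify.

(* A point of the open cell of w is a strictly increasing tuple of real points
   together with m points of the open upper half plane.  Let spread_t move the
   i-th real point by i t and every other point by i t upwards, corrected by a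
   real translation that keeps the divisor balanced.  The margin
   min (y_(i+1) - y_i, Im z_j), which is nonnegative on the closed cell and
   positive on the open one, and a linear coordinate (the mean of Im z_j, or a
   gap) both grow at speed 1 along spread; sliding along spread by their
   difference is therefore a homeomorphism of the space of all balanced pairs,
   which by Viete is a Euclidean space, taking the closed cell to a half space
   and the open cell to its interior.  Everything commutes with the dilations of
   the points about alpha, which act on the coefficients in the frame centred at
   O_alpha by weighted dilations; these give the flow, the cone structure, and,
   by sliding along their orbits, the closed cells of the sphere.  The
   characteristic maps are proper because the coefficients of a monic polynomial
   bound its roots, whence the closures and the weak topology. *)

Set Implicit Arguments.
Unset Strict Implicit.
Unset Printing Implicit Defensive.

Import Order.TTheory GRing.Theory Num.Theory numFieldNormedType.Exports.

Local Open Scope classical_set_scope.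
Local Open Scope ring_scope.

(** * Topology and continuity *)

Section GeneralTopology.

(** The obstacle is that a closed cell, cut by the balance condition out of a cone times the
    symmetric power of a half plane, has no evident convex model, so no radial argument shows that
    it is a ball. The slide by the difference of margin and linear coordinate avoids convexity: it
    uses only that both grow at the same rate along a free action of the line. The slide needs a gap
    or an imaginary part to measure. For d > 0 the only cell with neither is that of (d), a single
    point, which is treated apart. A boundary point of a cell has two coinciding real points, or a
    point of D'' on the real axis. The first is a merge. In the second, z and its conjugate collide
    in a double real root, which is where the entry 2 of an insert comes from. Each step raises the
    codimension by one, so boundaries fall into cells of smaller dimension. *)

Lemma cvg_mx (T : Type) (F : set_system T) (U : topologicalType) m n
    (f : T -> 'M[U]_(m, n)) (M : 'M[U]_(m, n)) : Filter F ->
  (forall i j, (fun x => f x i j) @ F --> M i j) -> f @ F --> M.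
Proof.
move=> FF cf A [P M_P PA]; apply: (filterS (P := fun x => forall i j, P i j (f x i j))).
  by move=> x Px; exact: PA.
by apply: filter_forall => i; apply: filter_forall => j; exact: cf.
Qed.

Lemma continuous_mx (T U : topologicalType) m n (f : T -> 'M[U]_(m, n)) :
  (forall i j, continuous (fun x => f x i j)) -> continuous f.
Proof. by move=> cf x; apply: cvg_mx => i j; exact: cf. Qed.

Lemma continuous_mx_at (T U : topologicalType) m n (f : T -> 'M[U]_(m, n)) x :
  (forall i j, {for x, continuous (fun x => f x i j)}) -> {for x, continuous f}.
Proof. by move=> cf; apply: cvg_mx => i j; exact: cf. Qed.

Lemma continuous_coord (U : topologicalType) m n i j :
  continuous (fun M : 'M[U]_(m, n) => M i j).
Proof.
move=> M A MA.
exists (fun i' j' => if (i' == i) && (j' == j) then A else setT).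
  move=> i' j'; case: ifP => [/andP[/eqP-> /eqP->]//|_]; exact: filterT.
by move=> N /(_ i j); rewrite !eqxx.
Qed.

Lemma continuous_pair (S T U : topologicalType) (f : S -> T) (g : S -> U) :
  continuous f -> continuous g -> continuous (fun x => (f x, g x)).
Proof. by move=> cf cg x; exact: (cvg_pair (cf x) (cg x)). Qed.

Lemma continuous_fst (T U : topologicalType) : continuous (@fst T U).
Proof. by move=> x; exact: cvg_fst. Qed.

Lemma continuous_snd (T U : topologicalType) : continuous (@snd T U).
Proof. by move=> x; exact: cvg_snd. Qed.

Lemma continuous_comp_fun (S T U : topologicalType) (f : S -> T) (g : T -> U) :
  continuous f -> continuous g -> continuous (fun x => g (f x)).
Proof. by move=> cf cg x; apply: continuous_comp; [exact: cf|exact: cg]. Qed.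

Lemma within_continuous_closedP (T U : topologicalType) (B : set T) (g : T -> U) :
  {within B, continuous g} <->
  (forall C : set U, closed C -> exists2 D, closed D & D `&` B = (g @^-1` C) `&` B).
Proof.
split.
  by move=> /continuous_closedP cg C cC; apply/closed_subspaceP; exact: (cg C cC).
by move=> H; apply/continuous_closedP => C cC; apply/closed_subspaceP; exact: H.
Qed.

(** Near u the image of A is that of the compact intersection of A and K, which is closed in a
    Hausdorff space. This local form of properness serves for Viete's map, for [Phi] and for the
    cone. *)
Lemma closed_image_proper (T U : topologicalType) (f : T -> U) (A : set T) :
    hausdorff_space U -> continuous f -> closed A ->
    (forall u : U, exists2 N : set U, nbhs u N &
       exists2 K : set T, compact K & A `&` f @^-1` N `<=` K) ->
  closed (f @` A).
Proof.
move=> hU cf cA prop u uc.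
have [N uN [K cK NK]] := prop u.
have cAK : compact (A `&` K) by rewrite setIC; apply: compact_closedI.
have cfAK : closed (f @` (A `&` K)).
  apply: compact_closed => //; apply: continuous_compact => //.
  exact: continuous_subspaceT.
suff [x [Ax _] <-] : (f @` (A `&` K)) u by exists x.
apply: cfAK => M uM.
have [_ [[x Ax <-] [Nx Mx]]] := uc _ (filterI uN uM).
by exists (f x); split=> //; exists x => //; split=> //; apply: NK.
Qed.

(** Sending relatively closed sets to relatively closed sets is continuity of the inverse; that
    inverse is chosen pointwise by [get]. *)
Lemma closed_map_homeo (T : ptopologicalType) (U : topologicalType) (A : set T)
    (B : set U) (f : T -> U) :
    set_bij A B f -> {within A, continuous f} ->
    (forall C, closed C -> exists2 D, closed D & D `&` B = f @` (C `&` A)) ->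
  is_homeo A B f.
Proof.
move=> bf cf clf; split=> //.
have [fAB fI fS] := bf.
pose g u : T := get (fun x => A x /\ f x = u).
have gK x : A x -> g (f x) = x.
  move=> Ax; have : exists y, A y /\ f y = f x by exists x.
  by move=> /getPex[Ag /fI]; apply; rewrite inE.
exists g => //; apply/within_continuous_closedP => C cC.
have [D cD DE] := clf C cC; exists D => //; rewrite DE.
apply/seteqP; split=> [_ [x [Cx Ax] <-]|u [/= Cgu /fS[x Ax xu]]].
  by split=> /=; [rewrite gK|exact: fAB].
by exists x => //; split=> //; rewrite -(gK x) // xu.
Qed.

Lemma is_homeo_closed_image (T U : topologicalType) (A : set T) (B : set U)
    (f : T -> U) (C : set T) : is_homeo A B f -> closed B -> closed C ->
  closed (f @` (C `&` A)).
Proof.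
move=> [[fAB fI fS] _ [g cg gK]] cB cC.
have [D cD DE] := (within_continuous_closedP B g).1 cg C cC.
suff -> : f @` (C `&` A) = D `&` B by exact: closedI.
rewrite DE; apply/seteqP; split=> [_ [x [Cx Ax] <-]|u [/= Cgu /fS[x Ax xu]]].
  by split=> /=; [rewrite gK|exact: fAB].
by exists x => //; split=> //; rewrite -(gK x) // xu.
Qed.

Lemma is_homeo_inverse (T U : topologicalType) (A : set T) (B : set U)
    (f : T -> U) (g : U -> T) :
    (forall x, A x -> B (f x)) -> (forall u, B u -> A (g u)) ->
    (forall x, A x -> g (f x) = x) -> (forall u, B u -> f (g u) = u) ->
    {within A, continuous f} -> {within B, continuous g} ->
  is_homeo A B f.
Proof.
move=> AB BA gK fK cf cg; split=> //; last by exists g.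
split=> //.
  move=> x y; rewrite !inE => Ax Ay E.
  by rewrite -(gK x) // -(gK y) // E.
by move=> u Bu; exists (g u); [exact: BA|exact: fK].
Qed.

End GeneralTopology.

Section Arithmetic.
Context {K : numFieldType} {T : topologicalType}.
Implicit Types f g : T -> K^o.

Lemma continuous_add f g :
  continuous f -> continuous g -> continuous (fun x => f x + g x : K^o).
Proof. by move=> cf cg x; apply: (@cvgD K K^o); [exact: cf|exact: cg]. Qed.

Lemma continuous_opp f : continuous f -> continuous (fun x => - f x : K^o).
Proof. by move=> cf x; apply: (@cvgN K K^o); exact: cf. Qed.

Lemma continuous_sub f g :
  continuous f -> continuous g -> continuous (fun x => f x - g x : K^o).
Proof. by move=> cf cg; apply: continuous_add => //; exact: continuous_opp. Qed.

Lemma continuous_mul f g :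
  continuous f -> continuous g -> continuous (fun x => f x * g x : K^o).
Proof. by move=> cf cg x; apply: cvgM; [exact: cf|exact: cg]. Qed.

Lemma continuous_exp f n : continuous f -> continuous (fun x => f x ^+ n : K^o).
Proof.
move=> cf; elim: n => [|n IHn]; first by move=> x; exact: cvg_cst.
by under eq_fun do rewrite exprS; exact: continuous_mul.
Qed.

Lemma continuous_sum I (r : seq I) (P : pred I) (F : I -> T -> K^o) :
  (forall i, continuous (F i)) -> continuous (fun x => \sum_(i <- r | P i) F i x : K^o).
Proof.
move=> cF; elim: r => [|i r IHr].
  by under eq_fun do rewrite big_nil; move=> x; exact: cvg_cst.
under eq_fun do rewrite big_cons.
by case: (P i) => //; apply: continuous_add.
Qed.

End Arithmetic.

Section RealFunctions.
Context {R : realType} {T : topologicalType}.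
Implicit Types f g : T -> R.

Lemma continuous_minr f g :
  continuous f -> continuous g -> continuous (fun x => Num.min (f x) (g x)).
Proof. by move=> cf cg x; apply: continuous_min; [exact: cf|exact: cg]. Qed.

Lemma closed_le_fun f g : continuous f -> continuous g -> closed [set x | f x <= g x].
Proof.
move=> cf cg.
have -> : [set x | f x <= g x] = (fun x => g x - f x) @^-1` [set y | 0 <= y].
  by apply/seteqP; split=> x /=; rewrite subr_ge0.
apply: closed_comp; last exact: closed_ge.
by move=> x _; apply: (continuous_sub (K := R)).
Qed.

Lemma closed_eq_fun f g : continuous f -> continuous g -> closed [set x | f x = g x].
Proof.
move=> cf cg.
have -> : [set x | f x = g x] = [set x | f x <= g x] `&` [set x | g x <= f x].
  apply/seteqP; split=> x /=; first by move=> ->.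
  by move=> [? ?]; apply/eqP; rewrite eq_le; apply/andP.
by apply: closedI; exact: closed_le_fun.
Qed.

End RealFunctions.

(** * The complex line as a real plane *)

Section ComplexTopology.
Context {R : realType}.
Local Open Scope complex_scope.
Local Notation C := (R[i]^o).

Lemma complex_normE (z : R[i]) : `|z| = (Normc.normc z)%:C.
Proof. by []. Qed.

Lemma Re_le_normc (z : R[i]) : `|complex.Re z| <= Normc.normc z.
Proof. by have := normc_ge_Re z; rewrite complex_normE lecR. Qed.

Lemma Im_le_normc (z : R[i]) : `|complex.Im z| <= Normc.normc z.
Proof.
case: z => a b /=; rewrite -sqrtr_sqr ler_wsqrtr// lerDr sqr_ge0 //.
Qed.

Lemma normc_le_ReIm (z : R[i]) :
  Normc.normc z <= `|complex.Re z| + `|complex.Im z|.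
Proof.
case: z => a b /=; rewrite -(ger0_norm (addr_ge0 (normr_ge0 a) (normr_ge0 b))).
rewrite -sqrtr_sqr ler_wsqrtr// sqrrD !real_normK ?num_real//.
by rewrite addrAC lerDl mulrn_wge0// mulr_ge0.
Qed.

Lemma continuous_Re : continuous (fun z : C => complex.Re z : R).
Proof.
move=> z A /nbhs_ballP[e e0 eA].
apply/(@nbhs_ballP R[i] C); exists e%:C => /=; first by rewrite ltcR.
move=> w zw; apply: eA; move: zw; rewrite -!ball_normE /= complex_normE ltcR.
by apply: le_lt_trans; have := Re_le_normc (z - w); case: (z) (w) => [? ?] [? ?].
Qed.

Lemma continuous_Im : continuous (fun z : C => complex.Im z : R).
Proof.
move=> z A /nbhs_ballP[e e0 eA].
apply/(@nbhs_ballP R[i] C); exists e%:C => /=; first by rewrite ltcR.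
move=> w zw; apply: eA; move: zw; rewrite -!ball_normE /= complex_normE ltcR.
by apply: le_lt_trans; have := Im_le_normc (z - w); case: (z) (w) => [? ?] [? ?].
Qed.

Lemma continuous_Complex (T : topologicalType) (f g : T -> R) :
  continuous f -> continuous g -> continuous (fun x => f x +i* g x : C).
Proof.
move=> cf cg x A /(@nbhs_ballP R[i] C)[e e0 eA].
have eE : e = (complex.Re e)%:C by rewrite RRe_real // gtr0_real.
have {}e0 : 0 < complex.Re e / 2 by move: e0; rewrite /= ltcE => /andP[_ ?]; rewrite divr_gt0.
have /cvgrPdist_lt/(_ _ e0) hf := cf x.
have /cvgrPdist_lt/(_ _ e0) hg := cg x.
near=> y; apply: eA; rewrite -ball_normE /= eE complex_normE ltcR.
apply: le_lt_trans (normc_le_ReIm _) _ => /=.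
by rewrite (splitr (complex.Re e)) ltrD //; near: y.
Unshelve. all: by end_near. Qed.

Lemma continuous_conjc (T : topologicalType) (f : T -> C) :
  continuous f -> continuous (fun x => conjc (f x) : C).
Proof.
move=> cf.
have -> : (fun x => conjc (f x) : C) =
    (fun x => complex.Re (f x) +i* (- complex.Im (f x)) : C).
  by apply/funext => x; case: (f x).
apply: continuous_Complex.
  exact: (continuous_comp_fun cf continuous_Re).
apply: (continuous_opp (K := R)).
exact: (continuous_comp_fun cf continuous_Im).
Qed.

Definition cballs m (M : R) : set 'rV[C]_m :=
  [set u | forall j, `|complex.Re (u 0 j)| <= M /\ `|complex.Im (u 0 j)| <= M].

Lemma compact_rballs m (M : R) : compact [set u : 'rV[R]_m | forall j, `|u 0 j| <= M].
Proof.
apply: bounded_closed_compact.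
  exists (Num.max M 0); split; first exact: num_real.
  move=> N MN u /= hu; rewrite /Num.Def.normr /= mx_normrE.
  apply/bigmax_leP; split; first by rewrite (le_trans _ (ltW MN))// le_max lexx orbT.
  move=> [i j] _ /=; rewrite ord1 (le_trans (hu j)) // (le_trans _ (ltW MN)) //.
  by rewrite le_max lexx.
have -> : [set u : 'rV[R]_m | forall j, `|u 0 j| <= M] =
    \bigcap_(j : 'I_m) [set u : 'rV[R]_m | `|u 0 j| <= M].
  by apply/seteqP; split=> u /= hu j; [move=> _|]; apply: hu.
apply: closed_bigI => j _; apply: closed_le_fun; last exact: cst_continuous.
move=> u; apply: (@continuous_comp _ _ _ (fun u : 'rV[R]_m => u 0 j) Num.norm).
  exact: continuous_coord.
exact: norm_continuous.
Qed.

Lemma compact_cballs m (M : R) : compact (@cballs m M).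
Proof.
pose f (xy : 'rV[R]_m * 'rV[R]_m) : 'rV[C]_m := \row_j (xy.1 0 j +i* xy.2 0 j).
pose B := [set u : 'rV[R]_m | forall j, `|u 0 j| <= M].
have -> : @cballs m M = f @` (B `*` B).
  apply/seteqP; split=> [u hu|_ [[x y] [/= hx hy] <-] j].
    exists (\row_j complex.Re (u 0 j), \row_j complex.Im (u 0 j)).
      by split=> j /=; rewrite mxE; case: (hu j).
    by apply/rowP => j; rewrite !mxE; case: (u 0 j).
  by split; rewrite mxE /=; [exact: hx|exact: hy].
apply: continuous_compact; last by apply: compact_setX; exact: compact_rballs.
apply: continuous_subspaceT; apply: continuous_mx => i j.
under eq_fun do rewrite mxE.
apply: continuous_Complex.
  exact: (continuous_comp_fun (@continuous_fst _ _) (@continuous_coord _ _ _ _ _)).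
exact: (continuous_comp_fun (@continuous_snd _ _) (@continuous_coord _ _ _ _ _)).
Qed.

End ComplexTopology.

(** * Symmetric powers of the complex line *)

Section PolynomialFamilies.
Context {R : realType} {T : topologicalType}.
Local Open Scope complex_scope.
Local Notation C := (R[i]^o).

Definition continuous_coefs (F : T -> {poly R[i]}) :=
  forall k, continuous (fun x => (F x)`_k : C).

Lemma continuous_coefsM F G : continuous_coefs F -> continuous_coefs G ->
  continuous_coefs (fun x => F x * G x).
Proof.
move=> cF cG k; under eq_fun do rewrite coefM.
by apply: (continuous_sum (K := R[i])) => i; apply: (continuous_mul (K := R[i])).
Qed.

Lemma continuous_coefs_prod I (r : seq I) (F : I -> T -> {poly R[i]}) :
  (forall i, continuous_coefs (F i)) ->
  continuous_coefs (fun x => \prod_(i <- r) F i x).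
Proof.
move=> cF; elim: r => [|i r IHr] k.
  by under eq_fun do rewrite big_nil; exact: cst_continuous.
under eq_fun do rewrite big_cons.
exact: (continuous_coefsM (cF i) IHr).
Qed.

Lemma continuous_coefs_XsubC (f : T -> C) : continuous f ->
  continuous_coefs (fun x => 'X - (f x)%:P).
Proof.
move=> cf [|k].
  under eq_fun do rewrite coefB coefX coefC /= sub0r.
  exact: (continuous_opp (K := R[i])).
under eq_fun do rewrite coefB coefX coefC /= subr0.
exact: cst_continuous.
Qed.

End PolynomialFamilies.

(** * Bounding roots by coefficients *)

Section RootBound.
Context {R : realType}.
Import Normc.

Lemma normc_ge0 (z : R[i]) : 0 <= normc z.
Proof. by case: z => a b; exact: sqrtr_ge0. Qed.

Lemma normcX (z : R[i]) n : normc (z ^+ n) = normc z ^+ n.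
Proof.
elim: n => [|n IHn]; first by rewrite !expr0 normc1.
by rewrite !exprS normcM IHn.
Qed.

Lemma normc_sum n (F : 'I_n -> R[i]) : normc (\sum_i F i) <= \sum_i normc (F i).
Proof.
elim/big_rec2: _ => [|i x y _ le_xy]; first by rewrite normc0.
by apply: le_trans (le_normcD _ _) _; rewrite lerD2l.
Qed.

(** Cauchy's bound. Beyond it, z^n, which is minus the sum of the lower terms, would exceed n M
    |z|^(n-1), the largest value that sum can have. *)
Lemma root_bound (s : seq R[i]) (M : R) z : z \in s ->
  (forall k, (k < size s)%N -> normc (\prod_(a <- s) ('X - a%:P))`_k <= M) ->
  normc z <= 1 + (size s)%:R * M.
Proof.
move=> zs bd; rewrite leNgt; apply/negP => big.
set p := \prod_(a <- s) ('X - a%:P) in bd.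
have s_gt0 : (0 < size s)%N by case: (s) zs.
have M0 : 0 <= M by apply: le_trans (bd _ s_gt0); exact: normc_ge0.
have z1 : 1 < normc z.
  by apply: le_lt_trans big; rewrite lerDl mulr_ge0.
have pz : p.[z] = 0 by apply/rootP; rewrite root_prod_XsubC.
have lp : p`_(size s) = 1.
  have := lead_coef_prod_XsubC s xpredT id.
  by rewrite /lead_coef size_prod_XsubC.
have zm : z ^+ size s = - \sum_(k < size s) p`_k * z ^+ k.
  move: pz; rewrite horner_coef size_prod_XsubC big_ord_recr /= lp mul1r.
  by move/eqP; rewrite addrC addr_eq0 => /eqP.
have : normc z ^+ size s <= (size s)%:R * M * normc z ^+ (size s).-1.
  rewrite -normcX zm normcN; apply: le_trans (normc_sum _) _.
  have -> : (size s)%:R * M * normc z ^+ (size s).-1 =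
      \sum_(k < size s) M * normc z ^+ (size s).-1.
    by rewrite sumr_const card_ord -mulrA mulr_natl.
  apply: ler_sum => k _; rewrite normcM normcX ler_pM ?normc_ge0 ?exprn_ge0 //.
  - exact: normc_ge0.
  - exact: bd.
  - by rewrite ler_weXn2l ?ltW // -ltnS prednK.
rewrite -{1}(prednK s_gt0) exprS ler_pM2r; last first.
  by rewrite exprn_gt0 // (lt_trans _ z1).
by move=> le_z; have := lt_le_trans big le_z; rewrite gtrDr ltr10.
Qed.

End RootBound.

(** Homogenization of the product in X - c and a. As nothing is divided by a, the coefficients
    depend polynomially on a and c and the value a = 0 is allowed. The formula gives both the
    continuity of affine motions of divisors and the weights of dilations. *)
Lemma prod_XsubC_affine (K : comNzRingType) (s : seq K) (a c : K) :
  \prod_(z <- s) ('X - (a * z + c)%:P) =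
  \sum_(k < (size s).+1)
    ((\prod_(z <- s) ('X - z%:P))`_k * a ^+ (size s - k)) *: ('X - c%:P) ^+ k.
Proof.
elim: s => [|z s IHs].
  by rewrite !big_nil big_ord1 coef1 !mul1r expr0 scale1r.
rewrite big_cons IHs /= !big_cons.
set q := \prod_(_ <- s) _; set n := size s; set Y := 'X - c%:P.
have -> : 'X - (a * z + c)%:P = Y - (a * z)%:P by rewrite polyCD /Y; ring.
have -> : \sum_(k < n.+2) ((('X - z%:P) * q)`_k * a ^+ (n.+1 - k)) *: Y ^+ k =
    \sum_(k < n.+2) ((if k == 0 :> nat then 0 else q`_k.-1) * a ^+ (n.+1 - k)) *: Y ^+ k
    - \sum_(k < n.+2) (z * q`_k * a ^+ (n.+1 - k)) *: Y ^+ k.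
  rewrite -sumrB; apply: eq_bigr => k _.
  by rewrite mulrBl coefB coefXM coefCM -scalerBl mulrBl.
rewrite mulrBl; congr (_ - _).
  rewrite [RHS]big_ord_recl /= mul0r scale0r add0r mulr_sumr.
  by apply: eq_bigr => k _; rewrite /bump /= add1n subSS exprS scalerAr.
rewrite [RHS]big_ord_recr /= [q`_n.+1]nth_default ?size_prod_XsubC //.
rewrite mulr0 mul0r scale0r addr0 mulr_sumr; apply: eq_bigr => k _.
rewrite subSn; last by rewrite -ltnS.
by rewrite mul_polyC scalerA exprS; congr (_ *: _); ring.
Qed.

Lemma eq_perm_eq (T : eqType) (s t : seq T) : s = t -> perm_eq s t.
Proof. by move=> ->. Qed.

Section SymmetricPowers.
Context {R : realType} {m : nat}.
Local Open Scope complex_scope.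
Local Open Scope quotient_scope.
Local Notation C := (R[i]^o).
Local Notation SP := (SymPow m C).
Implicit Types (D E : SP) (u v : 'rV[C]_m).

Definition row_points u : seq C := [seq u 0 j | j <- enum 'I_m].

Lemma size_row_points u : size (row_points u) = m.
Proof. by rewrite size_map size_enum_ord. Qed.

Lemma size_points D : size (points D) = m.
Proof. exact: size_row_points. Qed.

Lemma pi_eqP u v : reflect (\pi_SP u = \pi_SP v) (perm_eq (row_points u) (row_points v)).
Proof.
pose tp (w : 'rV[C]_m) : m.-tuple C := [tuple w 0 j | j < m].
have tpE w : row_points w = tp w by rewrite /row_points /= enumT.
rewrite !tpE perm_sym; apply: (iffP tuple_permP) => [[p /val_inj E]|].
  apply/eqmodP/existsP; exists p; apply/eqP/rowP => j; rewrite mxE.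
  by have := congr1 (fun t => tnth t j) E; rewrite !tnth_mktuple.
move=> /eqmodP/existsP[p /eqP->]; exists p.
by congr tval; apply: eq_from_tnth => j; rewrite !tnth_mktuple mxE.
Qed.

Lemma points_pi u : perm_eq (points (\pi_SP u)) (row_points u).
Proof. by apply/pi_eqP; rewrite reprK. Qed.

Lemma points_inj D E : perm_eq (points D) (points E) -> D = E.
Proof. by move=> /pi_eqP; rewrite !reprK. Qed.

Lemma sympow_continuous (Z : topologicalType) (f : SP -> Z) :
  continuous (f \o \pi_SP) -> continuous f.
Proof. by move=> cf; apply/(@quotient_continuous _ SP). Qed.

Lemma pi_sympow_continuous : continuous (\pi_SP : 'rV[C]_m -> SP).
Proof. exact: (@pi_continuous _ SP). Qed.

Lemma points_of_seq (s : seq C) : size s = m ->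
  exists D : SP, perm_eq (points D) s.
Proof.
move=> /eqP sm; exists (\pi_SP (\row_j tnth (Tuple sm) j)).
apply: perm_trans (points_pi _) _; rewrite /row_points.
apply: eq_perm_eq; rewrite -[RHS]/(tval (Tuple sm)) -[RHS]map_tnth_enum.
by apply: eq_map => j; rewrite mxE.
Qed.

(** The map acts on a chosen representative; [points_symmap] removes the dependence on the
    choice. *)
Definition symmap (g : C -> C) D : SP := \pi_SP (map_mx g (repr D)).

Lemma points_symmap g D : perm_eq (points (symmap g D)) (map g (points D)).
Proof.
apply: perm_trans (points_pi _) _; rewrite /row_points /points.
by apply: eq_perm_eq; rewrite -[RHS]map_comp; apply: eq_map => j; rewrite mxE.
Qed.

Lemma symmap_comp g h D : symmap g (symmap h D) = symmap (g \o h) D.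
Proof.
apply: points_inj; rewrite (permPl (points_symmap _ _)).
by rewrite perm_sym (permPl (points_symmap _ _)) map_comp perm_map // perm_sym points_symmap.
Qed.

Lemma eq_symmap g h D : g =1 h -> symmap g D = symmap h D.
Proof. by move=> gh; congr symmap; exact/funext. Qed.

Lemma symmap_id D : symmap id D = D.
Proof. by apply: points_inj; rewrite (permPl (points_symmap _ _)) map_id. Qed.

Definition sympoly D : {poly R[i]} := \prod_(z <- points D) ('X - z%:P).

Lemma sympoly_pi u : sympoly (\pi_SP u) = \prod_(j < m) ('X - (u 0 j)%:P).
Proof.
by rewrite /sympoly (perm_big _ (points_pi u)) big_map big_enum.
Qed.

Lemma sympoly_inj D E : sympoly D = sympoly E -> D = E.
Proof. by move=> /prod_XsubC_eq; exact: points_inj. Qed.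

Lemma continuous_sympoly : continuous_coefs sympoly.
Proof.
move=> k; apply: sympow_continuous.
have -> : (fun D => (sympoly D)`_k : C) \o \pi_SP =
    (fun u : 'rV[C]_m => (\prod_(j < m) ('X - (u 0 j)%:P))`_k : C).
  by apply/funext => u /=; rewrite sympoly_pi.
apply: continuous_coefs_prod => j; apply: continuous_coefs_XsubC.
exact: continuous_coord.
Qed.

(** Viete's map for complex divisors, split into real and imaginary parts of the non-leading
    coefficients. *)
Definition symV D : 'rV[R]_m * 'rV[R]_m :=
  (\row_k complex.Re (sympoly D)`_k, \row_k complex.Im (sympoly D)`_k).

Lemma continuous_symV : continuous symV.
Proof.
apply: continuous_pair; apply: continuous_mx => i k; under eq_fun do rewrite mxE.
  exact: (continuous_comp_fun (@continuous_sympoly k) continuous_Re).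
exact: (continuous_comp_fun (@continuous_sympoly k) continuous_Im).
Qed.

Definition monic_seq (ab : 'rV[R]_m * 'rV[R]_m) : {poly R[i]} :=
  'X^m + \poly_(k < m) (if insub k is Some j then ab.1 0 j +i* ab.2 0 j else 0).

Lemma coef_monic_seq ab (k : 'I_m) : (monic_seq ab)`_k = ab.1 0 k +i* ab.2 0 k.
Proof.
rewrite coefD coefXn (ltn_eqF (ltn_ord k)) add0r coef_poly ltn_ord.
by rewrite insubT //= => lt; congr (_ +i* _); congr (_ _ _); apply: val_inj.
Qed.

Lemma size_monic_seq ab : size (monic_seq ab) = m.+1.
Proof. by rewrite size_polyDl size_polyXn // ltnS size_poly. Qed.

Lemma monic_seq_monic ab : monic_seq ab \is monic.
Proof.
by rewrite monicE lead_coefDl ?lead_coefXn // size_polyXn ltnS size_poly.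
Qed.

Lemma size_sympoly D : size (sympoly D) = m.+1.
Proof. by rewrite /sympoly size_prod_XsubC size_points. Qed.

Lemma coef_sympoly_m D : (sympoly D)`_m = 1.
Proof.
have := lead_coef_prod_XsubC (points D) xpredT id.
by rewrite /lead_coef -/(sympoly D) size_sympoly.
Qed.

Lemma monic_seq_symV D : monic_seq (symV D) = sympoly D.
Proof.
apply/polyP => k; have [lt_km|] := ltnP k m.
  by rewrite (coef_monic_seq _ (Ordinal lt_km)) !mxE /=; case: (_`_k).
rewrite leq_eqVlt => /orP[/eqP<-|lt_mk].
  by rewrite coef_sympoly_m coefD coefXn eqxx coef_poly ltnn addr0.
by rewrite !nth_default // ?size_sympoly // size_monic_seq.
Qed.

Lemma symV_inj : injective symV.
Proof. by move=> D E /(congr1 monic_seq); rewrite !monic_seq_symV => /sympoly_inj. Qed.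

Lemma symV_surj ab : exists D, symV D = ab.
Proof.
have [s Es] := closed_field_poly_normal (monic_seq ab).
rewrite (monicP (monic_seq_monic ab)) scale1r in Es.
have ss : size s = m.
  by have := size_monic_seq ab; rewrite Es size_prod_XsubC => -[].
have [D sD] := points_of_seq ss; exists D.
have pE : sympoly D = monic_seq ab by rewrite /sympoly (perm_big _ sD) Es.
rewrite [ab]surjective_pairing; congr pair; apply/rowP => k.
  by rewrite mxE pE coef_monic_seq.
by rewrite mxE pE coef_monic_seq.
Qed.

Definition symW ab : SP := projT1 (cid (symV_surj ab)).

Lemma symWK ab : symV (symW ab) = ab. Proof. by rewrite /symW; case: cid. Qed.

Lemma symVK D : symW (symV D) = D.
Proof. by apply: symV_inj; rewrite symWK. Qed.

Lemma sympoly_symW ab : sympoly (symW ab) = monic_seq ab.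
Proof. by rewrite -monic_seq_symV symWK. Qed.

(* Viete's map is proper on C^m since the coefficients bound the roots, so it
   is closed. *)
Lemma continuous_symW : continuous symW.
Proof.
apply/continuous_closedP => F cF.
pose f u := symV (\pi_SP u).
have -> : symW @^-1` F = f @` ((\pi_SP : 'rV[C]_m -> SP) @^-1` F).
  apply/seteqP; split=> [ab /= Fab|_ [u /= Fu <-]]; last by rewrite /f symVK.
  by exists (repr (symW ab)); rewrite /= /f reprK ?symWK.
apply: closed_image_proper.
- exact: norm_hausdorff.
- exact: (continuous_comp_fun pi_sympow_continuous continuous_symV).
- by move: F cF; apply/continuous_closedP; exact: pi_sympow_continuous.
move=> ab; pose M := `|ab| + 1.
exists (ball ab 1); first exact: nbhsx_ballx.
exists (@cballs R m (1 + m%:R * (M + M))); first exact: compact_cballs.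
move=> u [_ /=]; rewrite -ball_normE /= => abu j.
have fM : `|f u| <= M.
  rewrite -[f u](subKr ab) (le_trans (ler_normB _ _)) // lerD2l.
  exact: ltW.
suff : Normc.normc (u 0 j) <= 1 + m%:R * (M + M).
  by split; [exact: le_trans (Re_le_normc _) _|exact: le_trans (Im_le_normc _) _].
have := @root_bound R (row_points u) (M + M) (u 0 j).
rewrite size_row_points; apply; first by apply: map_f; rewrite mem_enum.
move=> k lt_km; rewrite big_map big_enum /= -sympoly_pi.
apply: le_trans (normc_le_ReIm _) _.
have [f1 f2] : `|(f u).1| <= M /\ `|(f u).2| <= M.
  by move: fM; rewrite prod_normE ge_max => /andP[].
have coordM (x : 'rV[R]_m) : `|x| <= M -> `|x 0 (Ordinal lt_km)| <= M.
  apply: le_trans; rewrite /Num.Def.normr /= mx_normrE.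
  exact: (le_bigmax _ (fun i : 'I_1 * 'I_m => `|x i.1 i.2|) (ord0, Ordinal lt_km)).
apply: lerD.
  by have := coordM _ f1; rewrite mxE.
by have := coordM _ f2; rewrite mxE.
Qed.

(** By Viete's homeomorphism, a divisor varies continuously as soon as its elementary symmetric
    functions do; no continuous choice of representatives is needed. *)
Lemma continuous_into_sympow (T : topologicalType) (f : T -> SP) :
  continuous_coefs (fun x => sympoly (f x)) -> continuous f.
Proof.
move=> cf; have -> : f = symW \o (fun x => symV (f x)).
  by apply/funext => x /=; rewrite symVK.
move=> x; apply: continuous_comp; last exact: continuous_symW.
apply: continuous_pair; apply: continuous_mx => i k; under eq_fun do rewrite mxE.
  exact: (continuous_comp_fun (cf k) continuous_Re).
exact: (continuous_comp_fun (cf k) continuous_Im).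
Qed.

End SymmetricPowers.

Section AffineMaps.
Context {R : realType} {m : nat} {T : topologicalType}.
Local Open Scope complex_scope.
Local Notation C := (R[i]^o).

(** By [prod_XsubC_affine] the new coefficients are polynomials in a, c and the old coefficients.
    This gives joint continuity in the motion and the divisor, which sliding by a point-dependent
    time requires. *)
Lemma continuous_symmap_affine (a c : T -> C) (D : T -> SymPow m C) :
  continuous a -> continuous c -> continuous D ->
  continuous (fun x => symmap (fun z => a x * z + c x) (D x)).
Proof.
move=> ca cc cD; apply: continuous_into_sympow => k.
under eq_fun => x.
  rewrite /sympoly (perm_big _ (points_symmap _ _)) big_map prod_XsubC_affine.
  rewrite size_points -/(sympoly (D x)) coef_sum; over.
apply: (continuous_sum (K := R[i])) => i.
under eq_fun do rewrite coefZ.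
apply: (continuous_mul (K := R[i])).
  apply: (continuous_mul (K := R[i])).
    exact: (continuous_comp_fun cD (@continuous_sympoly _ _ i)).
  exact: (continuous_exp (K := R[i])).
have : continuous_coefs (fun x => \prod_(j < i) ('X - (c x)%:P)).
  by apply: continuous_coefs_prod => j; exact: continuous_coefs_XsubC.
by move=> /(_ k); under eq_fun do rewrite prodr_const card_ord.
Qed.

End AffineMaps.

(** * Root divisors *)

Section RootDivisors.
Context {R : realType}.
Local Open Scope complex_scope.
Local Notation C := (R[i]^o).
Implicit Types (D E : seq C) (p : {poly R}).

Lemma size_monic_of d (c : 'rV[R]_d) : size (monic_of c) = d.+1.
Proof. by rewrite size_polyDl size_polyXn // ltnS size_poly. Qed.

Lemma monic_of_monic d (c : 'rV[R]_d) : monic_of c \is monic.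
Proof. by rewrite monicE lead_coefDl ?lead_coefXn // size_polyXn ltnS size_poly. Qed.

Lemma coef_monic_of d (c : 'rV[R]_d) (i : 'I_d) : (monic_of c)`_i = c 0 i.
Proof. by rewrite coefD coefXn (ltn_eqF (ltn_ord i)) add0r coef_rVpoly_ord. Qed.

Lemma coef_monic_of_d d (c : 'rV[R]_d) : (monic_of c)`_d = 1.
Proof. by rewrite coefD coefXn eqxx [X in _ + X]nth_default ?addr0 // size_poly. Qed.

Lemma monic_of_inj d : injective (@monic_of R d).
Proof. by move=> c e E; apply/rowP => i; rewrite -!coef_monic_of E. Qed.

Lemma monic_of_surj d p : p \is monic -> size p = d.+1 ->
  p = monic_of (poly_rV p : 'rV[R]_d).
Proof.
move=> mp sp; apply/polyP => k; have [lt_kd|] := ltnP k d.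
  by rewrite (coef_monic_of _ (Ordinal lt_kd)) mxE.
rewrite leq_eqVlt => /orP[/eqP<-|lt_dk].
  by rewrite coef_monic_of_d; move/monicP: mp; rewrite /lead_coef sp.
by rewrite !nth_default ?sp ?size_monic_of.
Qed.

Lemma root_divisor_ex p : p \is monic -> exists D, root_divisor p D.
Proof.
move=> mp; have [D DE] := closed_field_poly_normal (map_poly (real_complex R) p).
have /monicP lp : map_poly (real_complex R) p \is monic by rewrite map_monic.
by exists D; rewrite /root_divisor {1}DE lp scale1r.
Qed.

Lemma root_divisor_perm p D E : root_divisor p D ->
  perm_eq D E <-> root_divisor p E.
Proof.
rewrite /root_divisor => ->; split; first exact: perm_big.
exact: prod_XsubC_eq.
Qed.

Lemma root_divisor_size p D : root_divisor p D -> size p = (size D).+1.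
Proof.
rewrite /root_divisor => rD; have := congr1 (fun q : {poly R[i]} => size q) rD.
by rewrite (size_map_poly (real_complex R)) size_prod_XsubC.
Qed.

Lemma root_divisor_inj p q D : root_divisor p D -> root_divisor q D -> p = q.
Proof.
rewrite /root_divisor => <- /esym; apply: (@map_inj_poly _ _ (real_complex R)).
  exact: complexI.
exact: rmorph0.
Qed.

Lemma root_divisor_conj p D : root_divisor p D -> perm_eq D (conj_divisor D).
Proof.
move=> rD; apply/(root_divisor_perm _ rD); move: rD; rewrite /root_divisor => rD.
rewrite big_map -(map_prod_XsubC (conjc : {rmorphism R[i] -> R[i]})) -rD.
rewrite -map_poly_comp; apply: eq_map_poly => x /=.
by rewrite oppr0.
Qed.

Lemma viete_root_divisor d (c : 'rV[R]_d) D :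
  root_divisor (monic_of c) D -> viete d D = c.
Proof.
move=> rD; apply/rowP => i; rewrite mxE.
by rewrite -[\prod_(z <- D) _]rD coef_map coef_monic_of.
Qed.

Lemma root_divisor_viete d D : size D = d -> perm_eq D (conj_divisor D) ->
  root_divisor (monic_of (viete d D)) D.
Proof.
move=> sD cD; pose q : {poly R[i]} := \prod_(z <- D) ('X - z%:P).
have qJ : map_poly (conjc : {rmorphism R[i] -> R[i]}) q = q.
  by rewrite /q (map_prod_XsubC (conjc : {rmorphism R[i] -> R[i]})) [RHS](perm_big _ cD) /= big_map.
have qR k : q`_k = (complex.Re q`_k)%:C.
  have := congr1 (fun r : {poly R[i]} => r`_k) qJ.
  rewrite /= coef_map /=; case: (q`_k) => a b /= -[/eqP].
  by rewrite eqNr => /eqP->.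
have szq : size q = d.+1 by rewrite /q size_prod_XsubC sD.
rewrite /root_divisor -/q; apply/polyP => k; rewrite (coef_map (real_complex R)) /=.
have [lt_kd|] := ltnP k d.
  by rewrite (coef_monic_of _ (Ordinal lt_kd)) mxE -/q -qR.
rewrite leq_eqVlt => /orP[/eqP<-|lt_dk].
  rewrite coef_monic_of_d; have := lead_coef_prod_XsubC D xpredT id.
  by rewrite /lead_coef -/q szq.
by rewrite !nth_default ?szq ?size_monic_of.
Qed.

Lemma balanced_perm alpha D E : perm_eq D E -> balanced alpha D -> balanced alpha E.
Proof. by rewrite /balanced => DE; rewrite (perm_big _ DE) (perm_size DE). Qed.

(** Root divisors of one polynomial are permutations of each other, so balance may be tested on any
    of them. *)
Lemma coef_spaceP d alpha (c : 'rV[R]_d) D : root_divisor (monic_of c) D ->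
  coef_space d alpha c <-> balanced alpha D.
Proof.
move=> rD; split; last by exists D.
by move=> [E rE]; apply: balanced_perm; exact: ((root_divisor_perm _ rE).2 rD).
Qed.

Lemma mem_rootsR p D x : p != 0 -> root_divisor p D ->
  (x \in rootsR p) = (x%:C \in D).
Proof.
move=> p0 rD; have /(_ x) := roots_on_rootsR p0.
rewrite inE /= => <-; rewrite -(root_prod_XsubC D) -[\prod_(_ <- _) _]rD.
by rewrite (fmorph_root (real_complex R)).
Qed.

(** Divisibility by a power of X - x is unaffected by the extension from the reals to the complex
    numbers, so the two multiplicities dominate each other. *)
Lemma mup_root_divisor p D x : p != 0 -> root_divisor p D ->
  mup x p = count_mem (x%:C : R[i]) D.
Proof.
move=> p0 rD; rewrite -mu_prod_XsubC -[\prod_(_ <- _) _]rD.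
have mp0 : map_poly (real_complex R) p != 0 by rewrite map_poly_eq0.
apply/eqP; rewrite eq_sym eqn_leq; apply/andP.
have dv n : (n <= mup x p)%N = (n <= mup (x%:C : R[i]) (map_poly (real_complex R) p))%N.
  rewrite !mup_geq // -(dvdp_map (real_complex R)) rmorphXn /=.
  by rewrite rmorphB /= map_polyX map_polyC.
by split; [rewrite dv|rewrite -dv].
Qed.

Lemma comb_type_root_divisor p D : p != 0 -> root_divisor p D ->
  comb_type p = [seq count_mem (x%:C : R[i]) D | x <- rootsR p].
Proof. by move=> p0 rD; apply: eq_map => x; exact: mup_root_divisor. Qed.

(** [real_divisor] over a list in place of a row vector, so that merges and inserts become
    manipulations of concatenations. *)
Definition rdiv (w : seq nat) (ys : seq R) : seq C :=
  flatten [seq nseq ky.1 (ky.2%:C : C) | ky <- zip w ys].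

Definition full_div w ys (zs : seq C) : seq C := rdiv w ys ++ zs ++ conj_divisor zs.

Lemma rdiv_cat w1 w2 y1 y2 : size w1 = size y1 ->
  rdiv (w1 ++ w2) (y1 ++ y2) = rdiv w1 y1 ++ rdiv w2 y2.
Proof. by move=> s1; rewrite /rdiv zip_cat // map_cat flatten_cat. Qed.

Lemma rdiv_cons k w y ys : rdiv (k :: w) (y :: ys) = nseq k (y%:C : C) ++ rdiv w ys.
Proof. by []. Qed.

Lemma size_rdiv w ys : size ys = size w -> size (rdiv w ys) = sumn w.
Proof.
elim: w ys => [|k w IHw] [|y ys] //= [] /IHw.
by rewrite rdiv_cons size_cat size_nseq => ->.
Qed.

Lemma conj_rdiv w ys : conj_divisor (rdiv w ys) = rdiv w ys.
Proof.
elim: w ys => [|k w IHw] [|y ys] //=; rewrite rdiv_cons /conj_divisor map_cat.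
by rewrite [X in _ ++ X]IHw map_nseq /= oppr0.
Qed.

Lemma conj_divisor_cat D E : conj_divisor (D ++ E) = conj_divisor D ++ conj_divisor E.
Proof. exact: map_cat. Qed.

Lemma conj_divisorK : involutive (@conj_divisor R).
Proof. by apply: mapK => z; exact: conjcK. Qed.

Lemma full_div_conj w ys zs : perm_eq (full_div w ys zs) (conj_divisor (full_div w ys zs)).
Proof.
rewrite /full_div !conj_divisor_cat conj_rdiv conj_divisorK perm_cat2l.
by rewrite perm_catC.
Qed.

Lemma size_full_div w ys zs : size ys = size w ->
  size (full_div w ys zs) = (sumn w + (size zs).*2)%N.
Proof.
by move=> sw; rewrite !size_cat size_map size_rdiv // addnn.
Qed.

Lemma mem_rdiv w ys z : all (fun k => 0 < k)%N w -> size ys = size w ->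
  (z \in rdiv w ys) = (z \in [seq (y%:C : C) | y <- ys]).
Proof.
elim: w ys => [|k w IHw] [|y ys] //= /andP[k0 w0] [sw].
by rewrite rdiv_cons mem_cat mem_nseq k0 /= inE IHw.
Qed.

Lemma Im_rdiv w ys z : z \in rdiv w ys -> complex.Im z = 0.
Proof.
elim: w ys => [|k w IHw] [|y ys] //; rewrite rdiv_cons mem_cat mem_nseq.
by move=> /orP[/andP[_ /eqP->]//|/IHw].
Qed.

Lemma count_rdiv (f : R -> nat) ys x : uniq ys ->
  count_mem (x%:C : C) (rdiv (map f ys) ys) = if x \in ys then f x else 0%N.
Proof.
elim: ys => //= y ys IHys /andP[yys uys]; rewrite rdiv_cons count_cat IHys //.
rewrite count_nseq /= inE (inj_eq (@complexI R)) eq_sym.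
have [->|_] /= := eqVneq x y; last by rewrite mul0n.
by rewrite (negPf yys) mul1n addn0.
Qed.

End RootDivisors.

(** * Degenerations of the combinatorial type *)

Section Representations.
Context {R : realType} {d : nat}.
Local Open Scope complex_scope.
Local Notation C := (R[i]^o).
Implicit Types (c : 'rV[R]_d) (w : seq nat) (ys : seq R) (zs : seq C).

(** Together with balance, [rep] describes the image of the closed cell of w and [srep] that of the
    open cell. Ties among the real points and real members of [zs] are what the weak inequalities
    admit. *)
Definition rep w c := exists ys zs, [/\ size ys = size w, sorted <=%R ys,
  all (fun z : C => 0 <= complex.Im z) zs & root_divisor (monic_of c) (full_div w ys zs)].

Definition srep w c := exists ys zs, [/\ size ys = size w, sorted <%R ys,
  all (fun z : C => 0 < complex.Im z) zs & root_divisor (monic_of c) (full_div w ys zs)].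

Definition positive w := all (fun k => 0 < k)%N w.

Lemma monic_of_neq0 c : monic_of c != 0.
Proof. exact: monic_neq0 (monic_of_monic c). Qed.

Lemma mem_full_div_real w ys zs x : positive w -> size ys = size w ->
  all (fun z : C => 0 < complex.Im z) zs ->
  ((x%:C : C) \in full_div w ys zs) = (x \in ys).
Proof.
move=> w0 sw /allP zs0; rewrite !mem_cat mem_rdiv // (mem_map (@complexI R)).
have -> : (x%:C : C) \in zs = false.
  by apply/negP => /zs0 /=; rewrite ltxx.
have -> : (x%:C : C) \in conj_divisor zs = false.
  apply/negP => /mapP[[a b] /zs0 /= b0 [_ /eqP]].
  by rewrite eq_sym oppr_eq0 => /eqP b00; rewrite b00 ltxx in b0.
by rewrite !orbF.
Qed.

Lemma count_full_div_real w ys zs x :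
  all (fun z : C => 0 < complex.Im z) zs ->
  count_mem (x%:C : C) (full_div w ys zs) = count_mem (x%:C : C) (rdiv w ys).
Proof.
move=> /allP zs0; rewrite !count_cat.
have -> : count_mem (x%:C : C) zs = 0%N.
  by apply/count_memPn/negP => /zs0 /=; rewrite ltxx.
have -> : count_mem (x%:C : C) (conj_divisor zs) = 0%N.
  apply/count_memPn/negP => /mapP[[a b] /zs0 /= b0 [_ /eqP]].
  by rewrite eq_sym oppr_eq0 => /eqP b00; rewrite b00 ltxx in b0.
by rewrite !addn0.
Qed.

Lemma srep_roots w c ys zs : positive w -> size ys = size w -> sorted <%R ys ->
  all (fun z : C => 0 < complex.Im z) zs ->
  root_divisor (monic_of c) (full_div w ys zs) -> rootsR (monic_of c) = ys.
Proof.
move=> w0 sw sy zs0 rD; apply: lt_sorted_eq => //; first exact: sorted_roots.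
by move=> x; rewrite (mem_rootsR _ (monic_of_neq0 c) rD) mem_full_div_real.
Qed.

Lemma srep_comb_type w c : positive w -> srep w c -> comb_type (monic_of c) = w.
Proof.
move=> w0 [ys [zs [sw sy zs0 rD]]].
rewrite (comb_type_root_divisor (monic_of_neq0 c) rD) (srep_roots w0 sw sy zs0 rD).
pose f x := nth 0%N w (index x ys).
have uy : uniq ys by exact: lt_sorted_uniq.
have wE : w = map f ys.
  apply: (@eq_from_nth _ 0%N); rewrite ?size_map // => i iw.
  by rewrite (nth_map 0) ?sw // /f index_uniq // sw.
rewrite [RHS]wE; apply/eq_in_map => x xys.
by rewrite count_full_div_real // {1}wE count_rdiv // xys.
Qed.

(** The real roots and the points above the axis determine the divisor: conjugation invariance
    supplies the points below. Multiplicities are compared at each point according to the sign of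
    its imaginary part. *)
Lemma comb_type_srep c : srep (comb_type (monic_of c)) c.
Proof.
have [D rD] := root_divisor_ex (monic_of_monic c).
exists (rootsR (monic_of c)), [seq z <- D | 0 < complex.Im z].
split; [by rewrite size_map|exact: sorted_roots|exact: filter_all|].
apply/(root_divisor_perm _ rD); rewrite (comb_type_root_divisor (monic_of_neq0 c) rD).
have cD z : count_mem (conjc z) D = count_mem z D.
  rewrite (seq.permP (root_divisor_conj rD)) count_map; apply: eq_count => x /=.
  by rewrite (inj_eq (inv_inj (@conjcK R))).
have uR : uniq (rootsR (monic_of c)) by apply: lt_sorted_uniq; exact: sorted_roots.
apply/allP => z _ /=; apply/eqP; rewrite !count_cat.
have cf x : count_mem x [seq z <- D | 0 < complex.Im z] =
    if 0 < complex.Im x then count_mem x D else 0%N.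
  case: ifPn => x0; last by apply/count_memPn; rewrite mem_filter negb_and x0.
  rewrite count_filter; apply: eq_count => y /=.
  by case: eqVneq => // ->; rewrite x0.
have cj x : count_mem x (conj_divisor [seq z <- D | 0 < complex.Im z]) =
    if complex.Im x < 0 then count_mem x D else 0%N.
  have -> : (complex.Im x < 0) = (0 < complex.Im (conjc x)).
    by case: x => a b /=; rewrite oppr_gt0.
  rewrite -[count_mem x D]cD -cf count_map; apply: eq_count => y /=.
  by rewrite -(inj_eq (inv_inj (@conjcK R))) conjcK.
have cr x v ys : complex.Im x != 0 -> count_mem x (rdiv v ys) = 0%N.
  by move=> xI; apply/count_memPn; apply: contra xI => /Im_rdiv ->.
rewrite cf cj; case: (ltgtP (complex.Im z) 0) => zI /=.
- by rewrite cr ?lt_eqF.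
- by rewrite addn0 cr ?gt_eqF.
case: z zI => x b /= ->; rewrite !addn0 count_rdiv // (mem_rootsR _ (monic_of_neq0 c) rD).
by case: ifPn => // /count_memPn.
Qed.

Lemma positive_comb_type c : positive (comb_type (monic_of c)).
Proof.
have [D rD] := root_divisor_ex (monic_of_monic c).
rewrite /positive (comb_type_root_divisor (monic_of_neq0 c) rD) all_map.
apply/allP => x /=; rewrite (mem_rootsR _ (monic_of_neq0 c) rD).
by rewrite -has_pred1 has_count.
Qed.

Lemma stratumP alpha w c : positive w ->
  stratum d alpha w c <-> coef_space d alpha c /\ srep w c.
Proof.
move=> w0; split=> -[cc]; first by move=> <-; split=> //; exact: comb_type_srep.
by split=> //; exact: srep_comb_type.
Qed.

Lemma srep_rep w c : srep w c -> rep w c.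
Proof.
move=> [ys [zs [sw sy /allP zs0 rD]]]; exists ys, zs; split=> //.
  by apply: sub_sorted sy => x y; exact: ltW.
by apply/allP => z /zs0 /ltW.
Qed.

Lemma rep_sum w c : rep w c -> exists m, d = (sumn w + m.*2)%N.
Proof.
move=> [ys [zs [sw sy _ rD]]]; exists (size zs).
have := root_divisor_size rD; rewrite size_monic_of => -[->].
exact: size_full_div.
Qed.

Lemma rep_Omega w c : positive w -> rep w c -> Omega_le d w.
Proof.
move=> w0 /rep_sum[m dE]; split=> //; rewrite dE; first exact: leq_addr.
by rewrite -muln2 addnC modnMDl.
Qed.

Lemma elem_mergeP w1 w2 a b :
  elem_merge (size w1) (w1 ++ a :: b :: w2) = w1 ++ (a + b)%N :: w2.
Proof.
rewrite /elem_merge take_size_cat // !nth_cat ltnn subnn ltnNge leqnSn /= subSnn /=.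
by rewrite drop_cat -[(size w1).+2]addn2 ltnNge leq_addr addKn /= drop0.
Qed.

Lemma elem_insertP w1 w2 : elem_insert (size w1) (w1 ++ w2) = w1 ++ 2 :: w2.
Proof. by rewrite /elem_insert take_size_cat // drop_size_cat. Qed.

Lemma merge_split j w : (j.+1 < size w)%N ->
  exists w1 w2 a b, w = w1 ++ a :: b :: w2 /\ size w1 = j.
Proof.
move=> jw; have jw' := ltnW jw.
exists (take j w), (drop j.+2 w), (nth 0%N w j), (nth 0%N w j.+1).
rewrite size_take jw'; split=> //.
by rewrite -!drop_nth // ?cat_take_drop.
Qed.

Lemma insert_split j w : (j <= size w)%N -> exists w1 w2, w = w1 ++ w2 /\ size w1 = j.
Proof.
by move=> jw; exists (take j w), (drop j w); rewrite cat_take_drop size_takel.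
Qed.

Lemma size_cat_split (T U : Type) (s : seq T) (t1 t2 : seq U) :
  size s = size (t1 ++ t2) ->
  exists s1 s2, [/\ s = s1 ++ s2, size s1 = size t1 & size s2 = size t2].
Proof.
move=> ss; exists (take (size t1) s), (drop (size t1) s).
rewrite cat_take_drop size_takel ?size_drop ss size_cat ?leq_addr //.
by rewrite addKn.
Qed.

Lemma sorted_dup (y1 y2 : seq R) y :
  sorted <=%R (y1 ++ y :: y2) = sorted <=%R (y1 ++ y :: y :: y2).
Proof. by case: y1 => [|x y1] /=; rewrite ?cat_path /= lexx. Qed.

(** A merged entry is the total multiplicity of two real points at the same place. *)
Lemma merge_full_div w1 w2 a b y1 y2 y zs : size y1 = size w1 ->
  full_div (w1 ++ (a + b)%N :: w2) (y1 ++ y :: y2) zs =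
  full_div (w1 ++ a :: b :: w2) (y1 ++ y :: y :: y2) zs.
Proof.
move=> s1; rewrite /full_div !rdiv_cat // !rdiv_cons.
by rewrite nseqD -!catA.
Qed.

(** A real y placed in [zs] occurs again as its own conjugate, which makes it a double real
    point. *)
Lemma insert_full_div w1 w2 y1 y2 y zs : size y1 = size w1 ->
  perm_eq (full_div (w1 ++ 2 :: w2) (y1 ++ y :: y2) zs)
          (full_div (w1 ++ w2) (y1 ++ y2) ((y%:C : C) :: zs)).
Proof.
move=> s1; rewrite /full_div !rdiv_cat // rdiv_cons /= oppr0.
apply/seq.permP => a; rewrite !count_cat /= !count_cat /= (_ : y +i* 0 = y%:C) //.
by move: (nat_of_bool _) (count _ _) (count _ _) (count _ _) (count _ _) => *; lia.
Qed.

Lemma rep_merge w j c : (j.+1 < size w)%N -> rep (elem_merge j w) c -> rep w c.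
Proof.
move=> /merge_split[w1 [w2 [a [b [-> <-]]]]]; rewrite elem_mergeP.
move=> [ys [zs [sw sy zs0 rD]]].
have [y1 [[|y y2] [ysE s1 s2]]] := size_cat_split sw => //.
exists (y1 ++ y :: y :: y2), zs; split=> //.
- by rewrite !size_cat s1 /=; case: s2 => ->.
- by rewrite -sorted_dup -ysE.
by rewrite -merge_full_div // -ysE.
Qed.

Lemma rep_insert w j c : (j <= size w)%N -> rep (elem_insert j w) c -> rep w c.
Proof.
move=> /insert_split[w1 [w2 [-> <-]]]; rewrite elem_insertP.
move=> [ys [zs [sw sy zs0 rD]]].
have [y1 [[|y y2] [ysE s1 s2]]] := size_cat_split sw => //.
exists (y1 ++ y2), ((y%:C : C) :: zs); split=> //.
- by rewrite !size_cat s1; case: s2 => ->.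
- apply: (subseq_sorted le_trans) sy; rewrite ysE.
  by apply: cat_subseq => //; exact: subseq_cons.
- by rewrite /= lexx.
by apply/(root_divisor_perm _ rD); rewrite ysE; exact: insert_full_div.
Qed.

(** Undoing a merge repeats a real point, and undoing an insert trades a double real point for a
    member of [zs] on the axis; both are allowed by [rep]. So the image of a closed cell contains
    the strata of all smaller types. *)
Lemma rep_succeq w w' c : succeq w w' -> rep w' c -> rep w c.
Proof.
elim=> // w1 j _ IHw lt_j rw; apply: IHw; first exact: rep_merge rw.
exact: rep_insert rw.
Qed.

Lemma sorted_le_split ys : sorted <=%R ys ->
  sorted <%R ys \/ exists y1 y y2, ys = y1 ++ y :: y :: y2.
Proof.
elim: ys => [|x ys IHys]; first by left.
move=> sx; have /IHys[sy|[y1 [y [y2 ->]]]] : sorted <=%R ys by exact: path_sorted sx.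
  case: ys sx sy {IHys} => [|y ys]; first by left.
  rewrite /= le_eqVlt => /andP[/orP[/eqP->|->] _]; last by left.
  by right; exists [::], y, ys.
by right; exists (x :: y1), y, y2.
Qed.

Lemma sorted_insertion ys x : sorted <=%R ys ->
  exists y1 y2, ys = y1 ++ y2 /\ sorted <=%R (y1 ++ x :: y2).
Proof.
elim: ys => [|y ys IHys] sy; first by exists [::], [::].
have [le_xy|lt_yx] := leP x y; first by exists [::], (y :: ys); rewrite /= le_xy.
have [y1 [y2 [ysE sx]]] := IHys (path_sorted sy).
exists (y :: y1), y2; split; first by rewrite ysE.
move: sy sx; rewrite ysE; case: y1 {ysE} => [|z y1] /=; first by rewrite (ltW lt_yx).
by move=> /andP[-> _].
Qed.

(** Positivity matters because [norm_red] sums truncated predecessors. *)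
Lemma norm_red_merge w1 w2 a b : positive (w1 ++ a :: b :: w2) ->
  norm_red (w1 ++ (a + b)%N :: w2) = (norm_red (w1 ++ a :: b :: w2)).+1.
Proof.
rewrite /positive all_cat /= => /and4P[_ a0 b0 _].
by rewrite /norm_red !big_cat !big_cons /=; lia.
Qed.

Lemma norm_red_insert w1 w2 : norm_red (w1 ++ 2 :: w2) = (norm_red (w1 ++ w2)).+1.
Proof. by rewrite /norm_red !big_cat !big_cons /=; lia. Qed.

(** The converse of [rep_succeq]: as long as the representation is degenerate, a tie is resolved by
    a merge and a point on the axis by an insert. Every such step raises [norm_red], which gives the
    dichotomy at the end. *)
Lemma rep_degenerate w c : positive w -> rep w c ->
  exists w', [/\ positive w', succeq w w', srep w' c &
    w' = w \/ (norm_red w < norm_red w')%N].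
Proof.
move=> w0 [ys [zs [sw sy zs0 rD]]].
(* A merge shortens w by one. An insert lengthens w by one but removes a point of [zs], hence the
   weight two on [zs]. *)
have [n] := ubnP (size w + (size zs).*2); elim: n => // n IHn in w w0 ys zs sw sy zs0 rD *.
rewrite ltnS => le_n.
(* Two real points coincide: apply a merge. *)
have [sys|[y1 [y [y2 ysE]]]] := sorted_le_split sy; last first.
  have sw' : size w = size (y1 ++ y :: y :: y2) by rewrite -ysE.
  have [w1 [[|a [|b w2]] [wE s1 s2]]] := size_cat_split sw' => //; subst w ys.
  case: s2 => s2.
  have [||||||w' [w'0 ww' sw'' nw']] := IHn (w1 ++ (a + b)%N :: w2) _ (y1 ++ y :: y2) zs.
  - by move: w0; rewrite /positive !all_cat /= => /and4P[-> a0 b0 ->]; rewrite addn_gt0 a0.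
  - by rewrite !size_cat /= s1 s2.
  - by rewrite sorted_dup.
  - by [].
  - by rewrite merge_full_div.
  - by move: le_n; rewrite !size_cat /=; lia.
  exists w'; split=> //.
    apply: succeq_trans ww'; rewrite -elem_mergeP; apply: succeq_merge.
      exact: succeq_refl.
    by rewrite size_cat /= !addnS !ltnS leq_addr.
  right; have := norm_red_merge w0; case: nw' => [->|]; lia.
have [zspos|/allPn[z zzs zn]] := boolP (all (fun z : C => 0 < complex.Im z) zs).
  by exists w; split=> //; [exact: succeq_refl|exists ys, zs|left].
(* A point of [zs] lies on the axis: turn it into a double real point by an insert at its place in
   the order. *)
have zI : complex.Im z = 0.
  by have /(_ z zzs) := allP zs0; rewrite le_eqVlt (negPf zn) orbF => /eqP.
have zE : z = ((complex.Re z)%:C : C) by case: z zI {zzs zn} => a b /= ->.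
have [y1 [y2 [ysE sy']]] := sorted_insertion (complex.Re z) sy.
have sw' : size w = size (y1 ++ y2) by rewrite -ysE.
have [w1 [w2 [wE s1 s2]]] := size_cat_split sw'; subst w ys.
have pz : perm_eq zs (z :: rem z zs) by exact: perm_to_rem.
have [||||||w' [w'0 ww' sw'' nw']] :=
    IHn (w1 ++ 2 :: w2) _ (y1 ++ complex.Re z :: y2) (rem z zs).
- by move: w0; rewrite /positive !all_cat.
- by rewrite !size_cat /= s1 s2.
- by [].
- by apply/allP => x /mem_rem; apply: (allP zs0).
- apply/(root_divisor_perm _ rD); rewrite perm_sym.
  apply: perm_trans (insert_full_div _ _ _ _ _) _; first by [].
  rewrite -zE /full_div perm_cat2l; apply: perm_cat; first by rewrite perm_sym.
  by apply: perm_map; rewrite perm_sym.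
- move: le_n; rewrite (perm_size pz) !size_cat /=; lia.
exists w'; split=> //.
  apply: succeq_trans ww'; rewrite -elem_insertP; apply: succeq_insert.
    exact: succeq_refl.
  by rewrite size_cat leq_addr.
right; have := norm_red_insert w1 w2; case: nw' => [->|]; lia.
Qed.

End Representations.

(** * The dilation flow *)

Lemma continuous_addv (R : realType) (T : topologicalType) (V : normedModType R)
    (f g : T -> V) :
  continuous f -> continuous g -> continuous (fun x => f x + g x).
Proof. by move=> cf cg x; apply: cvgD; [exact: cf|exact: cg]. Qed.

Section Dilation.
Context {R : realType} {d : nat}.
Local Open Scope complex_scope.
Implicit Types (alpha s t : R) (c v : 'rV[R]_d).

Lemma rVpoly_sum v : rVpoly v = \sum_j v 0 j *: 'X^j.
Proof.
apply/polyP => k; rewrite coef_sum coef_rVpoly; case: insubP => [j _ <-|kd].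
  rewrite (bigD1 j) //= coefZ coefXn eqxx mulr1 big1 ?addr0 // => i' ij.
  by rewrite coefZ coefXn eq_sym (inj_eq val_inj) (negPf ij) mulr0.
rewrite big1 // => j _; rewrite coefZ coefXn; case: eqP => [kj|]; last by rewrite mulr0.
by rewrite kj ltn_ord in kd.
Qed.

Lemma taylor_coordE alpha v i :
  taylor alpha v 0 i = \sum_j v 0 j * (('X + alpha%:P) ^+ j)`_i.
Proof.
rewrite mxE rVpoly_sum linear_sum coef_sum; apply: eq_bigr => j _.
by rewrite linearZ coefZ rmorphXn /= comp_polyX.
Qed.

Lemma taylor0 alpha : taylor alpha 0 = 0 :> 'rV[R]_d.
Proof. by rewrite /taylor !linear0. Qed.

Lemma rVpoly_taylor alpha v : rVpoly (taylor alpha v) = rVpoly v \Po ('X + alpha%:P).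
Proof.
by rewrite poly_rV_K // size_comp_poly2 ?size_XaddC // size_poly.
Qed.

Lemma taylorK alpha : cancel (taylor alpha) (@taylor R d (- alpha)).
Proof.
move=> v; rewrite /taylor -/(taylor alpha v) rVpoly_taylor -comp_polyA.
by rewrite comp_polyD comp_polyX comp_polyC polyCN subrK comp_polyXr rVpolyK.
Qed.

Lemma taylorNK alpha : cancel (taylor (- alpha)) (@taylor R d alpha).
Proof. by move=> v; have := taylorK (- alpha) v; rewrite opprK. Qed.

Lemma continuous_taylor alpha : continuous (@taylor R d alpha).
Proof.
apply: continuous_mx => i0 i; rewrite {i0}(ord1 i0).
under eq_fun do rewrite taylor_coordE.
apply: (continuous_sum (K := R)) => j; apply: (continuous_mul (K := R)).
  exact: continuous_coord.
exact: cst_continuous.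
Qed.

(** The coefficients of [monic_of c] in the powers of X - alpha, without the leading one; [O_pt] is
    their origin. *)
Definition frame alpha c : 'rV[R]_d := taylor alpha (c - O_pt d alpha).

Definition wdil n (k : 'I_n -> nat) s (x : 'rV[R]_n) : 'rV[R]_n := \row_i (s ^+ k i * x 0 i).

(** Coefficient i of a monic polynomial of degree d is homogeneous of degree d - i in its roots. *)
Definition dweight (i : 'I_d) : nat := (d - i)%N.

Lemma wdilE n (k : 'I_n -> nat) s (x : 'rV[R]_n) i :
  wdil k s x 0 i = s ^+ k i * x 0 i.
Proof. by rewrite mxE. Qed.

Lemma dweight_gt0 i : (0 < dweight i)%N.
Proof. by rewrite subn_gt0. Qed.

Definition dilate alpha s c : 'rV[R]_d :=
  O_pt d alpha + taylor (- alpha) (wdil dweight s (frame alpha c)).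

Lemma frame_dilate alpha s c :
  frame alpha (dilate alpha s c) = wdil dweight s (frame alpha c).
Proof. by rewrite {1}/frame /dilate addrC addKr taylorNK. Qed.

Lemma frame_inj alpha : injective (frame alpha).
Proof. by move=> c e /(can_inj (taylorK alpha)) /addIr. Qed.

Lemma frame_eq0 alpha c : frame alpha c = 0 -> c = O_pt d alpha.
Proof. by move=> E; apply: (@frame_inj alpha); rewrite E /frame subrr taylor0. Qed.

Lemma frame_O alpha : frame alpha (O_pt d alpha) = 0.
Proof. by rewrite /frame subrr taylor0. Qed.

Lemma continuous_frame alpha : continuous (frame alpha).
Proof.
apply: (@continuous_comp_fun _ _ _ (fun c => c - O_pt d alpha) (taylor alpha)).
  apply: continuous_addv; last exact: cst_continuous.
  by move=> c; exact: cvg_id.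
exact: continuous_taylor.
Qed.

Lemma wdilM n (k : 'I_n -> nat) s t x : wdil k s (wdil k t x) = wdil k (s * t) x.
Proof. by apply/rowP => i; rewrite !mxE exprMn mulrA. Qed.

Lemma wdil1 n (k : 'I_n -> nat) x : wdil k 1 x = x.
Proof. by apply/rowP => i; rewrite !mxE expr1n mul1r. Qed.

Lemma continuous_wdil n (k : 'I_n -> nat) :
  continuous (fun sx : R * 'rV[R]_n => wdil k sx.1 sx.2).
Proof.
apply: continuous_mx => i0 i; rewrite {i0}(ord1 i0).
under eq_fun do rewrite mxE.
apply: (continuous_mul (K := R)).
  by apply: (continuous_exp (K := R)); exact: continuous_fst.
exact: (continuous_comp_fun (@continuous_snd _ _) (@continuous_coord _ _ _ _ _)).
Qed.

Lemma dilateM alpha s t c : dilate alpha s (dilate alpha t c) = dilate alpha (s * t) c.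
Proof.
apply: (@frame_inj alpha); rewrite (frame_dilate alpha s (dilate alpha t c)) (frame_dilate alpha t c).
by rewrite (frame_dilate alpha (s * t) c) wdilM.
Qed.

Lemma dilate1 alpha c : dilate alpha 1 c = c.
Proof. by apply: (@frame_inj alpha); rewrite frame_dilate wdil1. Qed.

Lemma dilate_O alpha s : dilate alpha s (O_pt d alpha) = O_pt d alpha.
Proof.
apply: (@frame_inj alpha); rewrite frame_dilate frame_O.
by apply/rowP => i; rewrite !mxE mulr0.
Qed.

Lemma dilate0 alpha c : dilate alpha 0 c = O_pt d alpha.
Proof.
apply: frame_eq0; rewrite frame_dilate; apply/rowP => i.
by rewrite !mxE expr0n gtn_eqF ?dweight_gt0 // mul0r.
Qed.

Lemma continuous_dilate alpha :
  continuous (fun sc : R * 'rV[R]_d => dilate alpha sc.1 sc.2).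
Proof.
have cw : continuous (fun sc : R * 'rV[R]_d => wdil dweight sc.1 (frame alpha sc.2)).
  apply: (@continuous_comp_fun _ _ _ (fun sc : R * 'rV[R]_d => (sc.1, frame alpha sc.2)) (fun sx => wdil dweight sx.1 sx.2)).
    apply: continuous_pair; first exact: continuous_fst.
    exact: (continuous_comp_fun (@continuous_snd _ _) (@continuous_frame alpha)).
  exact: continuous_wdil.
apply: continuous_addv; first exact: cst_continuous.
apply: (@continuous_comp_fun _ _ _ _ (taylor (- alpha)) cw).
exact: continuous_taylor.
Qed.

Lemma monic_of_O alpha : monic_of (O_pt d alpha) = ('X - alpha%:P) ^+ d.
Proof.
rewrite -monic_of_surj ?monic_exp ?monicXsubC // size_exp_XsubC //.
Qed.

Lemma monic_of_frame alpha c :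
  monic_of c = ('X - alpha%:P) ^+ d + (rVpoly (frame alpha c) \Po ('X - alpha%:P)).
Proof.
have E : 'X - alpha%:P = 'X + (- alpha)%:P by rewrite polyCN.
rewrite -monic_of_O E.
rewrite -rVpoly_taylor taylorK linearB /= /monic_of.
by rewrite -[RHS]addrA [rVpoly (O_pt d alpha) + _]addrC subrK.
Qed.

Definition scale_at alpha s (z : R[i]) : R[i] := s%:C * z + ((1 - s) * alpha)%:C.

(** Relative to alpha, multiplying the roots by s multiplies coefficient k by s^(d-k), which is the
    weighted dilation of the frame. The statement includes s = 0 and negative s. *)
Lemma root_divisor_dilate alpha s c D : root_divisor (monic_of c) D ->
  root_divisor (monic_of (dilate alpha s c)) (map (scale_at alpha s) D).
Proof.
move=> rD; rewrite /root_divisor.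
set rc := real_complex R.
pose E := [seq z - alpha%:C | z <- D].
have sE : size E = d.
  by have := root_divisor_size rD; rewrite size_map size_monic_of => -[].
(* After translating the roots by - alpha, the frame coordinates are the ordinary lower
   coefficients. *)
have prodE : \prod_(z <- E) ('X - z%:P) = map_poly rc ('X^d + rVpoly (frame alpha c)).
  have -> : 'X^d + rVpoly (frame alpha c) = (monic_of c \Po ('X + alpha%:P)).
    rewrite (monic_of_frame alpha c) comp_polyD -comp_polyA rmorphXn /=.
    by rewrite comp_polyB comp_polyX comp_polyC addrK comp_polyXr.
  rewrite map_comp_poly rmorphD /= map_polyX map_polyC.
  rewrite [map_poly rc _]rD big_map rmorph_prod /=; apply: eq_bigr => z _.
  by rewrite comp_polyB comp_polyX comp_polyC polyCB opprB addrA.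
(* The translation back by alpha becomes the constant c of [prod_XsubC_affine]. *)
transitivity (\prod_(z <- E) ('X - (s%:C * z + alpha%:C)%:P)); last first.
  rewrite !big_map; apply: eq_bigr => z _; congr ('X - _%:P).
  by rewrite /scale_at mulrBl mul1r rmorphB rmorphM /=; ring.
have coefd : (map_poly rc ('X^d + rVpoly (frame alpha c)))`_d = 1.
  rewrite coef_map coefD coefXn eqxx [(rVpoly _)`_d]nth_default ?size_poly //.
  by rewrite addr0 rmorph1.
have coefk (k : 'I_d) : (map_poly rc ('X^d + rVpoly (frame alpha c)))`_k =
    (frame alpha c 0 k)%:C.
  by rewrite coef_map coefD coefXn (ltn_eqF (ltn_ord k)) add0r coef_rVpoly_ord.
rewrite prod_XsubC_affine sE prodE big_ord_recr /= coefd subnn expr0 mulr1 scale1r.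
under eq_bigr => k _ do rewrite (coefk k).
rewrite (monic_of_frame alpha (dilate alpha s c)) frame_dilate.
rewrite -[LHS]/(map_poly (real_complex R) _) rmorphD rmorphXn /=.
have XE : map_poly (real_complex R) ('X - alpha%:P) = 'X - (alpha%:C)%:P.
  by rewrite rmorphB /= map_polyX map_polyC.
rewrite map_comp_poly XE [RHS]addrC; congr (_ + _).
rewrite rVpoly_sum rmorph_sum linear_sum /=; apply: eq_bigr => k _.
rewrite map_polyZ linearZ /= map_polyXn rmorphXn /= comp_polyX mxE.
by rewrite rmorphM rmorphXn /= mulrC.
Qed.

End Dilation.

(** * The flow of dilations, its velocity and its source *)

Section Flow.
Context {R : realType} {d : nat}.
Local Open Scope complex_scope.
Implicit Types (alpha s t : R) (c v : 'rV[R]_d).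

Definition flow alpha t c : 'rV[R]_d := dilate alpha (expR t) c.

Lemma scale_at_balanced alpha s (D : seq R[i]) :
  balanced alpha D -> balanced alpha (map (scale_at alpha s) D).
Proof.
rewrite /balanced size_map big_map big_split /= -mulr_sumr => ->.
rewrite big_const_seq count_predT iter_addr_0 -raddfMn -rmorphM -rmorphD /=.
by congr (_%:C); rewrite -mulr_natr; ring.
Qed.

Lemma dilate_coef_space alpha s c :
  coef_space d alpha c -> coef_space d alpha (dilate alpha s c).
Proof.
move=> [D rD bD]; exists (map (scale_at alpha s) D).
  exact: root_divisor_dilate.
exact: scale_at_balanced.
Qed.

Lemma scale_at_conj alpha s z : conjc (scale_at alpha s z) = scale_at alpha s (conjc z).
Proof. by rewrite /scale_at rmorphD rmorphM /= !oppr0. Qed.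

Lemma scale_at_real alpha s (y : R) :
  scale_at alpha s y%:C = (s * y + (1 - s) * alpha)%:C.
Proof. by rewrite /scale_at -rmorphM -rmorphD. Qed.

Lemma Im_scale_at alpha s z : complex.Im (scale_at alpha s z) = s * complex.Im z.
Proof. by case: z => a b; rewrite /scale_at /= mul0r addr0 addr0. Qed.

Lemma map_rdiv_scale alpha s w (ys : seq R) :
  map (scale_at alpha s) (rdiv w ys) = rdiv w [seq s * y + (1 - s) * alpha | y <- ys].
Proof.
elim: w ys => [|k w IHw] [|y ys] //=; rewrite !rdiv_cons map_cat IHw.
by rewrite map_nseq scale_at_real.
Qed.

Lemma srep_dilate alpha s w c : 0 < s -> srep w c -> srep w (dilate alpha s c).
Proof.
move=> s0 [ys [zs [sw sy /allP zs0 rD]]].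
exists [seq s * y + (1 - s) * alpha | y <- ys], (map (scale_at alpha s) zs); split.
- by rewrite size_map.
- by rewrite sorted_map; apply: sub_sorted sy => x y /=; rewrite ltrD2r ltr_pM2l.
- by apply/allP => _ /mapP[z /zs0 z0 ->]; rewrite Im_scale_at mulr_gt0.
have := root_divisor_dilate alpha s rD.
rewrite /full_div !map_cat map_rdiv_scale /conj_divisor -!map_comp.
by congr (root_divisor _ (_ ++ (_ ++ _))); apply: eq_map => z /=; rewrite scale_at_conj.
Qed.

Lemma stratum_dilate alpha s w c : 0 < s -> positive w ->
  stratum d alpha w c -> stratum d alpha w (dilate alpha s c).
Proof.
move=> s0 w0 /(stratumP _ _ w0)[cc sc]; apply/(stratumP _ _ w0).
by split; [exact: dilate_coef_space|exact: srep_dilate].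
Qed.

Lemma flow_stratum alpha w t : positive w ->
  flow alpha t @` stratum d alpha w = stratum d alpha w.
Proof.
move=> w0; apply/seteqP; split=> [_ [c sc <-]|c sc].
  by apply: stratum_dilate => //; exact: expR_gt0.
exists (flow alpha (- t) c); first by apply: stratum_dilate => //; exact: expR_gt0.
by rewrite /flow dilateM -expRD subrr expR0 dilate1.
Qed.

(** Written as an identity of functions, with a linear combination of powers of [expR], so that the
    derivative is found by the [is_derive] instances. *)
Lemma flow_coordE alpha c i : (fun t => flow alpha t c 0 i) =
  (fun=> O_pt d alpha 0 i) + \sum_(j < d)
    ((frame alpha c 0 j * (('X + (- alpha)%:P) ^+ j)`_i) *: (expR ^+ dweight j)).
Proof.
apply/funext => t; rewrite /flow /dilate mxE taylor_coordE.
rewrite [RHS]/GRing.add /= fct_sumE; congr (_ + _); apply: eq_bigr => j _.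
rewrite mxE /GRing.scale /=.
have -> : (expR ^+ dweight j : R -> R) t = expR t ^+ dweight j.
  by elim: (dweight j) => [|n IHn]; rewrite ?expr0 // !exprS -IHn.
by rewrite -mulrA mulrC.
Qed.

Lemma is_derive_flow alpha c t (i : 'I_d) :
  is_derive t 1 (fun t => flow alpha t c 0 i)
   (\sum_(j < d) ((frame alpha c 0 j * (('X + (- alpha)%:P) ^+ j)`_i) *
      ((dweight j)%:R * expR t ^+ dweight j))).
Proof.
rewrite flow_coordE; apply: is_derive_eq.
rewrite add0r; apply: eq_bigr => j _.
by rewrite /GRing.scale /= -!mulrA -exprSr prednK // dweight_gt0.
Qed.

Lemma flow_derivable1 alpha t c : derivable (flow alpha ^~ c) t 1.
Proof.
apply/derivable_mxP => i0 i; rewrite {i0}(ord1 i0).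
exact: (@ex_derive _ _ _ _ _ _ _ (is_derive_flow alpha c t i)).
Qed.

Lemma velocity_flow alpha c : velocity (flow alpha) c =
  taylor (- alpha) (\row_j ((dweight j)%:R * frame alpha c 0 j)).
Proof.
rewrite /velocity derive_mx; last exact: flow_derivable1.
apply/rowP => i; rewrite mxE (@derive_val _ _ _ _ _ _ _ (is_derive_flow alpha c 0 i)).
rewrite taylor_coordE; apply: eq_bigr => j _; rewrite [in RHS]mxE expR0 expr1n.
by rewrite mulr1 mulrC mulrA.
Qed.

Lemma flow_is_flow alpha : is_flow (coef_space d alpha) (flow alpha).
Proof.
split.
- by move=> t c; exact: dilate_coef_space.
- by move=> c _; rewrite /flow expR0 dilate1.
- by move=> s t c _; rewrite /flow expRD dilateM.
- apply: continuous_subspaceT.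
  apply: (@continuous_comp_fun _ _ _ (fun tc : R * 'rV[R]_d => (expR tc.1, tc.2))
    (fun sc => dilate alpha sc.1 sc.2)); last exact: continuous_dilate.
  apply: continuous_pair; last exact: continuous_snd.
  by apply: continuous_comp_fun; [exact: continuous_fst|exact: continuous_expR].
- by move=> t c _; exact: flow_derivable1.
apply: continuous_subspaceT.
have -> : velocity (flow alpha) = (fun c => taylor (- alpha) (\row_j ((dweight j)%:R * frame alpha c 0 j))).
  by apply/funext => c; exact: velocity_flow.
apply: (@continuous_comp_fun _ _ _ (fun c => \row_j ((dweight j)%:R * frame alpha c 0 j))
  (taylor (- alpha))); last exact: continuous_taylor.
apply: continuous_mx => i0 i; rewrite {i0}(ord1 i0).
under eq_fun do rewrite mxE.
apply: (continuous_mul (K := R)); first exact: cst_continuous.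
exact: (continuous_comp_fun (@continuous_frame _ _ alpha) (@continuous_coord _ _ _ _ _)).
Qed.

Lemma dotp_ge0 n (x : 'rV[R]_n) : 0 <= dotp x x.
Proof. by apply: sumr_ge0 => i _; rewrite -expr2 sqr_ge0. Qed.

Lemma dotp_eq0 n (x : 'rV[R]_n) : dotp x x = 0 -> x = 0.
Proof.
move=> /eqP; rewrite psumr_eq0 => [|i _]; last by rewrite -expr2 sqr_ge0.
move=> /allP x0; apply/rowP => i; rewrite mxE.
by have := x0 i (mem_index_enum i); rewrite mulf_eq0 orbb => /eqP.
Qed.

Lemma dotp_gt0 n (x : 'rV[R]_n) : x != 0 -> 0 < dotp x x.
Proof.
move=> x0; rewrite lt_neqAle dotp_ge0 andbT eq_sym.
by apply: contra x0 => /eqP/dotp_eq0->.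
Qed.

Lemma coef_sphereE alpha r c : coef_sphere d alpha r c <->
  coef_space d alpha c /\ dotp (frame alpha c) (frame alpha c) = r ^+ 2.
Proof. by []. Qed.

(** Time 1 suffices: it multiplies frame coordinate i by a power of e with positive exponent, so a
    fixed coordinate vanishes. *)
Lemma flow_stationary alpha c : (forall t, flow alpha t c = c) <-> c = O_pt d alpha.
Proof.
split=> [fc|-> t]; last exact: dilate_O.
apply: frame_eq0; apply/rowP => i; rewrite [RHS]mxE.
have /(congr1 (fun e => frame alpha e 0 i)) := fc 1.
rewrite /flow frame_dilate wdilE => /eqP.
rewrite -subr_eq0 -{2}[frame alpha c 0 i]mul1r.
rewrite -mulrBl mulf_eq0 => /orP[|/eqP //].
rewrite subr_eq0 => /eqP e1.
have : 1 < expR 1 ^+ dweight i :> R by rewrite exprn_egt1 ?expR_gt1 // -lt0n dweight_gt0.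
by rewrite e1 ltxx.
Qed.

(** In the frame the velocity has coordinates (d - j) x_j. Its product with x is a sum of (d - j)
    x_j^2, hence at least the squared radius since each weight is at least 1. *)
Lemma flow_transversal alpha r : 0 < r -> transversal_to_sphere alpha r (flow alpha).
Proof.
move=> r0 c /coef_sphereE[_ cr]; rewrite /dot_at velocity_flow taylorNK -/(frame alpha c).
rewrite gt_eqF // /dotp.
have : 0 < dotp (frame alpha c) (frame alpha c) by rewrite cr exprn_gt0.
move=> /lt_le_trans; apply; apply: ler_sum => i _; rewrite [X in _ <= _ * X]mxE mulrCA.
by rewrite ler_peMl ?ler1n ?dweight_gt0 // -expr2 sqr_ge0.
Qed.

Lemma flow_source alpha : is_source (coef_space d alpha) (flow alpha) (O_pt d alpha).
Proof.
split.
  move=> U OU.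
  have tU : nbhs (0 : 'rV[R]_d) [set x | U (O_pt d alpha + taylor (- alpha) x)].
    have : {for 0, continuous (fun x : 'rV[R]_d => O_pt d alpha + taylor (- alpha) x)}.
      by apply: continuous_addv; [exact: cst_continuous|exact: continuous_taylor].
    by apply; rewrite taylor0 addr0.
  have /nbhs_ballP[e /= e0 eU] := tU.
  (* For t <= 0 the flow multiplies every frame coordinate by a factor at most 1, so balls of the
     sup norm are stable. *)
  exists (frame alpha @^-1` ball 0 e).
    by apply: continuous_frame; rewrite frame_O; exact: nbhsx_ballx.
  move=> t c t0 /= Wc _; apply: eU.
  move: Wc; rewrite -/(frame alpha c) -!ball_normE /= !sub0r !normrN; apply: le_lt_trans.
  rewrite /Num.Def.normr /= !mx_normrE; apply/bigmax_leP; split.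
    by apply: bigmax_ge_id.
  move=> [i0 i] _ /=; rewrite {i0}(ord1 i0) wdilE normrM ger0_norm ?exprn_ge0 ?expR_ge0 //.
  apply: (@le_trans _ _ (`|frame alpha c 0 i|)).
    by rewrite ler_piMl // exprn_ile1 ?expR_ge0 // expR_le1.
  exact: (le_bigmax _ (fun i : 'I_1 * 'I_d => `|frame alpha c i.1 i.2|) (ord0, i)).
(* Convergence in negative time is continuity of [dilate] at s = 0, where every orbit reaches the
   apex; hence the basin is the whole space. *)
exists setT; first exact: filterT.
move=> c _ _; rewrite -(dilate0 alpha c).
have cd : continuous (fun s => dilate alpha s c).
  apply: (@continuous_comp_fun _ _ _ (fun s : R => (s, c)) (fun sc => dilate alpha sc.1 sc.2)).
    by apply: continuous_pair; [move=> ?; exact: cvg_id|exact: cst_continuous].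
  exact: continuous_dilate.
apply: (@cvg_comp _ _ _ expR (fun s => dilate alpha s c)); last exact: cd.
by apply/cvgNy_compNP; exact: cvgr_expR.
Qed.

Lemma flow_coneE alpha c s : 0 <= s -> flow_cone alpha (flow alpha) (c, s) = dilate alpha s c.
Proof.
rewrite /flow_cone /=; have [->|s0] := eqVneq s 0; first by rewrite dilate0.
by move=> s_ge0; rewrite /flow lnK // posrE lt_neqAle eq_sym s0.
Qed.

End Flow.

(** * Weighted spheres and balls *)

Section WeightedSphere.
Context {R : realType} {n : nat} (k : 'I_n -> nat).
Context (k_gt0 : forall i, (0 < k i)%N).
Implicit Types (x : 'rV[R]_n) (r s : R).

(** The squared Euclidean norm along the orbit of x under weighted dilations. For x nonzero and s >=
    0 it increases strictly from 0 without bound, so the orbit meets each round sphere exactly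
    once. *)
Definition wnorm s x := dotp (wdil k s x) (wdil k s x).

Lemma wnormE s x : wnorm s x = \sum_i (s ^+ (k i).*2 * x 0 i ^+ 2).
Proof.
by apply: eq_bigr => i _; rewrite wdilE -expr2 exprMn -exprM muln2.
Qed.

Lemma dotp_continuous (T : topologicalType) m (f : T -> 'rV[R]_m) :
  continuous f -> continuous (fun t => dotp (f t) (f t)).
Proof.
move=> cf; apply: (continuous_sum (K := R)) => i.
by apply: (continuous_mul (K := R)); exact: (continuous_comp_fun cf (@continuous_coord _ _ _ _ _)).
Qed.

Lemma wnorm_continuous (T : topologicalType) (f : T -> R) (g : T -> 'rV[R]_n) :
  continuous f -> continuous g -> continuous (fun t => wnorm (f t) (g t)).
Proof.
move=> cf cg; apply: dotp_continuous.
exact: (@continuous_comp_fun _ _ _ (fun t => (f t, g t)) (fun sx => wdil k sx.1 sx.2)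
  (continuous_pair cf cg) (@continuous_wdil _ _ k)).
Qed.

Lemma wnorm_lt s t x : x != 0 -> 0 <= s -> s < t -> wnorm s x < wnorm t x.
Proof.
move=> x0 s0 st; rewrite !wnormE.
have [i xi] : exists i, x 0 i != 0.
  apply/existsP; rewrite -negb_forall; apply: contra x0 => /forallP x0.
  by apply/eqP/rowP => i; rewrite mxE; exact/eqP.
have t0 := le_lt_trans s0 st.
have le j : s ^+ (k j).*2 * x 0 j ^+ 2 <= t ^+ (k j).*2 * x 0 j ^+ 2.
  by rewrite ler_wpM2r ?sqr_ge0 // lerXn2r // ?nnegrE ltW.
rewrite (bigD1 i) //= [ltRHS](bigD1 i) //= ltr_leD //; last exact: ler_sum.
rewrite ltr_pM2r; last by rewrite lt_neqAle sqr_ge0 eq_sym expf_neq0.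
by rewrite ltr_pXn2r ?nnegrE ?double_gt0 ?k_gt0 // ltW.
Qed.

Lemma wnorm_inj s t x : x != 0 -> 0 <= s -> 0 <= t -> wnorm s x = wnorm t x -> s = t.
Proof.
move=> x0 s0 t0 st; apply/eqP; case: (ltgtP s t) => // /(wnorm_lt x0).
  by rewrite st ltxx => /(_ s0).
by rewrite st ltxx => /(_ t0).
Qed.

Lemma wnorm0 x : wnorm 0 x = 0.
Proof.
rewrite wnormE big1 // => i _.
by rewrite expr0n double_eq0 gtn_eqF ?k_gt0 // mul0r.
Qed.

Lemma wnorm1 x : wnorm 1 x = dotp x x.
Proof. by rewrite /wnorm wdil1. Qed.

Lemma wnorm_wdil s t x : wnorm s (wdil k t x) = wnorm (s * t) x.
Proof. by rewrite /wnorm wdilM. Qed.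

(** All weights are at least 1. This linear growth bounds the crossing time from above, both for its
    existence and for properness of the cone map. *)
Lemma wnorm_ge s x : 1 <= s -> s * dotp x x <= wnorm s x.
Proof.
move=> s1; rewrite wnormE mulr_sumr; apply: ler_sum => i _.
rewrite -expr2 ler_wpM2r ?sqr_ge0 // -{1}[s]expr1 ler_weXn2l //.
by rewrite double_gt0 k_gt0.
Qed.

Lemma wnorm_surj r x : 0 < r -> x != 0 -> exists s, 0 < s /\ wnorm s x = r ^+ 2.
Proof.
move=> r0 x0; have N0 := dotp_gt0 x0; have r20 : 0 < r ^+ 2 by rewrite exprn_gt0.
(* With this b the linear lower bound b |x|^2 exceeds r^2, so b is an upper end for the intermediate
   value theorem. *)
pose b := 1 + r ^+ 2 / dotp x x.
have b1 : 1 <= b by rewrite lerDl divr_ge0 // ltW.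
have b0 : 0 <= b by rewrite (le_trans _ b1).
have rb : r ^+ 2 <= wnorm b x.
  apply: le_trans (wnorm_ge x b1); rewrite mulrDl mul1r divfK ?gt_eqF //.
  by rewrite lerDr ltW.
have cw : continuous (wnorm ^~ x).
  by apply: wnorm_continuous; [move=> ?; exact: cvg_id|exact: cst_continuous].
have [||s /itvP sI ws] := @IVT R (wnorm ^~ x) 0 b (r ^+ 2) b0.
- by apply: continuous_subspaceT.
- have wb : 0 <= wnorm b x := le_trans (ltW r20) rb.
  by rewrite wnorm0 (min_idPl wb) (max_idPr wb) rb ltW.
exists s; split=> //; rewrite lt_neqAle sI andbT eq_sym.
by apply: contraTneq r20 => s0; rewrite -ws s0 wnorm0 ltxx.
Qed.

(** The parameter at which the orbit of x crosses the sphere of radius r; meaningful for r > 0 and x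
    nonzero. *)
Definition rho r x : R := get [set s | 0 < s /\ wnorm s x = r ^+ 2].

Lemma rhoP r x : 0 < r -> x != 0 -> 0 < rho r x /\ wnorm (rho r x) x = r ^+ 2.
Proof. by move=> r0 x0; have /getPex := wnorm_surj r0 x0. Qed.

Lemma rho_uniq r s x : 0 < r -> x != 0 -> 0 < s -> wnorm s x = r ^+ 2 -> rho r x = s.
Proof.
move=> r0 x0 s0 ws; have [q0 wq] := rhoP r0 x0.
by apply: (wnorm_inj x0); rewrite ?ltW // wq.
Qed.

(** By monotonicity, r^2 lies strictly between the values of [wnorm] at rho - e' and rho + e'. Both
    strict inequalities persist for y near x and trap the crossing time of y. *)
Lemma rho_continuous r x : 0 < r -> x != 0 -> {for x, continuous (rho r)}.
Proof.
move=> r0 x0; have [q0 wq] := rhoP r0 x0.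
move=> A /nbhs_ballP[e /= e0 eA].
(* Staying below rho keeps rho - e' nonnegative, where [wnorm] is monotone. *)
pose e' := Num.min (e / 2) (rho r x / 2).
have e'0 : 0 < e' by rewrite lt_min !divr_gt0.
have e'e : e' < e by rewrite gt_min ltr_pdivrMr // ltr_pMr // ltr1n.
have e'q : e' < rho r x by rewrite gt_min [X in _ || X]ltr_pdivrMr // ltr_pMr // ltr1n orbT.
have cw s : continuous (wnorm s).
  by apply: wnorm_continuous; [exact: cst_continuous|move=> ?; exact: cvg_id].
have lo : wnorm (rho r x - e') x < r ^+ 2.
  by rewrite -wq wnorm_lt ?subr_ge0 ?ltW // gtrBl.
have hi : r ^+ 2 < wnorm (rho r x + e') x.
  by rewrite -wq wnorm_lt ?ltW // ltrDl.
have nlo := cvgr_lt _ (cw (rho r x - e') x) _ lo.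
have nhi := cvgr_gt _ (cw (rho r x + e') x) _ hi.
suff : \forall y \near x, A (rho r y) by [].
near=> y; apply: eA; rewrite -ball_normE /=.
have ylo : wnorm (rho r x - e') y < r ^+ 2 by near: y; exact: nlo.
have yhi : r ^+ 2 < wnorm (rho r x + e') y by near: y; exact: nhi.
have y0 : y != 0.
  apply: contraTneq yhi => ->; rewrite -leNgt wnormE big1 ?sqr_ge0 // => i _.
  by rewrite mxE expr0n mulr0.
have [p0 wp] := rhoP r0 y0.
have mono s t : 0 <= s -> 0 <= t -> wnorm s y < wnorm t y -> s < t.
  move=> s0 t0; rewrite !ltNge; apply: contra; rewrite le_eqVlt => /orP[/eqP->//|ts].
  by rewrite ltW // wnorm_lt.
rewrite distrC ltr_norml; apply/andP; split.
  rewrite ltrBrDl; apply: (@lt_trans _ _ (rho r x - e')); first by rewrite ltrD2l ltrN2.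
  by apply: mono; rewrite ?subr_ge0 ?ltW // wp.
rewrite ltrBlDl; apply: (@lt_trans _ _ (rho r x + e')); last by rewrite ltrD2l.
by apply: mono; rewrite ?addr_ge0 ?ltW // wp.
Unshelve. all: by end_near. Qed.

End WeightedSphere.

Lemma eq_continuous_at (T U : topologicalType) (f g : T -> U) x :
  f =1 g -> {for x, continuous f} -> {for x, continuous g}.
Proof. by move=> /funext->. Qed.

Section PointwiseArithmetic.
Context {R : realType} {T : topologicalType}.
Implicit Types (f g : T -> R) (x : T).

Lemma continuous_at_add f g x : {for x, continuous f} -> {for x, continuous g} ->
  {for x, continuous (fun y => f y + g y)}.
Proof. by move=> cf cg; exact: (@cvgD _ _ _ _ _ f g _ _ cf cg). Qed.

Lemma continuous_at_sub f g x : {for x, continuous f} -> {for x, continuous g} ->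
  {for x, continuous (fun y => f y - g y)}.
Proof. by move=> cf cg; exact: (@cvgB _ _ _ _ _ f g _ _ cf cg). Qed.

Lemma continuous_at_mul f g x : {for x, continuous f} -> {for x, continuous g} ->
  {for x, continuous (fun y => f y * g y)}.
Proof. by move=> cf cg; exact: (@cvgM _ _ _ _ f g _ _ cf cg). Qed.

Lemma continuous_at_inv f x : f x != 0 -> {for x, continuous f} ->
  {for x, continuous (fun y => (f y)^-1)}.
Proof. by move=> f0 cf; apply: cvgV. Qed.

End PointwiseArithmetic.

(** * The ball with an open hemisphere is a half space *)

Section BallGeometry.
Context {R : realType} {n : nat} (i1 : 'I_n).
Implicit Types x y : 'rV[R]_n.

Definition osq x : R := \sum_(i | i != i1) x 0 i ^+ 2.

Lemma osq_ge0 x : 0 <= osq x.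
Proof. by apply: sumr_ge0 => i _; exact: sqr_ge0. Qed.

Lemma dotp_osq x : dotp x x = x 0 i1 ^+ 2 + osq x.
Proof. by rewrite /dotp (bigD1 i1) //=; congr (_ + _); apply: eq_bigr => i _. Qed.

Lemma osq_continuous : continuous osq.
Proof.
apply: (continuous_sum (K := R)) => i; apply: (continuous_exp (K := R)).
exact: continuous_coord.
Qed.

Definition axis : 'rV[R]_n := delta_mx 0 i1.

Lemma axis_neq0 : axis != 0.
Proof.
apply/eqP => /rowP/(_ i1); rewrite !mxE !eqxx /= => /eqP.
by rewrite oner_eq0.
Qed.

Lemma dotp_axis x : dotp axis x = x 0 i1.
Proof.
rewrite /dotp (bigD1 i1) //= big1 ?addr0 => [|i ne]; rewrite mxE eqxx /=.
  by rewrite eqxx mul1r.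
by rewrite (negPf ne) mul0r.
Qed.

Definition half_ball : set 'rV[R]_n :=
  eball n `|` [set x | dotp x x = 1 /\ 0 < dotp axis x].

Definition half_space : set 'rV[R]_n := [set y | 0 <= y 0 i1].

(** Here r is half the length of the chord through x parallel to the axis [i1]. The fraction maps
    the part (-r, r] of the chord onto [0, infinity), with the hemisphere going to 0, and x / r maps
    the unit ball of the other coordinates onto their whole space. *)
Definition to_half_space x : 'rV[R]_n :=
  let r := Num.sqrt (1 - osq x) in
  \row_i if i == i1 then (r - x 0 i1) / (r + x 0 i1) else x 0 i / r.

(** The half chord is recovered from the other coordinates through r^2 (1 + osq y) = 1. *)
Definition of_half_space y : 'rV[R]_n :=
  let r := (Num.sqrt (1 + osq y))^-1 in
  \row_i if i == i1 then r * (1 - y 0 i1) / (1 + y 0 i1) else r * y 0 i.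

Lemma half_ballP x : half_ball x ->
  let r := Num.sqrt (1 - osq x) in
  [/\ 0 < r, r ^+ 2 = 1 - osq x, 0 < r + x 0 i1, 0 <= r - x 0 i1
    & eball n x <-> 0 < r - x 0 i1].
Proof.
move=> hx r.
have o1 : 0 < 1 - osq x.
  case: hx; rewrite /eball /= dotp_osq subr_gt0; first by apply: le_lt_trans; rewrite lerDr sqr_ge0.
  by rewrite dotp_axis => -[<- x0]; rewrite ltrDr exprn_gt0.
have r0 : 0 < r by rewrite sqrtr_gt0.
have r2 : r ^+ 2 = 1 - osq x by rewrite sqr_sqrtr // ltW.
have bE : eball n x <-> x 0 i1 ^+ 2 < r ^+ 2.
  by rewrite /eball /= dotp_osq r2 ltrBrDr.
split=> //.
- case: hx => [/bE|[_]]; last by rewrite dotp_axis => x0; rewrite addr_gt0.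
  by nra.
- case: hx => [/bE|[]]; first by nra.
  by rewrite dotp_axis dotp_osq => xo x0; nra.
rewrite bE; case: hx => [/bE|[]].
  by move=> h; split=> _ //; nra.
by rewrite dotp_axis dotp_osq => xo x0; split=> h; nra.
Qed.

Lemma to_half_spaceK x : half_ball x -> of_half_space (to_half_space x) = x.
Proof.
move=> /half_ballP; set r := Num.sqrt _ => -[r0 r2 rx _ _].
have oE : osq (to_half_space x) = osq x / r ^+ 2.
  rewrite /osq mulr_suml; apply: eq_bigr => i ne.
  by rewrite mxE (negPf ne) -/r exprMn exprVn.
have rE : (Num.sqrt (1 + osq (to_half_space x)))^-1 = r.
  rewrite oE; have -> : 1 + osq x / r ^+ 2 = (r^-1) ^+ 2.
    have -> : osq x = 1 - r ^+ 2 by rewrite r2 opprB addrC subrK.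
    by field; rewrite gt_eqF.
  by rewrite sqrtr_sqr ger0_norm ?invrK // invr_ge0 ltW.
apply/rowP => i; rewrite mxE rE; case: (eqVneq i i1) => [->|ne].
  rewrite mxE eqxx -/r; field; rewrite gt_eqF //=.
  have -> : r + x 0 i1 + (r - x 0 i1) = r * 2 by ring.
  by rewrite mulf_neq0 // gt_eqF.
by rewrite mxE (negPf ne) -/r mulrC divfK // gt_eqF.
Qed.

Lemma of_half_spaceP y : half_space y ->
  let r := (Num.sqrt (1 + osq y))^-1 in
  [/\ 0 < r, r ^+ 2 * (1 + osq y) = 1 & osq (of_half_space y) = 1 - r ^+ 2].
Proof.
move=> hy r; have o1 : 0 < 1 + osq y by rewrite ltr_pwDl // osq_ge0.
have r0 : 0 < r by rewrite invr_gt0 sqrtr_gt0.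
have r2 : r ^+ 2 * (1 + osq y) = 1.
  by rewrite /r exprVn sqr_sqrtr ?mulVf // ?ltW // gt_eqF.
split=> //.
have -> : osq (of_half_space y) = r ^+ 2 * osq y.
  rewrite /osq mulr_sumr; apply: eq_bigr => i ne.
  by rewrite mxE (negPf ne) -/r exprMn.
by rewrite -r2; ring.
Qed.

Lemma of_half_space_axis y : half_space y ->
  let r := (Num.sqrt (1 + osq y))^-1 in
  of_half_space y 0 i1 = r * (1 - y 0 i1) / (1 + y 0 i1).
Proof. by move=> _ r; rewrite mxE eqxx. Qed.

Lemma of_half_spaceK y : half_space y -> to_half_space (of_half_space y) = y.
Proof.
move=> hy; have [] := of_half_spaceP hy; set r := _^-1 => r0 r2 oE.
have rE : Num.sqrt (1 - osq (of_half_space y)) = r.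
  by rewrite oE opprB addrC subrK sqrtr_sqr ger0_norm // ltW.
have y1 : 1 + y 0 i1 != 0 by rewrite gt_eqF // ltr_pwDl.
apply/rowP => i; rewrite mxE rE; case: (eqVneq i i1) => [->|ne].
  rewrite of_half_space_axis // -/r; field; rewrite y1 /=.
  have -> : r * (1 + y 0 i1) + r * (1 - y 0 i1) = r * 2 by ring.
  by rewrite mulf_neq0 // gt_eqF.
by rewrite mxE (negPf ne) -/r mulrAC divff ?mul1r // gt_eqF.
Qed.

Lemma to_half_space_in x : half_ball x -> half_space (to_half_space x).
Proof.
move=> /half_ballP[r0 r2 rx rx' _].
by rewrite /half_space /= mxE eqxx divr_ge0 // ltW.
Qed.

Lemma eball_half_space x : half_ball x -> eball n x <-> 0 < to_half_space x 0 i1.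
Proof.
move=> /half_ballP[r0 r2 rx rx' ->].
by rewrite mxE eqxx pmulr_lgt0 // invr_gt0.
Qed.

Lemma of_half_space_in y : half_space y -> half_ball (of_half_space y).
Proof.
move=> hy; have [] := of_half_spaceP hy; set r := _^-1 => r0 r2 oE.
have aE := of_half_space_axis hy; rewrite -/r in aE.
have y0 : 0 <= y 0 i1 by [].
have y1 : 0 < 1 + y 0 i1 by rewrite ltr_pwDl.
pose q := (1 - y 0 i1) / (1 + y 0 i1).
have aq : of_half_space y 0 i1 = r * q by rewrite aE mulrA.
have q1 : -1 < q by rewrite ltr_pdivlMr // mulN1r; lra.
have q2 : q <= 1 by rewrite ler_pdivrMr // mul1r; lra.
rewrite /half_ball /eball /= dotp_axis dotp_osq oE aq.
move: q2; rewrite le_eqVlt => /orP[/eqP->|q2].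
  by right; rewrite mulr1; split=> //; rewrite addrC subrK.
left; rewrite exprMn -subr_gt0.
have -> : 1 - (r ^+ 2 * q ^+ 2 + (1 - r ^+ 2)) = r ^+ 2 * ((1 - q) * (1 + q)) by ring.
by rewrite mulr_gt0 ?exprn_gt0 // mulr_gt0 // ?subr_gt0 //; lra.
Qed.

Lemma to_half_space_continuous x : half_ball x -> {for x, continuous to_half_space}.
Proof.
move=> /half_ballP; set r := Num.sqrt _ => -[r0 r2 rx _ _].
have cr : {for x, continuous (fun x => Num.sqrt (1 - osq x))}.
  apply: (@continuous_comp _ _ _ (fun x => 1 - osq x) Num.sqrt); last exact: sqrt_continuous.
  by apply: (continuous_sub (K := R)); [exact: cst_continuous|exact: osq_continuous].
have cc i : {for x, continuous (fun x : 'rV[R]_n => x 0 i)} by exact: continuous_coord.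
apply: continuous_mx_at => i0 i; rewrite {i0}(ord1 i0).
have [ie|ne] := eqVneq i i1.
  apply: (@eq_continuous_at _ _ (fun x =>
    (Num.sqrt (1 - osq x) - x 0 i1) / (Num.sqrt (1 - osq x) + x 0 i1))) => [z|].
    by rewrite mxE ie eqxx.
  apply: continuous_at_mul; first exact: continuous_at_sub.
  by apply: continuous_at_inv; [rewrite gt_eqF|exact: continuous_at_add].
apply: (@eq_continuous_at _ _ (fun x => x 0 i / Num.sqrt (1 - osq x))) => [z|].
  by rewrite mxE (negPf ne).
by apply: continuous_at_mul => //; apply: continuous_at_inv => //; rewrite gt_eqF.
Qed.

Lemma of_half_space_continuous y : half_space y -> {for y, continuous of_half_space}.
Proof.
move=> hy.
have o1 : 0 < Num.sqrt (1 + osq y) by rewrite sqrtr_gt0 ltr_pwDl // osq_ge0.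
have y0 : 0 <= y 0 i1 by [].
have y1 : 0 < 1 + y 0 i1 by rewrite ltr_pwDl.
have cr : {for y, continuous (fun y => (Num.sqrt (1 + osq y))^-1)}.
  apply: continuous_at_inv; first by rewrite gt_eqF.
  apply: (@continuous_comp _ _ _ (fun x => 1 + osq x) Num.sqrt); last exact: sqrt_continuous.
  by apply: (continuous_add (K := R)); [exact: cst_continuous|exact: osq_continuous].
have cc i : {for y, continuous (fun x : 'rV[R]_n => x 0 i)} by exact: continuous_coord.
apply: continuous_mx_at => i0 i; rewrite {i0}(ord1 i0).
have [ie|ne] := eqVneq i i1.
  apply: (@eq_continuous_at _ _ (fun y =>
    (Num.sqrt (1 + osq y))^-1 * (1 - y 0 i1) / (1 + y 0 i1))) => [z|].
    by rewrite mxE ie eqxx.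
  apply: continuous_at_mul.
    apply: continuous_at_mul => //.
    by apply: continuous_at_sub => //; exact: cst_continuous.
  apply: continuous_at_inv; first by rewrite gt_eqF.
  by apply: continuous_at_add => //; exact: cst_continuous.
apply: (@eq_continuous_at _ _ (fun y => (Num.sqrt (1 + osq y))^-1 * y 0 i)) => [z|].
  by rewrite mxE (negPf ne).
exact: continuous_at_mul.
Qed.

End BallGeometry.

(** * The closed ball as a closed hemisphere one dimension up *)

Section Hemisphere.
Context {R : realType} {n : nat} (i1 : 'I_n.+1).
Implicit Types (x : 'rV[R]_n) (y : 'rV[R]_n.+1).

(** The graph of sqrt (1 - |x|^2) in direction [i1]. Outside the ball the root takes the value 0,
    which keeps the map continuous everywhere. *)
Definition to_hemisphere x : 'rV[R]_n.+1 :=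
  \row_i if unlift i1 i is Some j then x 0 j else Num.sqrt (1 - dotp x x).

Definition of_hemisphere y : 'rV[R]_n := \row_j y 0 (lift i1 j).

Lemma to_hemisphere_lift x j : to_hemisphere x 0 (lift i1 j) = x 0 j.
Proof. by rewrite mxE liftK. Qed.

Lemma to_hemisphere_axis x : to_hemisphere x 0 i1 = Num.sqrt (1 - dotp x x).
Proof. by rewrite mxE unlift_none. Qed.

Lemma dotp_lift y : dotp y y = y 0 i1 ^+ 2 + dotp (of_hemisphere y) (of_hemisphere y).
Proof.
rewrite /dotp (bigD1_ord i1) //=; congr (_ + _).
by apply: eq_bigr => j _; rewrite mxE.
Qed.

Lemma to_hemisphereK x : of_hemisphere (to_hemisphere x) = x.
Proof. by apply/rowP => j; rewrite mxE to_hemisphere_lift. Qed.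

Lemma of_hemisphereK y : dotp y y = 1 -> 0 <= y 0 i1 -> to_hemisphere (of_hemisphere y) = y.
Proof.
move=> y1 y0; apply/rowP => i; rewrite mxE.
case: unliftP => [j ->|->]; first by rewrite mxE.
by move: y1; rewrite dotp_lift => <-; rewrite addrK sqrtr_sqr ger0_norm.
Qed.

Lemma dotp_to_hemisphere x : dotp x x <= 1 -> dotp (to_hemisphere x) (to_hemisphere x) = 1.
Proof.
move=> x1; rewrite dotp_lift to_hemisphereK to_hemisphere_axis.
by rewrite sqr_sqrtr ?subr_ge0 // subrK.
Qed.

Lemma to_hemisphere_gt0 x : 0 < to_hemisphere x 0 i1 <-> eball n x.
Proof. by rewrite to_hemisphere_axis sqrtr_gt0 subr_gt0. Qed.

Lemma of_hemisphere_in y : dotp y y = 1 -> eclosed_ball n (of_hemisphere y).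
Proof. by rewrite dotp_lift /eclosed_ball /= => <-; rewrite lerDr sqr_ge0. Qed.

Lemma to_hemisphere_continuous : continuous to_hemisphere.
Proof.
apply: continuous_mx => i0 i; rewrite {i0}(ord1 i0).
under eq_fun do rewrite mxE; case: (unlift i1 i) => [j|]; first exact: continuous_coord.
apply: (@continuous_comp_fun _ _ _ (fun x => 1 - dotp x x) Num.sqrt); last exact: sqrt_continuous.
apply: (continuous_sub (K := R)); first exact: cst_continuous.
by apply: dotp_continuous => x; exact: cvg_id.
Qed.

Lemma of_hemisphere_continuous : continuous of_hemisphere.
Proof.
apply: continuous_mx => i0 i; rewrite {i0}(ord1 i0).
by under eq_fun do rewrite mxE; exact: continuous_coord.
Qed.

End Hemisphere.

(** * The map from cells to polynomials *)

Section CellMap.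
Context {R : realType} {d : nat} {w : seq nat}.
Context (w_in : Omega_le d w).
Local Open Scope complex_scope.
Local Open Scope quotient_scope.
Local Notation C := (R[i]^o).
Local Notation p := (size w).
Local Notation m := ((d - sumn w)./2).
Local Notation U := (@cell_ambient R d w).
Implicit Types (x : U) (y : 'rV[R]_p) (alpha : R).

Let w_pos : positive w. Proof. by case: w_in. Qed.

(** The congruence of |w| and d modulo 2 makes the halving exact. *)
Lemma Omega_leE : d = (sumn w + m.*2)%N.
Proof.
case: w_in => _ le_wd par; rewrite -[LHS](subnKC le_wd); congr (_ + _)%N.
rewrite -[LHS]odd_double_half oddB //; move/eqP: par; rewrite !modn2.
by case: (odd d); case: (odd (sumn w)).
Qed.

Definition row_seq n (y : 'rV[R]_n) : seq R := [seq y 0 i | i <- enum 'I_n].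

Lemma size_row_seq n (y : 'rV[R]_n) : size (row_seq y) = n.
Proof. by rewrite size_map size_enum_ord. Qed.

Lemma nth_row_seq n (y : 'rV[R]_n) (i : 'I_n) : nth 0 (row_seq y) i = y 0 i.
Proof. by rewrite (nth_map i) ?size_enum_ord // nth_ord_enum. Qed.

Lemma row_seq_inj n : injective (@row_seq n).
Proof. by move=> y z E; apply/rowP => i; rewrite -!nth_row_seq E. Qed.

Lemma row_seq_surj n (ys : seq R) : size ys = n -> exists y : 'rV[R]_n, row_seq y = ys.
Proof.
move=> sy; exists (\row_i nth 0 ys i); apply: (@eq_from_nth _ 0); rewrite size_row_seq // => i lt_in.
by rewrite (nth_row_seq _ (Ordinal lt_in)) mxE.
Qed.

Lemma real_divisorE y : real_divisor y = rdiv w (row_seq y).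
Proof.
have wE : w = [seq nth 0%N w i | i : 'I_p <- enum 'I_p].
  rewrite (map_comp (nth 0%N w) (@nat_of_ord p)) -[X in map _ X]/(map val _) val_enum_ord.
  by rewrite -[LHS](mkseq_nth 0%N).
rewrite /rdiv [X in zip X _]wE zip_map -map_comp /real_divisor.
by congr flatten; apply: eq_map => i.
Qed.

Lemma cell_divisorE x : cell_divisor x = full_div w (row_seq x.1) (points x.2).
Proof. by rewrite /cell_divisor real_divisorE. Qed.

Lemma size_cell_divisor x : size (cell_divisor x) = d.
Proof.
by rewrite cell_divisorE size_full_div ?size_row_seq // size_points -Omega_leE.
Qed.

Lemma root_divisor_Phi x : root_divisor (monic_of (Phi d w x)) (cell_divisor x).
Proof.
apply: root_divisor_viete; first exact: size_cell_divisor.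
by rewrite cell_divisorE full_div_conj.
Qed.

Lemma Phi_eq x (c : 'rV[R]_d) : root_divisor (monic_of c) (cell_divisor x) -> Phi d w x = c.
Proof. exact: viete_root_divisor. Qed.

Lemma Pi_coneE n (y : 'rV[R]_n) : Pi_cone y <-> sorted <=%R (row_seq y).
Proof.
split=> [h|/le_sorted_leq_nth h i j ij].
  apply/(sortedP 0); rewrite size_row_seq => i lt_in.
  rewrite (nth_row_seq _ (Ordinal lt_in)) (nth_row_seq _ (Ordinal (ltnW lt_in))).
  exact: h.
by rewrite -!nth_row_seq; apply: h => //; rewrite inE size_row_seq.
Qed.

Lemma Pi_cone_intE n (y : 'rV[R]_n) : Pi_cone_int y <-> sorted <%R (row_seq y).
Proof.
split=> [h|/lt_sorted_ltn_nth h i j ij].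
  apply/(sortedP 0); rewrite size_row_seq => i lt_in.
  rewrite (nth_row_seq _ (Ordinal lt_in)) (nth_row_seq _ (Ordinal (ltnW lt_in))).
  exact: h.
by rewrite -!nth_row_seq h // inE size_row_seq.
Qed.

Definition cell_int alpha : set U :=
  [set x | [/\ Pi_cone_int x.1, Sym_in Hplane_int x.2 & balanced alpha (cell_divisor x)]].

Lemma Sym_inE (A : set C) (D : SymPow m C) (a : pred C) :
  (forall z, A z <-> a z) -> Sym_in A D <-> all a (points D).
Proof.
move=> Aa; split=> [h|/allP h z /h]; last by move/Aa.
by apply/allP => z /h /Aa.
Qed.

Lemma cell_int_e alpha : cell_int alpha `<=` cell_e d alpha w.
Proof.
move=> x [/Pi_cone_intE sy h b]; split=> //; last by move=> z /h /ltW.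
by apply/Pi_coneE; apply: sub_sorted sy => a a'; exact: ltW.
Qed.

Lemma cell_bdE alpha : cell_bd d alpha w = cell_e d alpha w `\` cell_int alpha.
Proof.
apply/seteqP; split=> x [ex nx]; split=> //.
  by move=> [h1 h2 _]; apply: nx.
by move=> [h1 h2]; apply: nx; split=> //; case: ex.
Qed.

Lemma ambient_of_seqs (ys : seq R) (zs : seq C) : size ys = p -> size zs = m ->
  exists x : U, row_seq x.1 = ys /\ perm_eq (points x.2) zs.
Proof.
move=> /row_seq_surj[y yE] /points_of_seq[D DE].
by exists (y, D).
Qed.

Lemma perm_full_div ys zs zs' : perm_eq zs zs' ->
  perm_eq (full_div w ys zs : seq C) (full_div w ys zs').
Proof.
by move=> zz; rewrite perm_cat2l; apply: perm_cat => //; exact: perm_map.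
Qed.

Lemma root_divisor_points_size (ys : seq R) (zs : seq C) (c : 'rV[R]_d) :
  size ys = p -> root_divisor (monic_of c) (full_div w ys zs) -> size zs = m.
Proof.
move=> sy /root_divisor_size; rewrite size_monic_of size_full_div // => -[dE].
by move: dE Omega_leE; lia.
Qed.

Lemma Phi_cell_e alpha :
  Phi d w @` cell_e d alpha w = [set c | coef_space d alpha c /\ rep w c].
Proof.
apply/seteqP; split=> [_ [x [px sx bx] <-]|c [cc [ys [zs [sw sy zs0 rD]]]]] /=.
  split; first exact/(coef_spaceP alpha (root_divisor_Phi x)).
  exists (row_seq x.1), (points x.2); split.
  - exact: size_row_seq.
  - exact/Pi_coneE.
  - exact: ((Sym_inE x.2 (a := fun z => 0 <= complex.Im z) (fun z => iff_refl _)).1 sx).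
  by rewrite -cell_divisorE; exact: root_divisor_Phi.
have [x [yE zE]] := ambient_of_seqs sw (root_divisor_points_size sw rD).
have rx : root_divisor (monic_of c) (cell_divisor x).
  apply/(root_divisor_perm _ rD); rewrite cell_divisorE yE.
  by apply: perm_full_div; rewrite perm_sym.
exists x; last exact: Phi_eq.
split; [by apply/Pi_coneE; rewrite yE| |exact/(coef_spaceP alpha rx)].
by move=> z; rewrite (perm_mem zE) => /(allP zs0).
Qed.

Lemma Phi_cell_int alpha : Phi d w @` cell_int alpha = stratum d alpha w.
Proof.
apply/seteqP; split=> [_ [x [px sx bx] <-]|c /(stratumP _ _ w_pos)[cc [ys [zs [sw sy zs0 rD]]]]].
  apply/(stratumP _ _ w_pos).
  split; first exact/(coef_spaceP alpha (root_divisor_Phi x)).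
  exists (row_seq x.1), (points x.2); split.
  - exact: size_row_seq.
  - exact/Pi_cone_intE.
  - exact: ((Sym_inE x.2 (a := fun z => 0 < complex.Im z) (fun z => iff_refl _)).1 sx).
  by rewrite -cell_divisorE; exact: root_divisor_Phi.
have [x [yE zE]] := ambient_of_seqs sw (root_divisor_points_size sw rD).
have rx : root_divisor (monic_of c) (cell_divisor x).
  apply/(root_divisor_perm _ rD); rewrite cell_divisorE yE.
  by apply: perm_full_div; rewrite perm_sym.
exists x; last exact: Phi_eq.
split; [by apply/Pi_cone_intE; rewrite yE| |exact/(coef_spaceP alpha rx)].
by move=> z; rewrite (perm_mem zE) => /(allP zs0).
Qed.

(** Real points and conjugates never lie strictly above the axis, so the strictly upper part of the
    divisor sees only [zs]. *)
Lemma filter_upper (ys : seq R) (zs : seq C) :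
  all (fun z : C => 0 <= complex.Im z) zs ->
  [seq z <- full_div w ys zs | 0 < complex.Im z] = [seq z <- zs | 0 < complex.Im z].
Proof.
move=> /allP zs0; rewrite !filter_cat.
have -> : [seq z <- rdiv w ys | 0 < complex.Im z] = [::].
  rewrite -(filter_pred0 (rdiv w ys)); apply: eq_in_filter => z /Im_rdiv -> /=.
  by rewrite ltxx.
have -> : [seq z <- conj_divisor zs | 0 < complex.Im z] = [::].
  rewrite -(filter_pred0 (conj_divisor zs)); apply: eq_in_filter => z /mapP[z' z'x ->] /=.
  by have := zs0 _ z'x; case: z' {z'x} => a b /= b0; rewrite oppr_gt0 ltNge b0.
by rewrite cats0.
Qed.

Lemma upper_points x : Sym_in Hplane_int x.2 ->
  [seq z <- cell_divisor x | 0 < complex.Im z] = points x.2.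
Proof.
move=> sx; rewrite cell_divisorE filter_upper.
  by rewrite -[RHS]filter_predT; apply: eq_in_filter => z /sx.
by apply/allP => z /sx /ltW.
Qed.

(** Counting: a strict representation has m points strictly above the axis, so all m points of x lie
    there. Its real points then are the same set of p distinct numbers, so x has no ties. Hence
    [Phi] sends no boundary point into the stratum itself. *)
Lemma srep_cell_int alpha x : cell_e d alpha w x -> srep w (Phi d w x) -> cell_int alpha x.
Proof.
move=> [px sx bx] [ys [zs [sw sy zs0 rD]]].
have xD := (root_divisor_perm _ rD).2 (root_divisor_Phi x).
have zs_size := root_divisor_points_size sw rD.
have x0 : all (fun z : C => 0 <= complex.Im z) (points x.2) by apply/allP => z /sx.
have zs00 : all (fun z : C => 0 <= complex.Im z) zs.
  by apply: sub_all zs0 => z; exact: ltW.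
have x1 : all (fun z : C => 0 < complex.Im z) (points x.2).
  have := perm_size (perm_filter (fun z : C => 0 < complex.Im z) xD).
  rewrite cell_divisorE !filter_upper // (all_filterP zs0) zs_size.
  rewrite size_filter => /esym/eqP; rewrite -[X in _ == X](size_points x.2) => cx.
  by rewrite all_count.
split=> //; last by move=> z zx; exact: (allP x1 _ zx).
apply/Pi_cone_intE; rewrite lt_sorted_uniq_le; move/Pi_coneE: px => ->; rewrite andbT.
have mem_x : row_seq x.1 =i ys.
  move=> t; rewrite -(mem_full_div_real t w_pos (size_row_seq _) x1).
  by rewrite -(mem_full_div_real t w_pos sw zs0) (perm_mem xD) cell_divisorE.
by rewrite (eq_uniq _ mem_x) ?lt_sorted_uniq // size_row_seq sw.
Qed.

(** On the open cell the polynomial determines D'' as the strictly upper part of its divisor and D'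
    through its ordered real roots. *)
Lemma Phi_int_inj alpha : set_inj (cell_int alpha) (Phi d w).
Proof.
move=> x x'; rewrite !inE => -[sy sz _] [sy' sz' _] E.
have rD := root_divisor_Phi x; have rD' := root_divisor_Phi x'.
rewrite -E in rD'; have xx' := (root_divisor_perm _ rD).2 rD'.
rewrite [x]surjective_pairing [x']surjective_pairing; congr pair; last first.
  apply: points_inj; rewrite -(upper_points sz) -(upper_points sz').
  exact: perm_filter.
apply: row_seq_inj; rewrite cell_divisorE in rD; rewrite cell_divisorE in rD'.
rewrite -(@srep_roots R d w (Phi d w x) _ _ w_pos (size_row_seq _) _ _ rD).
- rewrite -(@srep_roots R d w (Phi d w x) _ _ w_pos (size_row_seq _) _ _ rD') //.
    exact/Pi_cone_intE.
  exact: ((Sym_inE x'.2 (a := fun z => 0 < complex.Im z) (fun z => iff_refl _)).1 sz').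
- exact/Pi_cone_intE.
exact: ((Sym_inE x.2 (a := fun z => 0 < complex.Im z) (fun z => iff_refl _)).1 sz).
Qed.

(** [rep_degenerate] gives a type of larger [norm_red] or w itself; the latter would put x in the
    open cell by [srep_cell_int]. *)
Lemma Phi_bd alpha : Phi d w @` cell_bd d alpha w `<=`
  [set c | coef_space d alpha c /\ exists w', [/\ Omega_le d w', succeq w w',
     (norm_red w < norm_red w')%N & stratum d alpha w' c]].
Proof.
rewrite cell_bdE => _ [x [ex nx] <-] /=.
have [cc rc] : coef_space d alpha (Phi d w x) /\ rep w (Phi d w x).
  have : (Phi d w @` cell_e d alpha w) (Phi d w x) by exists x.
  by rewrite Phi_cell_e.
split=> //; have [w' [w'0 ww' sw' nw']] := rep_degenerate w_pos rc.
have st' : stratum d alpha w' (Phi d w x) by exact/stratumP.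
exists w'; split=> //; first exact: rep_Omega w'0 (srep_rep sw').
by case: nw' => // wE; case: nx; apply: srep_cell_int => //; move: sw'; rewrite wE.
Qed.

Lemma Phi_bd_stratum alpha x : cell_bd d alpha w x -> ~ stratum d alpha w (Phi d w x).
Proof.
by rewrite cell_bdE => -[ex nx] /(stratumP _ _ w_pos)[_ /(srep_cell_int ex)].
Qed.

Lemma prod_real_divisor y : \prod_(z <- real_divisor y) ('X - z%:P) =
  \prod_(i : 'I_p) \prod_(j < nth 0%N w i) ('X - ((y 0 i)%:C)%:P).
Proof.
rewrite /real_divisor big_flatten big_map big_enum /=; apply: eq_bigr => i _.
by rewrite big_nseq prodr_const card_ord iter_mulr_1.
Qed.

Lemma cell_divisor_prod x : \prod_(z <- cell_divisor x) ('X - z%:P) =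
  (\prod_(i : 'I_p) \prod_(j < nth 0%N w i) ('X - ((x.1 0 i)%:C)%:P)) *
  (sympoly x.2 * map_poly (conjc : {rmorphism R[i] -> R[i]}) (sympoly x.2)).
Proof.
rewrite /cell_divisor !big_cat /= prod_real_divisor; congr (_ * (_ * _)).
by rewrite /sympoly (map_prod_XsubC (conjc : {rmorphism R[i] -> R[i]})) big_map.
Qed.

Lemma continuous_Phi : continuous (Phi d w : U -> 'rV[R]_d).
Proof.
apply: continuous_mx => i0 i; rewrite {i0}(ord1 i0).
under eq_fun do rewrite mxE cell_divisor_prod.
apply: (@continuous_comp_fun _ _ _ _ (fun z : C => complex.Re z : R)); last exact: continuous_Re.
have c2 : continuous_coefs (fun x : U => sympoly x.2).
  by move=> k; exact: (continuous_comp_fun (@continuous_snd _ _) (@continuous_sympoly _ _ k)).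
apply: (@continuous_coefsM R U).
  apply: continuous_coefs_prod => j; apply: continuous_coefs_prod => j'.
  apply: continuous_coefs_XsubC; apply: (@continuous_Complex R U); last exact: cst_continuous.
  exact: (continuous_comp_fun (@continuous_fst _ _) (@continuous_coord _ _ _ _ _)).
apply: (continuous_coefsM c2) => k.
under eq_fun do rewrite coef_map.
by apply: continuous_conjc; exact: c2.
Qed.

Lemma coef_le_norm n (c : 'rV[R]_n) i : `|c 0 i| <= `|c|.
Proof.
rewrite [leRHS]/Num.Def.normr /= mx_normrE.
exact: (le_bigmax _ (fun i : 'I_1 * 'I_n => `|c i.1 i.2|) (ord0, i)).
Qed.

(* The coefficients bound the roots, so that Phi is proper. *)
Lemma closed_Phi (A : set U) : closed A -> closed (Phi d w @` A).
Proof.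
move=> cA; apply: closed_image_proper; [exact: norm_hausdorff|exact: continuous_Phi|exact: cA|].
move=> c; pose M := `|c| + 1; pose M' := 1 + d%:R * M.
exists (ball c 1); first exact: nbhsx_ballx.
exists ([set y : 'rV[R]_p | forall i, `|y 0 i| <= M'] `*`
        ((\pi_(SymPow m C) : 'rV[C]_m -> SymPow m C) @` @cballs R m M')).
  apply: compact_setX; first exact: compact_rballs.
  apply: continuous_compact; last exact: compact_cballs.
  by apply: continuous_subspaceT; exact: pi_sympow_continuous.
move=> x [_ /=]; rewrite -ball_normE /= => xc.
have xM : `|Phi d w x| <= M.
  rewrite -[Phi d w x](subKr c) (le_trans (ler_normB _ _)) // lerD2l.
  exact: ltW.
have rx z : z \in cell_divisor x -> Normc.normc z <= M'.
  move=> zx; rewrite /M' -{1}(size_cell_divisor x); apply: root_bound => // k.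
  rewrite size_cell_divisor => lt_kd; rewrite -[\prod_(_ <- _) _]root_divisor_Phi.
  rewrite (coef_map (real_complex R)) /= (coef_monic_of _ (Ordinal lt_kd)).
  rewrite expr0n addr0 sqrtr_sqr; exact: le_trans (coef_le_norm _ _) xM.
split=> /= [i|].
  have /rx : ((x.1 0 i)%:C : C) \in cell_divisor x.
    rewrite cell_divisorE mem_cat mem_rdiv ?size_row_seq // map_f //.
    by rewrite map_f // mem_enum.
  by rewrite /= expr0n addr0 sqrtr_sqr.
exists (repr x.2); last exact: reprK.
move=> j; have /rx zj : repr x.2 0 j \in cell_divisor x.
  by rewrite !mem_cat [X in _ || (X || _)]map_f ?orbT // mem_enum.
by split; [exact: le_trans (Re_le_normc _) zj|exact: le_trans (Im_le_normc _) zj].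
Qed.

End CellMap.

(** * Charts of the cells *)

Section AffineActions.
Context {R : realType} {d : nat} {w : seq nat} (w_in : Omega_le d w) (alpha : R).
Local Open Scope complex_scope.
Local Open Scope quotient_scope.
Local Notation C := (R[i]^o).
Local Notation p := (size w).
Local Notation m := ((d - sumn w)./2).
Local Notation U := (@cell_ambient R d w).
Implicit Types (x : U) (s t u : R).

(** t spreads the real points apart and lifts the others; u translates everything horizontally. The
    factor 1 matches the affine form of [continuous_symmap_affine]. *)
Definition shift t u x : U :=
  (\row_i (x.1 0 i + (i%:R * t + u)), symmap (fun z : C => 1 * z + (u +i* t)) x.2).

Definition scale s x : U :=
  (\row_i (s * x.1 0 i + (1 - s) * alpha), symmap (scale_at alpha s : C -> C) x.2).

Lemma shift0 x : shift 0 0 x = x.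
Proof.
rewrite [RHS]surjective_pairing; congr pair.
  by apply/rowP => i; rewrite !mxE mulr0 !addr0.
by rewrite -[RHS]symmap_id; apply: eq_symmap => z; rewrite mul1r addr0.
Qed.

Lemma shiftD t u t' u' x : shift t u (shift t' u' x) = shift (t + t') (u + u') x.
Proof.
congr pair; first by apply/rowP => i; rewrite !mxE /=; ring.
rewrite symmap_comp; apply: eq_symmap => z /=.
rewrite !mul1r -addrA; congr (z + _); apply/eqP.
by rewrite eq_complex /= [u' + u]addrC [t' + t]addrC !eqxx.
Qed.

Lemma scale_shift s t u x : scale s (shift t u x) = shift (s * t) (s * u) (scale s x).
Proof.
congr pair; first by apply/rowP => i; rewrite !mxE /=; ring.
rewrite !symmap_comp; apply: eq_symmap => -[a b] /=; rewrite /scale_at.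
by apply/eqP; rewrite eq_complex /=; apply/andP; split; apply/eqP => /=; ring.
Qed.

Lemma continuous_shift (T : topologicalType) (t u : T -> R) (f : T -> U) :
  continuous t -> continuous u -> continuous f ->
  continuous (fun a => shift (t a) (u a) (f a)).
Proof.
move=> ct cu cf; apply: continuous_pair.
  apply: continuous_mx => i0 i; rewrite {i0}(ord1 i0); under eq_fun do rewrite mxE.
  apply: (continuous_add (K := R)).
    apply: (@continuous_comp_fun _ _ _ (fun a => (f a).1) (fun y => y 0 i)).
      exact: (continuous_comp_fun cf (@continuous_fst _ _)).
    exact: continuous_coord.
  apply: (continuous_add (K := R)) => //; apply: (continuous_mul (K := R)) => //.
  exact: cst_continuous.
apply: continuous_symmap_affine; first exact: cst_continuous.
  exact: continuous_Complex.
exact: (continuous_comp_fun cf (@continuous_snd _ _)).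
Qed.

(** Indexed by naturals, with value 0 from p on, so that consecutive points can be compared without
    ordinals. *)
Definition pt x (i : nat) : R := nth 0 (row_seq x.1) i.

Lemma ptE x (i : 'I_p) : pt x i = x.1 0 i. Proof. exact: nth_row_seq. Qed.

Lemma pt_shift t u x i : (i < p)%N -> pt (shift t u x) i = pt x i + (i%:R * t + u).
Proof. by move=> lt_ip; rewrite !(ptE _ (Ordinal lt_ip)) mxE. Qed.

Lemma pt_scale s x i : (i < p)%N -> pt (scale s x) i = s * pt x i + (1 - s) * alpha.
Proof. by move=> lt_ip; rewrite !(ptE _ (Ordinal lt_ip)) mxE. Qed.

Lemma continuous_pt i : continuous (pt ^~ i).
Proof.
have [lt_ip|le_pi] := ltnP i p.
  have -> : pt ^~ i = (fun x => x.1 0 (Ordinal lt_ip)).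
    by apply/funext => x; rewrite (ptE _ (Ordinal lt_ip)).
  exact: (continuous_comp_fun (@continuous_fst _ _) (@continuous_coord _ _ _ _ _)).
have -> : pt ^~ i = (fun=> 0).
  by apply/funext => x; rewrite /pt nth_default // size_row_seq.
exact: cst_continuous.
Qed.

Definition csum (D : SymPow m C) : R[i] := \sum_(z <- points D) z.

Lemma continuous_csum : continuous (csum : _ -> C).
Proof.
apply: sympow_continuous.
have -> : (csum : _ -> C) \o \pi_(SymPow m C) = (fun u : 'rV[C]_m => \sum_j u 0 j).
  by apply/funext => u /=; rewrite /csum (perm_big _ (points_pi u)) big_map big_enum.
by apply: (continuous_sum (K := R[i])) => j; exact: continuous_coord.
Qed.

Lemma csum_shift t u x : csum (shift t u x).2 = csum x.2 + (u +i* t) *+ m.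
Proof.
rewrite /csum (perm_big _ (points_symmap _ _)) big_map big_split /=.
by rewrite -mulr_sumr mul1r big_const_seq count_predT size_points iter_addr_0.
Qed.

Lemma csum_scale s x : csum (scale s x).2 = s%:C * csum x.2 + ((1 - s) * alpha)%:C *+ m.
Proof.
rewrite /csum (perm_big _ (points_symmap _ _)) big_map big_split /=.
by rewrite -mulr_sumr big_const_seq count_predT size_points iter_addr_0.
Qed.

(** The sum of the points of the whole divisor: conjugate pairs contribute twice their real part. *)
Definition bal x : R := \sum_(i < p) (nth 0%N w i)%:R * x.1 0 i + complex.Re (csum x.2) *+ 2.

Lemma sumn_ord : sumn w = (\sum_(i < p) nth 0%N w i)%N.
Proof. by rewrite sumnE (big_nth 0%N) big_mkord. Qed.

Lemma sum_conj (s : seq C) :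
  \sum_(z <- conj_divisor s) z = conjc (\sum_(z <- s) z : R[i]).
Proof.
elim: s => [|z s IHs] /=; first by rewrite !big_nil conjc0.
by rewrite !big_cons IHs rmorphD.
Qed.

Lemma csum_cell x : \sum_(z <- cell_divisor x) z = (bal x)%:C.
Proof.
rewrite /cell_divisor !big_cat /= /bal rmorphD; congr (_ + _).
  rewrite /real_divisor big_flatten big_map big_enum /= rmorph_sum; apply: eq_bigr => i _.
  by rewrite big_nseq iter_addr_0 mulr_natl raddfMn.
rewrite sum_conj -/(csum x.2).
by case: (csum x.2) => a b; apply/eqP; rewrite eq_complex /= mulr2n subrr !eqxx.
Qed.

Lemma balancedE x : balanced alpha (cell_divisor x) <-> bal x = alpha * d%:R.
Proof.
rewrite /balanced csum_cell size_cell_divisor //.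
by split=> [/complexI|->].
Qed.

Lemma continuous_bal : continuous bal.
Proof.
apply: (continuous_add (K := R)).
  apply: (continuous_sum (K := R)) => i; apply: (continuous_mul (K := R)).
    exact: cst_continuous.
  exact: (continuous_comp_fun (@continuous_fst _ _) (@continuous_coord _ _ _ _ _)).
under eq_fun do rewrite mulr2n.
have cr : continuous (fun x : U => complex.Re (csum x.2) : R).
  apply: (@continuous_comp_fun _ _ _ (fun x : U => csum x.2 : C) (fun z : C => complex.Re z : R)).
    exact: (continuous_comp_fun (@continuous_snd _ _) continuous_csum).
  exact: continuous_Re.
exact: (continuous_add (K := R)).
Qed.

(** The rate at which spreading the real points changes [bal]. *)
Definition wmoment : R := \sum_(i < p) (nth 0%N w i)%:R * i%:R.

Lemma ReD (z z' : R[i]) : complex.Re (z + z') = complex.Re z + complex.Re z'.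
Proof. by case: z z' => a b [a' b']. Qed.

Lemma ImD (z z' : R[i]) : complex.Im (z + z') = complex.Im z + complex.Im z'.
Proof. by case: z z' => a b [a' b']. Qed.

Lemma Re_mulrn (z : R[i]) n : complex.Re (z *+ n) = complex.Re z *+ n.
Proof. by elim: n => // n IHn; rewrite !mulrS ReD IHn. Qed.

Lemma Im_mulrn (z : R[i]) n : complex.Im (z *+ n) = complex.Im z *+ n.
Proof. by elim: n => // n IHn; rewrite !mulrS ImD IHn. Qed.

Lemma dE_R : d%:R = \sum_(i < p) (nth 0%N w i)%:R + m%:R *+ 2 :> R.
Proof.
rewrite {1}(Omega_leE w_in) natrD sumn_ord natr_sum; congr (_ + _).
by rewrite -muln2 natrM mulr_natr.
Qed.

Lemma bal_shift t u x : bal (shift t u x) = bal x + (t * wmoment + u * d%:R).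
Proof.
rewrite /bal csum_shift ReD Re_mulrn /= dE_R /wmoment.
have -> : \sum_(i < p) (nth 0%N w i)%:R * (shift t u x).1 0 i =
    \sum_(i < p) (nth 0%N w i)%:R * x.1 0 i +
    (t * (\sum_(i < p) (nth 0%N w i)%:R * i%:R) + u * \sum_(i < p) (nth 0%N w i)%:R).
  rewrite 3?mulr_sumr -big_split /= -big_split /=.
  apply: eq_bigr => i _; rewrite mxE /=.
  by move: (nth 0%N w i)%:R (i%:R : R) (x.1 0 i) => a b c; ring.
by rewrite mulrnDl; ring.
Qed.

Lemma bal_scale s x : bal (scale s x) = s * bal x + (1 - s) * (alpha * d%:R).
Proof.
rewrite /bal csum_scale ReD Re_mulrn dE_R.
have -> : complex.Re (s%:C * csum x.2) = s * complex.Re (csum x.2).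
  by case: (csum x.2) => a b /=; rewrite mul0r subr0.
have -> : \sum_(i < p) (nth 0%N w i)%:R * (scale s x).1 0 i =
    s * (\sum_(i < p) (nth 0%N w i)%:R * x.1 0 i) +
    (1 - s) * (alpha * \sum_(i < p) (nth 0%N w i)%:R).
  rewrite !mulr_sumr -big_split /=; apply: eq_bigr => i _; rewrite mxE /=.
  by move: (nth 0%N w i)%:R (x.1 0 i) => a b; ring.
by rewrite mulrnDl /=; ring.
Qed.

(* Moving the real points apart and the other points up, at speed 1, while
   keeping the divisor balanced. *)
Definition spread t x : U := shift t (- (t * wmoment / d%:R)) x.

Lemma bal_spread t x : bal (spread t x) = bal x.
Proof.
rewrite bal_shift; have [d0|d0] := posnP d; last first.
  by rewrite mulNr divfK ?pnatr_eq0 -?lt0n // subrr addr0.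
(* For d = 0 the correcting translation divides by zero; then w is empty and there is nothing to
   correct. *)
have sw0 : sumn w = 0%N by have := Omega_leE w_in; rewrite {1}d0; lia.
have w0 : w = [::].
  case: w_in => + _ _; move: sw0; case: (w) => //= k v.
  by move=> /eqP; rewrite addn_eq0 => /andP[/eqP->].
have -> : wmoment = 0.
  by rewrite /wmoment big1 // => i _; have := ltn_ord i; rewrite {2}w0.
by rewrite !mulr0 mul0r oppr0 mul0r !addr0.
Qed.

Lemma spreadD t t' x : spread t (spread t' x) = spread (t + t') x.
Proof. by rewrite /spread shiftD; congr shift; ring. Qed.

Lemma spread0 x : spread 0 x = x.
Proof. by rewrite /spread !mul0r oppr0 shift0. Qed.

Lemma scale_spread s t x : scale s (spread t x) = spread (s * t) (scale s x).
Proof. by rewrite /spread scale_shift; congr shift; ring. Qed.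

Lemma continuous_spread (T : topologicalType) (t : T -> R) (f : T -> U) :
  continuous t -> continuous f -> continuous (fun a => spread (t a) (f a)).
Proof.
move=> ct cf; apply: continuous_shift => //.
apply: (continuous_opp (K := R)); apply: (continuous_mul (K := R)); last exact: cst_continuous.
by apply: (continuous_mul (K := R)) => //; exact: cst_continuous.
Qed.

Definition avgIm (D : SymPow m C) : R := complex.Im (csum D) / m%:R.

(** The minimum starts from the mean, which for m > 0 is never below it and which moves and scales
    with the points; a constant initial value would not. *)
Definition minIm (D : SymPow m C) : R := \big[Num.min/avgIm D]_(z <- points D) complex.Im z.

Lemma continuous_avgIm : continuous avgIm.
Proof.
apply: (continuous_mul (K := R)); last exact: cst_continuous.
exact: (continuous_comp_fun continuous_csum continuous_Im).
Qed.

Lemma continuous_bigmin (T : topologicalType) I (r : seq I) (f0 : T -> R) (f : I -> T -> R) :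
  continuous f0 -> (forall i, continuous (f i)) ->
  continuous (fun a => \big[Num.min/f0 a]_(i <- r) f i a).
Proof.
move=> c0 cf; elim: r => [|i r IHr]; first by under eq_fun do rewrite big_nil.
by under eq_fun do rewrite big_cons; exact: continuous_minr.
Qed.

Lemma continuous_minIm : continuous minIm.
Proof.
apply: sympow_continuous.
have -> : minIm \o \pi_(SymPow m C) =
    (fun u : 'rV[C]_m => \big[Num.min/avgIm (\pi_(SymPow m C) u)]_j complex.Im (u 0 j)).
  by apply/funext => u /=; rewrite /minIm (perm_big _ (points_pi u)) big_map big_enum.
apply: continuous_bigmin => [|j].
  exact: (continuous_comp_fun pi_sympow_continuous continuous_avgIm).
apply: (@continuous_comp_fun _ _ _ (fun u : 'rV[C]_m => u 0 j) (fun z : C => complex.Im z : R)).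
  exact: continuous_coord.
exact: continuous_Im.
Qed.

Definition gap x i : R := pt x i.+1 - pt x i.

Definition lin x : R := if (0 < m)%N then avgIm x.2 else gap x 0.

(** The initial value is again one that moves at speed 1: [minIm], or, when there are no nonreal
    points, the first gap. *)
Definition margin x : R :=
  \big[Num.min/if (0 < m)%N then minIm x.2 else gap x 0]_(i < p.-1) gap x i.

Lemma continuous_gap i : continuous (gap ^~ i).
Proof. by apply: (continuous_sub (K := R)); exact: continuous_pt. Qed.

Lemma continuous_lin : continuous lin.
Proof.
rewrite /lin; case: (0 < m)%N; last exact: continuous_gap.
exact: (continuous_comp_fun (@continuous_snd _ _) continuous_avgIm).
Qed.

Lemma continuous_margin : continuous margin.
Proof.
apply: continuous_bigmin => [|i]; last exact: continuous_gap.
case: (0 < m)%N; last exact: continuous_gap.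
exact: (continuous_comp_fun (@continuous_snd _ _) continuous_minIm).
Qed.

Lemma bigmin_shift I (r : seq I) (f : I -> R) t a :
  \big[Num.min/a + t]_(i <- r) (f i + t) = \big[Num.min/a]_(i <- r) f i + t.
Proof.
by elim: r => [|i r IHr]; rewrite ?big_nil // !big_cons IHr -addr_minl.
Qed.

Lemma bigmin_scale I (r : seq I) (f : I -> R) s a : 0 < s ->
  \big[Num.min/s * a]_(i <- r) (s * f i) = s * \big[Num.min/a]_(i <- r) f i.
Proof.
move=> s0; elim: r => [|i r IHr]; rewrite ?big_nil // !big_cons IHr.
by rewrite -minr_pMr // ltW.
Qed.

Lemma gap_shift t u x i : (i.+1 < p)%N -> gap (shift t u x) i = gap x i + t.
Proof. by move=> lt_ip; rewrite /gap !pt_shift ?(ltnW lt_ip) // -[i.+1]addn1 natrD; ring. Qed.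

Lemma gap_scale s x i : (i.+1 < p)%N -> gap (scale s x) i = s * gap x i.
Proof. by move=> lt_ip; rewrite /gap !pt_scale ?(ltnW lt_ip) //; ring. Qed.

Lemma avgIm_shift t u x : (0 < m)%N -> avgIm (shift t u x).2 = avgIm x.2 + t.
Proof.
move=> m0; rewrite /avgIm csum_shift ImD Im_mulrn /= mulrDl; congr (_ + _).
by rewrite -[t *+ m]mulr_natr mulfK // pnatr_eq0 -lt0n.
Qed.

Lemma avgIm_scale s x : avgIm (scale s x).2 = s * avgIm x.2.
Proof.
rewrite /avgIm csum_scale ImD Im_mulrn /= mul0rn addr0 mulrA; congr (_ / _).
by case: (csum x.2) => a b /=; rewrite mul0r addr0.
Qed.

Lemma minIm_shift t u x : (0 < m)%N -> minIm (shift t u x).2 = minIm x.2 + t.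
Proof.
move=> m0; rewrite /minIm avgIm_shift // (perm_big _ (points_symmap _ _)) big_map /=.
by rewrite -bigmin_shift; apply: eq_bigr => z _; rewrite mul1r ImD.
Qed.

Lemma minIm_scale s x : 0 < s -> minIm (scale s x).2 = s * minIm x.2.
Proof.
move=> s0; rewrite /minIm avgIm_scale (perm_big _ (points_symmap _ _)) big_map /=.
by rewrite -bigmin_scale //; apply: eq_bigr => z _; rewrite Im_scale_at.
Qed.

Context (nondeg : (0 < m)%N || (1 < p)%N).

(** [nondeg] makes [lin] read an actual quantity: for m = 0, the gap at index 0 lies between two
    points of the divisor only if 1 < p. *)
Lemma lin_shift t u x : lin (shift t u x) = lin x + t.
Proof.
rewrite /lin; have [m0|] := ltnP 0 m; first exact: avgIm_shift.
by move=> m0; rewrite gap_shift //; move: nondeg; rewrite ltnNge m0.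
Qed.

Lemma lin_scale s x : lin (scale s x) = s * lin x.
Proof.
rewrite /lin; have [m0|] := ltnP 0 m; first exact: avgIm_scale.
by move=> m0; rewrite gap_scale //; move: nondeg; rewrite ltnNge m0.
Qed.

Lemma margin_shift t u x : margin (shift t u x) = margin x + t.
Proof.
rewrite /margin -bigmin_shift.
have -> : (if (0 < m)%N then minIm (shift t u x).2 else gap (shift t u x) 0) =
    (if (0 < m)%N then minIm x.2 else gap x 0) + t.
  have [m0|] := ltnP 0 m; first exact: minIm_shift.
  by move=> m0; rewrite gap_shift //; move: nondeg; rewrite ltnNge m0.
by apply: eq_bigr => i _; rewrite gap_shift //; have := ltn_ord i; lia.
Qed.

Lemma margin_scale s x : 0 < s -> margin (scale s x) = s * margin x.
Proof.
move=> s0; rewrite /margin -bigmin_scale //.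
have -> : (if (0 < m)%N then minIm (scale s x).2 else gap (scale s x) 0) =
    s * (if (0 < m)%N then minIm x.2 else gap x 0).
  have [m0|] := ltnP 0 m; first exact: minIm_scale.
  by move=> m0; rewrite gap_scale //; move: nondeg; rewrite ltnNge m0.
by apply: eq_bigr => i _; rewrite gap_scale //; have := ltn_ord i; lia.
Qed.

Lemma csum_Im (D : SymPow m C) : complex.Im (csum D) = \sum_(z <- points D) complex.Im z.
Proof.
rewrite /csum; elim: (points D) => [|z s IHs]; first by rewrite !big_nil.
by rewrite !big_cons ImD IHs.
Qed.

Lemma bigmin_ge0 I (r : seq I) (f : I -> R) a :
  (0 <= \big[Num.min/a]_(i <- r) f i) = (0 <= a) && all (fun i => 0 <= f i) r.
Proof.
elim: r => [|i r IHr] /=; first by rewrite big_nil andbT.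
by rewrite big_cons le_min IHr andbCA.
Qed.

Lemma bigmin_gt0 I (r : seq I) (f : I -> R) a :
  (0 < \big[Num.min/a]_(i <- r) f i) = (0 < a) && all (fun i => 0 < f i) r.
Proof.
elim: r => [|i r IHr] /=; first by rewrite big_nil andbT.
by rewrite big_cons lt_min IHr andbCA.
Qed.

Lemma minIm_ge0 (D : SymPow m C) : (0 <= minIm D) = all (fun z : C => 0 <= complex.Im z) (points D).
Proof.
rewrite /minIm bigmin_ge0; apply: andb_idl => /allP h.
by rewrite /avgIm csum_Im divr_ge0 // big_seq sumr_ge0.
Qed.

Lemma minIm_gt0 (D : SymPow m C) : (0 < m)%N ->
  (0 < minIm D) = all (fun z : C => 0 < complex.Im z) (points D).
Proof.
move=> m0; rewrite /minIm bigmin_gt0; apply: andb_idl => /allP h.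
rewrite /avgIm csum_Im divr_gt0 ?ltr0n //.
have : (0 < size (points D))%N by rewrite size_points.
case: (points D) h => // z s h _; rewrite big_cons ltr_pwDl ?h ?mem_head //.
by rewrite big_seq sumr_ge0 // => z' z's; rewrite ltW // h // inE z's orbT.
Qed.

Lemma points_nil (D : SymPow m C) : m = 0%N -> points D = [::].
Proof. by move=> m0; apply: size0nil; rewrite size_points. Qed.

Lemma sorted_gap (e : rel R) (le0 : pred R) x :
  (forall a b, e a b = le0 (b - a)) ->
  sorted e (row_seq x.1) = all (fun i => le0 (gap x i)) (iota 0 p.-1).
Proof.
move=> ele; apply/(sortedP 0)/allP => h i.
  rewrite mem_iota add0n => /= lt_ip; rewrite -ele; apply: h.
  by rewrite size_row_seq; lia.
rewrite size_row_seq => lt_ip; rewrite ele; apply: h.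
by rewrite mem_iota add0n /=; lia.
Qed.

Lemma gap0_last x : (0 < m)%N = false -> (0 < p.-1)%N.
Proof. by move: nondeg => /orP[->//|]; lia. Qed.

Lemma margin_iotaE x : margin x =
  \big[Num.min/if (0 < m)%N then minIm x.2 else gap x 0]_(i <- iota 0 p.-1) gap x i.
Proof. by rewrite /margin -(big_mkord xpredT (gap x)) /index_iota subn0. Qed.

Lemma margin_ge0 x : 0 <= margin x <-> Pi_cone x.1 /\ Sym_in Hplane x.2.
Proof.
rewrite (Sym_inE x.2 (a := fun z => 0 <= complex.Im z) (fun z => iff_refl _)) Pi_coneE.
rewrite (@sorted_gap _ (fun a => 0 <= a)) => [|a b]; last by rewrite subr_ge0.
rewrite margin_iotaE bigmin_ge0; case: ifP => [m0|m0].
  by rewrite minIm_ge0 andbC; split=> /andP.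
rewrite points_nil; last by move: m0; case: (m).
(* For m = 0 the initial value of the minimum is itself one of the gaps. *)
split=> [/andP[_ ->//]|[h _]]; rewrite h andbT.
by apply: (allP h); rewrite mem_iota (gap0_last x).
Qed.

Lemma margin_gt0 x : 0 < margin x <-> Pi_cone_int x.1 /\ Sym_in Hplane_int x.2.
Proof.
rewrite (Sym_inE x.2 (a := fun z => 0 < complex.Im z) (fun z => iff_refl _)) Pi_cone_intE.
rewrite (@sorted_gap _ (fun a => 0 < a)) => [|a b]; last by rewrite subr_gt0.
rewrite margin_iotaE bigmin_gt0; case: ifP => [m0|m0].
  by rewrite minIm_gt0 // andbC; split=> /andP.
rewrite points_nil; last by move: m0; case: (m).
split=> [/andP[_ ->//]|[h _]]; rewrite h andbT.
by apply: (allP h); rewrite mem_iota (gap0_last x).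
Qed.

(* margin and lin both grow at speed 1 along spread, so the following
   homeomorphism turns margin into lin. *)
Definition straighten x : U := spread (margin x - lin x) x.

Definition unstraighten x : U := spread (lin x - margin x) x.

Lemma lin_spread t x : lin (spread t x) = lin x + t.
Proof. exact: lin_shift. Qed.

Lemma margin_spread t x : margin (spread t x) = margin x + t.
Proof. exact: margin_shift. Qed.

Lemma straightenK : cancel straighten unstraighten.
Proof.
move=> x; rewrite /unstraighten /straighten lin_spread margin_spread spreadD.
by rewrite -[RHS]spread0; congr spread; ring.
Qed.

Lemma unstraightenK : cancel unstraighten straighten.
Proof.
move=> x; rewrite /unstraighten /straighten lin_spread margin_spread spreadD.
by rewrite -[RHS]spread0; congr spread; ring.
Qed.

Lemma margin_unstraighten x : margin (unstraighten x) = lin x.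
Proof. by rewrite margin_spread addrC subrK. Qed.

Lemma continuous_straighten : continuous straighten.
Proof.
apply: continuous_spread; last by move=> x; exact: cvg_id.
by apply: (continuous_sub (K := R)); [exact: continuous_margin|exact: continuous_lin].
Qed.

Lemma continuous_unstraighten : continuous unstraighten.
Proof.
apply: continuous_spread; last by move=> x; exact: cvg_id.
by apply: (continuous_sub (K := R)); [exact: continuous_lin|exact: continuous_margin].
Qed.

Lemma scale_unstraighten s x : 0 < s -> scale s (unstraighten x) = unstraighten (scale s x).
Proof.
by move=> s0; rewrite /unstraighten scale_spread lin_scale margin_scale // mulrBr.
Qed.

Lemma Phi_scale s x : Phi d w (scale s x) = dilate alpha s (Phi d w x).
Proof.
apply: Phi_eq; apply/(root_divisor_perm _ (root_divisor_dilate alpha s (root_divisor_Phi w_in x))).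
rewrite !cell_divisorE /full_div !map_cat map_rdiv_scale.
have -> : row_seq (scale s x).1 = [seq s * y + (1 - s) * alpha | y <- row_seq x.1].
  by rewrite /row_seq -[RHS]map_comp; apply: eq_map => i; rewrite /= mxE.
rewrite perm_cat2l perm_sym; apply: perm_cat; first exact: points_symmap.
apply: perm_trans (perm_map _ (points_symmap _ _)) _; apply: eq_perm_eq.
rewrite /conj_divisor -[LHS]map_comp -[RHS]map_comp.
by apply: eq_map => z; rewrite /= scale_at_conj.
Qed.

(** All points over the apex polynomial equal alpha, the centre of the dilations. With s = 2 this
    shows that the chart sends only the origin to the apex. *)
Lemma scale_fixed s x : Phi d w x = O_pt d alpha -> scale s x = x.
Proof.
move=> E; have rD := root_divisor_Phi w_in x.
have all_alpha z : z \in cell_divisor x -> z = alpha%:C.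
  rewrite -root_prod_XsubC -[\prod_(_ <- _) _]rD E monic_of_O rmorphXn /=.
  by rewrite rmorphB /= map_polyX map_polyC rootE horner_exp hornerXsubC expf_eq0 subr_eq0 => /andP[_ /eqP].
rewrite [RHS]surjective_pairing; congr pair.
  apply/rowP => i; rewrite mxE.
  suff /complexI -> : ((x.1 0 i)%:C : R[i]) = alpha%:C by ring.
  apply: all_alpha; rewrite cell_divisorE mem_cat mem_rdiv ?size_row_seq ?map_f ?mem_enum //.
  by case: w_in.
rewrite -[RHS]symmap_id; apply: points_inj.
rewrite (permPl (points_symmap _ _)) perm_sym (permPl (points_symmap _ _)) map_id.
apply: eq_perm_eq; rewrite -[LHS]map_id; apply/eq_in_map => z zx.
rewrite (all_alpha z); last by rewrite !mem_cat zx !orbT.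
by rewrite scale_at_real; congr (_%:C); ring.
Qed.

End AffineActions.

(** * Coordinates on the ambient space and charts of the balanced pairs *)

Section Charts.
Context {R : realType} {d : nat} {w : seq nat} (w_in : Omega_le d w) (alpha : R).
Local Open Scope complex_scope.
Local Notation C := (R[i]^o).
Local Notation p := (size w).
Local Notation m := ((d - sumn w)./2).
Local Notation U := (@cell_ambient R d w).
Local Notation I := ('I_p + 'I_m + 'I_m)%type.
Implicit Types (x : U) (s t u : R) (f : I -> R).

(** The point reflection z -> alpha - z rather than a translation: it also moves alpha to the
    origin, and being an involution it serves for [co] and for its inverse [ci]. *)
Definition reflect_at (z : C) : C := (-1) * z + alpha%:C.

Lemma reflect_atK : involutive reflect_at.
Proof. by move=> z; rewrite /reflect_at; ring. Qed.

Lemma symmap_reflectK n : involutive (@symmap R n reflect_at).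
Proof. by move=> D; rewrite symmap_comp -[RHS]symmap_id; apply: eq_symmap => z /=; rewrite reflect_atK. Qed.

(* Up to sign, the coefficients of the polynomial with root divisor D in the
   powers of X - alpha. *)
Definition cpoly x : {poly R[i]} := sympoly (symmap reflect_at x.2).

(** Global coordinates of the ambient space: the first real point, the successive gaps, and the
    coefficients of the nonreal part. Dilations about alpha multiply each of them by a power of
    s. *)
Definition co x (i : I) : R :=
  match i with
  | inl (inl j) => if j == 0%N :> nat then pt x 0 - alpha else gap x j.-1
  | inl (inr k) => complex.Re (cpoly x)`_k
  | inr k => complex.Im (cpoly x)`_k
  end.

Definition real_co f (j : nat) : R := if insub j is Some j' then f (inl (inl j')) else 0.

Definition ci f : U :=
  (\row_i (alpha + \sum_(j < i.+1) real_co f j),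
   symmap reflect_at (symW (\row_k f (inl (inr k)), \row_k f (inr k)))).

Lemma real_co_co x j : (j < p)%N ->
  real_co (co x) j = if j == 0%N then pt x 0 - alpha else gap x j.-1.
Proof. by move=> lt_jp; rewrite /real_co insubT. Qed.

Lemma coK : cancel co ci.
Proof.
move=> x; rewrite [RHS]surjective_pairing; congr pair.
  apply/rowP => i; rewrite mxE -ptE; have lt_ip := ltn_ord i.
  suff H k : (k < p)%N -> alpha + \sum_(j < k.+1) real_co (co x) j = pt x k by exact: H.
  elim: k => [|k IHk] lt_kp.
    by rewrite big_ord1 /= real_co_co //= addrC subrK.
  by rewrite big_ord_recr /= addrA IHk ?(ltnW lt_kp) // real_co_co //= /gap addrC subrK.
rewrite -[RHS]symmap_reflectK; congr symmap; by rewrite -[RHS]symVK; congr symW.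
Qed.

Lemma pt_ci f j : (j < p)%N -> pt (ci f) j = alpha + \sum_(i < j.+1) real_co f i.
Proof. by move=> lt_jp; rewrite (ptE _ (Ordinal lt_jp)) mxE. Qed.

Lemma ciK f : co (ci f) =1 f.
Proof.
have rc (j : 'I_p) : real_co f j = f (inl (inl j)).
  by rewrite /real_co insubT //= => lt; congr (f (inl (inl _))); apply: val_inj.
have cp : cpoly (ci f) = monic_seq (\row_k f (inl (inr k)), \row_k f (inr k)).
  by rewrite /cpoly symmap_reflectK sympoly_symW.
case=> [[j|k]|k].
- rewrite /=; have lt_jp := ltn_ord j; case: eqP => [j0|/eqP j0].
    rewrite pt_ci; last by rewrite -j0.
    by rewrite big_ord1 addrC addKr -rc j0.
  have lt0j : (0 < j)%N by rewrite lt0n.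
  rewrite /gap prednK // !pt_ci //; last by rewrite prednK // ltnW.
  by rewrite prednK // big_ord_recr /= -rc; ring.
- by rewrite /= cp coef_monic_seq /= mxE.
by rewrite /= cp coef_monic_seq /= mxE.
Qed.

Lemma continuous_co i : continuous (co ^~ i).
Proof.
have cp k : continuous (fun x => (cpoly x)`_k : C).
  apply: (@continuous_comp_fun _ _ _ (fun x : U => symmap reflect_at x.2) (fun D => (sympoly D)`_k : C)).
    apply: continuous_symmap_affine; [exact: cst_continuous|exact: cst_continuous|].
    exact: continuous_snd.
  exact: continuous_sympoly.
case: i => [[j|k]|k] /=.
- case: eqP => _; last exact: continuous_gap.
  by apply: (continuous_sub (K := R)); [exact: continuous_pt|exact: cst_continuous].
- exact: (continuous_comp_fun (@cp k) continuous_Re).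
exact: (continuous_comp_fun (@cp k) continuous_Im).
Qed.

Lemma continuous_ci (T : topologicalType) (F : T -> I -> R) :
  (forall i, continuous (F ^~ i)) -> continuous (fun a => ci (F a)).
Proof.
move=> cF; apply: continuous_pair.
  apply: continuous_mx => i0 i; rewrite {i0}(ord1 i0); under eq_fun do rewrite mxE.
  apply: (continuous_add (K := R)); first exact: cst_continuous.
  apply: (continuous_sum (K := R)) => j; rewrite /real_co.
  by case: (insub _) => [j'|]; [exact: cF|exact: cst_continuous].
apply: continuous_symmap_affine; [exact: cst_continuous|exact: cst_continuous|].
apply: (@continuous_comp_fun _ _ _ (fun a =>
    (\row_k F a (inl (inr k)), \row_k F a (inr k))) symW); last exact: continuous_symW.
by apply: continuous_pair; apply: continuous_mx => i0 k; under eq_fun do rewrite mxE; exact: cF.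
Qed.

Definition wt (i : I) : nat :=
  match i with inl (inl _) => 1 | inl (inr k) => m - k | inr k => m - k end.

Lemma wt_gt0 i : (0 < wt i)%N.
Proof. by case: i => [[j|k]|k] //=; rewrite subn_gt0. Qed.

(** The reflection turns dilation about alpha into multiplication by s, so [prod_XsubC_affine]
    applies with c = 0 and a single summand survives. *)
Lemma coef_cpoly_scale s x k : (k <= m)%N ->
  (cpoly (scale alpha s x))`_k = (cpoly x)`_k * s%:C ^+ (m - k).
Proof.
move=> le_km; have -> : cpoly (scale alpha s x) =
    \prod_(z <- points (symmap reflect_at x.2)) ('X - (s%:C * z + 0)%:P).
  rewrite /cpoly /sympoly [LHS](perm_big _ (points_symmap _ _)) big_map.
  rewrite [LHS](perm_big _ (points_symmap _ _)) [RHS](perm_big _ (points_symmap _ _)) !big_map.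
  apply: eq_bigr => z _; congr ('X - _%:P).
  by rewrite /reflect_at /scale_at rmorphM rmorphB rmorph1 /=; ring.
rewrite prod_XsubC_affine size_points coef_sum.
rewrite (bigD1 (Ordinal (leq_ltn_trans le_km (ltnSn m)))) //= subr0 coefZ coefXn eqxx mulr1.
rewrite [X in _ + X]big1 ?addr0 // => j jk; rewrite coefZ coefXn eq_sym.
by rewrite -(inj_eq val_inj) /= in jk; rewrite (negPf jk) mulr0.
Qed.

Lemma co_scale s x i : co (scale alpha s x) i = s ^+ wt i * co x i.
Proof.
have E k : (k < m)%N -> (cpoly (scale alpha s x))`_k = (s ^+ (m - k))%:C * (cpoly x)`_k.
  by move=> lt_km; rewrite coef_cpoly_scale ?(ltnW lt_km) // rmorphXn mulrC.
case: i => [[j|k]|k] /=.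
- have lt_jp := ltn_ord j; case: eqP => [j0|/eqP j0].
    by rewrite pt_scale ?expr1; [ring|rewrite -j0].
  by rewrite gap_scale ?expr1 // prednK // lt0n.
- by rewrite E //; case: (_`_k) => a b /=; rewrite mul0r subr0.
by rewrite E //; case: (_`_k) => a b /=; rewrite mul0r addr0.
Qed.

Lemma ci_scale s f : ci (fun i => s ^+ wt i * f i) = scale alpha s (ci f).
Proof.
rewrite -[RHS]coK; congr ci; apply/funext => i.
by rewrite co_scale ciK.
Qed.

Lemma cpoly_last x : (0 < m)%N -> (cpoly x)`_m.-1 = csum x.2 - alpha%:C *+ m.
Proof.
move=> m0; rewrite /cpoly /sympoly.
have := @coefPn_prod_XsubC _ (points (symmap reflect_at x.2)).
rewrite size_points => ->; last by rewrite -lt0n.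
rewrite (perm_big _ (points_symmap _ _)) big_map.
rewrite /reflect_at big_split /= -mulr_sumr mulN1r big_const_seq count_predT size_points.
by rewrite iter_addr_0 opprD opprK.
Qed.

Context (nondeg : (0 < m)%N || (1 < p)%N).

(** Balance is not in general the vanishing of one coordinate of [co], but anchor = 0 is, and
    [anchor] moves with horizontal translations. They therefore identify the slice anchor = 0 with
    the balanced pairs. *)
Definition anchor x : R :=
  if (0 < p)%N then pt x 0 - alpha else complex.Re (csum x.2) / m%:R - alpha.

Lemma m_gt0 : (0 < p)%N = false -> (0 < m)%N.
Proof. by move=> p0; move: nondeg => /orP[//|]; lia. Qed.

Lemma anchor_shift u x : anchor (shift 0 u x) = anchor x + u.
Proof.
rewrite /anchor; case: ifP => [p0|/m_gt0 m0].
  by rewrite pt_shift // mulr0 add0r addrAC.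
rewrite csum_shift ReD Re_mulrn /= mulrDl addrAC; congr (_ + _).
by rewrite -[u *+ m]mulr_natr mulfK // pnatr_eq0 -lt0n.
Qed.

Lemma continuous_anchor : continuous anchor.
Proof.
rewrite /anchor; case: (0 < p)%N; (apply: (continuous_sub (K := R)); last exact: cst_continuous).
  exact: continuous_pt.
apply: (continuous_mul (K := R)); last exact: cst_continuous.
apply: (@continuous_comp_fun _ _ _ (fun x : U => csum x.2 : C) (fun z : C => complex.Re z : R)).
  exact: (continuous_comp_fun (@continuous_snd _ _) (@continuous_csum _ _ _)).
exact: continuous_Re.
Qed.

Lemma anchor_coord : exists i0 : I, forall x, anchor x = 0 <-> co x i0 = 0.
Proof.
rewrite /anchor; have [p0|p0] := boolP (0 < p)%N; first by exists (inl (inl (Ordinal p0))).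
have m0 := m_gt0 (negPf p0).
have lt_m : (m.-1 < m)%N by rewrite prednK.
exists (inl (inr (Ordinal lt_m))) => x; rewrite /= cpoly_last // ReD.
have -> : complex.Re (- (alpha%:C *+ m)) = - (alpha * m%:R) :> R.
  by rewrite -raddfMn /= mulr_natr.
have m0R : m%:R != 0 :> R by rewrite pnatr_eq0 -lt0n.
split=> [/eqP|/eqP]; rewrite subr_eq0 => /eqP E; apply/eqP; rewrite subr_eq0.
  by rewrite -E divfK.
by rewrite E mulfK.
Qed.

(** For m > 0 the subleading coefficient has imaginary part m times the mean; otherwise the first
    gap is a coordinate. That it differs from the anchor coordinate keeps it alive on the slice. *)
Lemma lin_coord : exists (i1 : I) (c1 : R), [/\ 0 < c1,
  forall x, co x i1 = c1 * lin x & forall i0, (forall x, anchor x = 0 <-> co x i0 = 0) -> i1 != i0].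
Proof.
suff [i1 [c1 [c10 cl]]] : exists (i1 : I) (c1 : R), 0 < c1 /\ forall x, co x i1 = c1 * lin x.
  exists i1, c1; split=> // i0 h0; apply/negP => /eqP i10.
  (* Horizontal translation preserves [lin] but can make [anchor] vanish. If both coordinates
     agreed, translating this point would turn its value 1 into 0. *)
  pose f i : R := if i == i1 then 1 else 0.
  have f1 : co (ci f) i1 = 1 by rewrite ciK /f eqxx.
  have : co (shift 0 (- anchor (ci f)) (ci f)) i1 = 0.
    by rewrite i10; apply/h0; rewrite anchor_shift subrr.
  rewrite cl (lin_shift nondeg) addr0 -cl f1 => /eqP.
  by rewrite oner_eq0.
have [m0|m0] := boolP (0 < m)%N.
  have lt_m : (m.-1 < m)%N by rewrite prednK.
  exists (inr (Ordinal lt_m)), m%:R; rewrite ltr0n; split=> // x.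
  rewrite /= cpoly_last // ImD /lin m0 /avgIm mulrC divfK ?pnatr_eq0 -?lt0n //.
  by rewrite -raddfMn /= oppr0 addr0.
have p1 : (1 < p)%N by move: nondeg; rewrite (negPf m0).
exists (inl (inl (Ordinal p1))), 1; split=> // x.
by rewrite mul1r /lin (negPf m0).
Qed.

Lemma punctured_enum (J : finType) (i0 : J) n : n.+1 = #|J| ->
  exists e : 'I_n -> J, injective e /\ forall i, i != i0 <-> exists j, e j = i.
Proof.
move=> nJ; have cn : n = #|[set~ i0]%SET| by rewrite cardsC1 -nJ.
exists (fun j => enum_val (cast_ord cn j)); split.
  by move=> j j' /enum_val_inj/cast_ord_inj.
move=> i; split=> [ii0|[j <-]].
  have i_in : i \in [set~ i0]%SET by rewrite !inE.
  exists (cast_ord (esym cn) (enum_rank_in i_in i)).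
  by rewrite cast_ordKV enum_rankK_in.
by have := enum_valP (cast_ord cn j); rewrite !inE.
Qed.

(** A chart of all balanced pairs, not only of the cell: the cell is cut out by the sign of one
    coordinate, and dilations act diagonally with weights k. [chi'] is total but inverts [chi] only
    on balanced pairs. *)
Record cell_chart n (i1 : 'I_n) (k : 'I_n -> nat) (chi : 'rV[R]_n -> U)
    (chi' : U -> 'rV[R]_n) : Prop := {
  chart_continuous : continuous chi;
  chart_inv_continuous : continuous chi';
  chartK : cancel chi chi';
  chart_invK : forall x, balanced alpha (cell_divisor x) -> chi (chi' x) = x;
  chart_cell : forall xi, cell_e d alpha w (chi xi) <-> 0 <= xi 0 i1;
  chart_cell_int : forall xi, cell_int alpha (chi xi) <-> 0 < xi 0 i1;
  chart_weight : forall i, (0 < k i)%N;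
  chart_dilate : forall s xi, 0 < s ->
    Phi d w (chi (wdil k s xi)) = dilate alpha s (Phi d w (chi xi));
  chart_apex : forall xi, Phi d w (chi xi) = O_pt d alpha -> xi = 0 }.

Lemma cell_chart_ex n : n.+1 = (p + m + m)%N ->
  exists i1 k chi chi', @cell_chart n i1 k chi chi'.
Proof.
move=> nE.
have d0 : (0 < d)%N.
  rewrite (Omega_leE w_in); case: w_in nondeg => w0 _ _ /orP[m0|p1]; first by lia.
  by case: (w) w0 p1 => //= a v /andP[a0 _] _; lia.
have dR : d%:R != 0 :> R by rewrite pnatr_eq0 -lt0n.
have [i0 h0] := anchor_coord.
have [i1 [c1 [c10 cl /(_ i0 h0) i10]]] := lin_coord.
have [|e [ei eP]] := @punctured_enum _ i0 n.
  by rewrite nE !card_sum !card_ord.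
have [j1 j1E] := (eP i1).1 i10.
(* The n free coordinates are extended by 0 at the anchor coordinate [i0]. *)
pose ext (xi : 'rV[R]_n) (i : I) : R := if [pick j | e j == i] is Some j then xi 0 j else 0.
have ext_e xi j : ext xi (e j) = xi 0 j.
  rewrite /ext; case: pickP => [j' /eqP/ei->//|/(_ j)]; by rewrite eqxx.
have ext_0 xi : ext xi i0 = 0.
  rewrite /ext; case: pickP => // j /eqP ej.
  by have /(eP i0).2 : exists j, e j = i0 by [exists j]; rewrite eqxx.
pose res f : 'rV[R]_n := \row_j f (e j).
have extK xi : res (ext xi) = xi by apply/rowP => j; rewrite mxE ext_e.
have resK f : f i0 = 0 -> ext (res f) = f.
  move=> f0; apply/funext => i; have [->|ii0] := eqVneq i i0; first by rewrite ext_0 f0.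
  by have [j <-] := (eP i).1 ii0; rewrite ext_e mxE.
(* [nrm] and [cen] are inverse horizontal translations between the balanced pairs and the slice
   anchor = 0. *)
pose nrm x := shift 0 (- anchor x) x.
pose cen x := shift 0 ((alpha * d%:R - bal x) / d%:R) x.
have anchor_nrm x : anchor (nrm x) = 0 by rewrite anchor_shift subrr.
have bal_cen x : bal (cen x) = alpha * d%:R.
  by rewrite (bal_shift w_in) mul0r add0r divfK // addrC subrK.
have cenK x : anchor x = 0 -> nrm (cen x) = x.
  by move=> a0; rewrite /nrm anchor_shift a0 add0r shiftD addr0 addNr shift0.
have nrmK x : bal x = alpha * d%:R -> cen (nrm x) = x.
  move=> b0; rewrite /cen (bal_shift w_in) b0 shiftD addr0 mul0r add0r.
  rewrite mulNr opprD opprK addrA subrr add0r mulfK // subrr.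
  exact: shift0.
pose kap (xi : 'rV[R]_n) := cen (ci (ext xi)).
pose kap' x := res (co (nrm x)).
have anchor_ci (xi : 'rV[R]_n) : anchor (ci (ext xi)) = 0 by apply/h0; rewrite ciK ext_0.
have kapK (xi : 'rV[R]_n) : kap' (kap xi) = xi.
  rewrite /kap' /kap cenK // -[RHS]extK; congr res; apply/funext => i.
  by rewrite ciK.
have kap'K x : bal x = alpha * d%:R -> kap (kap' x) = x.
  move=> b0; rewrite /kap /kap' resK ?coK ?nrmK //.
  by apply/h0; exact: anchor_nrm.
have bal_kap (xi : 'rV[R]_n) : bal (kap xi) = alpha * d%:R by exact: bal_cen.
have lin_kap (xi : 'rV[R]_n) : xi 0 j1 = c1 * lin (kap xi).
  by rewrite (lin_shift nondeg) addr0 -cl ciK -j1E ext_e.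
have cid : continuous (fun x : U => x) by move=> x; exact: cvg_id.
have c_nrm : continuous nrm.
  apply: continuous_shift => //; first exact: cst_continuous.
  by apply: (continuous_opp (K := R)); exact: continuous_anchor.
have c_cen : continuous cen.
  apply: continuous_shift => //; first exact: cst_continuous.
  apply: (continuous_mul (K := R)); last exact: cst_continuous.
  by apply: (continuous_sub (K := R)); [exact: cst_continuous|exact: continuous_bal].
have c_kap : continuous kap.
  apply: (@continuous_comp_fun _ _ _ (fun xi => ci (ext xi)) cen) => //.
  apply: continuous_ci => i; rewrite /ext.
  by case: pickP => [j _|_]; [exact: continuous_coord|exact: cst_continuous].
have c_kap' : continuous kap'.
  apply: continuous_mx => a0 j; rewrite {a0}(ord1 a0); under eq_fun do rewrite mxE.
  apply: (@continuous_comp_fun _ _ _ nrm (co ^~ (e j))) => //.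
  exact: continuous_co.
pose k j := wt (e j).
have kap_scale s (xi : 'rV[R]_n) : kap (wdil k s xi) = scale alpha s (kap xi).
  have -> : kap (wdil k s xi) = cen (scale alpha s (ci (ext xi))).
    rewrite /kap -ci_scale; congr (cen (ci _)); apply/funext => i.
    have [->|ii0] := eqVneq i i0; first by rewrite !ext_0 mulr0.
    by have [j <-] := (eP i).1 ii0; rewrite !ext_e wdilE.
  rewrite /kap /cen (bal_scale w_in) scale_shift mulr0; congr shift.
  by rewrite mulrA; congr (_ / _); ring.
(* The margin of [chi xi] is [lin (kap xi)], a positive multiple of the coordinate [j1]; so the sign
   of that coordinate decides membership in the cell. *)
pose chi (xi : 'rV[R]_n) := unstraighten (kap xi).
pose chi' x := kap' (straighten x).
have bal_st x : bal (straighten x) = bal x by exact: bal_spread.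
have bal_ust x : bal (unstraighten x) = bal x by exact: bal_spread.
have chi_bal (xi : 'rV[R]_n) : balanced alpha (cell_divisor (chi xi)).
  by apply/(balancedE w_in); rewrite bal_ust bal_kap.
have chi_m (xi : 'rV[R]_n) : margin (chi xi) = lin (kap xi) by exact: margin_unstraighten.
exists j1, k, chi, chi'; split=> //.
- exact: (continuous_comp_fun c_kap (@continuous_unstraighten _ _ _)).
- exact: (continuous_comp_fun (@continuous_straighten _ _ _) c_kap').
- by move=> xi; rewrite /chi' /chi (unstraightenK nondeg) kapK.
- move=> x /(balancedE w_in) bx; rewrite /chi /chi' kap'K ?bal_st //.
  exact: (straightenK nondeg).
- move=> xi; rewrite lin_kap -chi_m pmulr_rge0 // (margin_ge0 nondeg).
  by split=> [[px sx _]|[px sx]].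
- move=> xi; rewrite lin_kap -chi_m pmulr_rgt0 // (margin_gt0 nondeg).
  by split=> [[px sx _]|[px sx]].
- by move=> j; exact: wt_gt0.
- by move=> s xi s0; rewrite -(Phi_scale w_in) (scale_unstraighten _ nondeg) // /chi kap_scale.
move=> xi xiO.
(* Pairs over the apex are fixed by doubling; in the chart each coordinate is then fixed by a factor
   2^k > 1 and vanishes. *)
have E : chi (wdil k 2 xi) = chi xi.
  rewrite /chi kap_scale -(scale_unstraighten _ nondeg) //.
  exact: (scale_fixed w_in).
have {}E : wdil k 2 xi = xi.
  have /(congr1 chi') := E; rewrite /chi' /chi !(unstraightenK nondeg).
  by rewrite !kapK.
apply/rowP => j; rewrite mxE; have := congr1 (fun y : 'rV[R]_n => y 0 j) E.
rewrite wdilE => /eqP; rewrite -subr_eq0 -{2}[xi 0 j]mul1r -mulrBl mulf_eq0 => /orP[|/eqP//].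
rewrite subr_eq0 => /eqP e1.
have : 1 < (2 : R) ^+ k j by rewrite exprn_egt1 ?ltr1n // -lt0n wt_gt0.
by rewrite e1 ltxx.
Qed.

End Charts.

(** * Parametrizing the closed cells by standard balls *)

Section CellData.
Context {R : realType} {d : nat} {w : seq nat} (w_in : Omega_le d w) (alpha : R).
Local Open Scope complex_scope.
Local Notation C := (R[i]^o).
Local Notation p := (size w).
Local Notation m := ((d - sumn w)./2).
Local Notation U := (@cell_ambient R d w).

Lemma within_continuous_at (S T : topologicalType) (A : set S) (f : S -> T) :
  (forall x, A x -> {for x, continuous f}) -> {within A, continuous f}.
Proof.
by move=> cf; apply: continuous_in_subspaceT => x; rewrite inE; exact: cf.
Qed.

Lemma degenerate_int (x : U) : ~~ ((0 < m)%N || (1 < p)%N) ->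
  cell_e d alpha w x -> cell_int alpha x.
Proof.
rewrite negb_or -!leqNgt leqn0 => /andP[/eqP m0 p1] [px sx bx]; split=> //.
  by move=> i j; have := ltn_ord j; lia.
by move=> z; rewrite points_nil.
Qed.

(** Balance determines the only point of such a divisor. *)
Lemma degenerate_eq (x x' : U) : (size w = 1)%N -> m = 0%N ->
  balanced alpha (cell_divisor x) -> balanced alpha (cell_divisor x') -> x = x'.
Proof.
move=> p1 m0 /(balancedE w_in) bx /(balancedE w_in) bx'.
rewrite [x]surjective_pairing [x']surjective_pairing; congr pair; last first.
  by apply: points_inj; rewrite !points_nil.
have c0 (z : U) : csum z.2 = 0 by rewrite /csum points_nil // big_nil.
have := bx; rewrite -bx' /bal !c0 mul0rn !addr0.
case: w w_in p1 m0 x x' bx bx' c0 => // a [|//] [/= + _ _] _ _ x x' _ _ _.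
rewrite andbT !big_ord1 /= => a0 /mulfI E; apply/rowP => i; rewrite !ord1.
by apply: E; rewrite pnatr_eq0 -lt0n.
Qed.

Lemma degenerate_nonempty : (size w = 1)%N -> m = 0%N ->
  exists x : U, balanced alpha (cell_divisor x).
Proof.
move=> p1 m0; exists (const_mx alpha, symW 0); apply/(balancedE w_in).
have dR := dE_R (R := R) w_in; rewrite m0 mul0rn addr0 in dR.
rewrite /bal /csum points_nil // big_nil mul0rn addr0 dR mulr_sumr.
by apply: eq_bigr => i _; rewrite mxE mulrC.
Qed.

(** The chart followed by the map between half ball and half space; the degenerate cell is a point,
    parametrized by the closed ball of dimension 0. *)
Lemma cell_data n : n.+1 = (p + m + m)%N ->
  exists (B : set 'rV[R]_n) (h : 'rV[R]_n -> U), [/\ cell_domain B,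
    is_homeo B (cell_e d alpha w) h &
    forall x, B x -> cell_int alpha (h x) <-> eball n x].
Proof.
move=> nE; have [nondeg|deg] := boolP ((0 < m)%N || (1 < p)%N).
  have [i1 [k [chi [chi' ch]]]] := cell_chart_ex w_in alpha nondeg nE.
  exists (half_ball i1), (fun x => chi (to_half_space i1 x)); split.
  - by right; exists (axis i1) => //; exact: axis_neq0.
  - apply: (@is_homeo_inverse _ _ _ _ _ (fun z => of_half_space i1 (chi' z))).
    + by move=> x Bx; apply/(chart_cell ch); exact: to_half_space_in.
    + move=> z ez; apply: of_half_space_in; apply/(chart_cell ch).
      by rewrite (chart_invK ch) //; case: ez.
    + by move=> x Bx; rewrite (chartK ch) to_half_spaceK.
    + move=> z ez; rewrite of_half_spaceK ?(chart_invK ch) //; first by case: ez.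
      by apply/(chart_cell ch); rewrite (chart_invK ch) //; case: ez.
    + apply: within_continuous_at => x Bx; apply: continuous_comp.
        exact: to_half_space_continuous.
      exact: (chart_continuous ch).
    apply: within_continuous_at => z ez; apply: continuous_comp.
      exact: (chart_inv_continuous ch).
    apply: of_half_space_continuous; apply/(chart_cell ch).
    by rewrite (chart_invK ch) //; case: ez.
  by move=> x Bx; rewrite (chart_cell_int ch) (eball_half_space Bx).
(* The dimension equation excludes p = 0 here, so p = 1, m = 0 and n = 0. *)
have := deg; rewrite negb_or -!leqNgt leqn0 => /andP[/eqP m0 p1].
have {}p1 : (size w = 1)%N by lia.
have n0 : n = 0%N by lia.
subst n; have [x0 bx0] := degenerate_nonempty p1 m0.
have e0 : cell_e d alpha w x0.
  split=> //; last by move=> z; rewrite points_nil.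
  by move=> i j _; have := ltn_ord i; have := ltn_ord j; rewrite {2 4}p1 !ltnS !leqn0 => /eqP ji /eqP ii; rewrite (_ : i = j) //; apply: val_inj; rewrite /= ji ii.
exists (eclosed_ball 0), (fun=> x0); split; first by left.
- apply: (@is_homeo_inverse _ _ _ _ _ (fun=> 0 : 'rV[R]_0)).
  + by [].
  + by move=> _ _; rewrite /eclosed_ball /= /dotp big_ord0 ler01.
  + by move=> x _; rewrite [x]thinmx0.
  + by move=> z [_ _ bz]; exact: degenerate_eq.
  + by apply: continuous_subspaceT; exact: cst_continuous.
  by apply: continuous_subspaceT; exact: cst_continuous.
move=> x _; split=> _; first by rewrite /eball /= /dotp big_ord0 ltr01.
exact: degenerate_int.
Qed.

Lemma cell_e_coef_space (x : U) : cell_e d alpha w x -> coef_space d alpha (Phi d w x).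
Proof. by move=> [_ _ bx]; apply/(coef_spaceP alpha (root_divisor_Phi w_in x)). Qed.

(* Both the round sphere and the preimage of a coefficient sphere meet each orbit
   of the weighted dilations once; sliding along the orbits identifies them. *)
Lemma sphere_cell_data n (r : R) : 0 < r -> n.+2 = (p + m + m)%N ->
  exists (B : set 'rV[R]_n) (h : 'rV[R]_n -> U), [/\ cell_domain B,
    is_homeo B (cell_e d alpha w `&` Phi d w @^-1` coef_sphere d alpha r) h &
    forall x, B x -> cell_int alpha (h x) <-> eball n x].
Proof.
move=> r0 nE; have nondeg : (0 < m)%N || (1 < p)%N by lia.
have [i1 [k [chi [chi' ch]]]] := cell_chart_ex w_in alpha nondeg nE.
have k0 := chart_weight ch; have dw0 := @dweight_gt0 d.
pose A (xi : 'rV[R]_n.+1) := frame alpha (Phi d w (chi xi)).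
have A_neq0 (xi : 'rV[R]_n.+1) : xi != 0 -> A xi != 0.
  by apply: contra => /eqP /frame_eq0 /(chart_apex ch) ->.
have A_wdil (s : R) (xi : 'rV[R]_n.+1) : 0 < s -> A (wdil k s xi) = wdil (@dweight d) s (A xi).
  by move=> s0; rewrite /A (chart_dilate ch) // frame_dilate.
have cA : continuous A.
  apply: (@continuous_comp_fun _ _ _ (fun xi => Phi d w (chi xi)) (frame alpha)).
    exact: (continuous_comp_fun (chart_continuous ch) (@continuous_Phi _ _ _)).
  exact: continuous_frame.
have inS (z : U) : (cell_e d alpha w `&` Phi d w @^-1` coef_sphere d alpha r) z <->
    cell_e d alpha w z /\ dotp (A (chi' z)) (A (chi' z)) = r ^+ 2.
  split=> [[ez /coef_sphereE[_ hz]]|[ez hz]].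
    by split=> //; rewrite /A (chart_invK ch) //; case: ez.
  split=> //; apply/coef_sphereE; split; first exact: cell_e_coef_space.
  by move: hz; rewrite /A (chart_invK ch) //; case: ez.
have dotp_neq0 N (xi : 'rV[R]_N) (a : R) : 0 < a -> dotp xi xi = a -> xi != 0.
  move=> a0 xa; apply: contraTneq a0 => x0; rewrite -xa x0 /dotp big1 ?ltxx // => i _.
  by rewrite mxE mul0r.
have lift1 (x : 'rV[R]_n) : eclosed_ball n x -> dotp (to_hemisphere i1 x) (to_hemisphere i1 x) = 1.
  exact: dotp_to_hemisphere.
have lift_neq0 (x : 'rV[R]_n) : eclosed_ball n x -> to_hemisphere i1 x != 0.
  by move=> Bx; exact: (dotp_neq0 _ _ 1 ltr01 (lift1 x Bx)).
(* The factor that slides a point of the unit hemisphere in the chart along its orbit to the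
   coefficient sphere; [g] below slides back by [rho k 1]. *)
pose q (x : 'rV[R]_n) := rho (@dweight d) r (A (to_hemisphere i1 x)).
have qP (x : 'rV[R]_n) : eclosed_ball n x -> 0 < q x /\ wnorm (@dweight d) (q x) (A (to_hemisphere i1 x)) = r ^+ 2.
  by move=> Bx; apply: rhoP => //; apply/A_neq0/lift_neq0.
pose h (x : 'rV[R]_n) := chi (wdil k (q x) (to_hemisphere i1 x)).
pose g (z : U) := of_hemisphere i1 (wdil k (rho k 1 (chi' z)) (chi' z)).
have gP (z : U) : cell_e d alpha w z -> dotp (A (chi' z)) (A (chi' z)) = r ^+ 2 ->
    [/\ chi' z != 0, 0 < rho k 1 (chi' z) &
        dotp (wdil k (rho k 1 (chi' z)) (chi' z)) (wdil k (rho k 1 (chi' z)) (chi' z)) = 1].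
  move=> ez hz; have z0 : chi' z != 0.
    have Az : A (chi' z) != 0 by apply: dotp_neq0 hz; rewrite exprn_gt0.
    apply: contra Az => /eqP z0.
    (* If the chart point were 0, its frame would be fixed by doubling and hence vanish, off the
       sphere of positive radius. *)
    have E : A (chi' z) = wdil (@dweight d) 2 (A (chi' z)).
      rewrite -A_wdil // z0; congr A; apply/rowP => i.
      by rewrite wdilE !mxE mulr0.
    apply/eqP/rowP => i; rewrite [RHS]mxE.
    have /eqP := congr1 (fun v : 'rV[R]_d => v 0 i) E.
    rewrite wdilE eq_sym -subr_eq0 -{2}[A _ 0 i]mul1r -mulrBl mulf_eq0 => /orP[|/eqP//].
    rewrite subr_eq0 => /eqP e1.
    have : 1 < (2 : R) ^+ dweight i by rewrite exprn_egt1 ?ltr1n // -lt0n.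
    by rewrite e1 ltxx.
  by have [t0 tn] := rhoP k0 ltr01 z0; split=> //; move: tn; rewrite expr1n.
exists (eclosed_ball n), h; split; first by left.
- apply: (@is_homeo_inverse _ _ _ _ _ g).
  + move=> x Bx; have [q0 qr] := qP x Bx; apply/inS; split.
      apply/(chart_cell ch); rewrite wdilE mulr_ge0 ?exprn_ge0 ?(ltW q0) //.
      by rewrite to_hemisphere_axis sqrtr_ge0.
    by rewrite (chartK ch) A_wdil.
  + by move=> z /inS[ez hz]; have [_ _ gz] := gP z ez hz; exact: of_hemisphere_in.
  + move=> x Bx; have [q0 qr] := qP x Bx; rewrite /g /h (chartK ch).
    have -> : rho k 1 (wdil k (q x) (to_hemisphere i1 x)) = (q x)^-1.
      apply: rho_uniq => //; [|by rewrite invr_gt0|].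
        apply: contra (lift_neq0 x Bx) => /eqP x0.
        rewrite -[to_hemisphere i1 x](wdil1 k) -(mulVf (lt0r_neq0 q0)) -wdilM x0.
        by apply/eqP/rowP => i; rewrite wdilE mxE mulr0.
      by rewrite wnorm_wdil mulVf ?gt_eqF // wnorm1 lift1 // expr1n.
    by rewrite wdilM mulVf ?gt_eqF // wdil1 to_hemisphereK.
  + move=> z /inS[ez hz]; have [z0 t0 gz] := gP z ez hz; rewrite /h /g.
    set t := rho k 1 (chi' z) in t0 gz *.
    have lift_g : to_hemisphere i1 (of_hemisphere i1 (wdil k t (chi' z))) = wdil k t (chi' z).
      rewrite of_hemisphereK // wdilE mulr_ge0 ?exprn_ge0 ?(ltW t0) //.
      by apply/(chart_cell ch); rewrite (chart_invK ch) //; case: ez.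
    rewrite /q lift_g A_wdil //.
    have -> : rho (@dweight d) r (wdil (@dweight d) t (A (chi' z))) = t^-1.
      apply: rho_uniq => //; [|by rewrite invr_gt0|].
        by rewrite -A_wdil // A_neq0 //; apply: dotp_neq0 gz.
      by rewrite wnorm_wdil mulVf ?gt_eqF // wnorm1.
    rewrite wdilM mulVf ?gt_eqF // wdil1 (chart_invK ch) //; by case: ez.
  + apply: within_continuous_at => x Bx.
    have cl : {for x, continuous (to_hemisphere i1)} by exact: to_hemisphere_continuous.
    have cq : {for x, continuous q}.
      apply: (@continuous_comp _ _ _ (fun x => A (to_hemisphere i1 x)) (rho (@dweight d) r)).
        by apply: continuous_comp; [exact: cl|exact: cA].
      by apply: rho_continuous => //; apply/A_neq0/lift_neq0.
    apply: (@continuous_comp _ _ _ (fun x => wdil k (q x) (to_hemisphere i1 x)) chi); last exact: (chart_continuous ch).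
    apply: (@continuous_comp _ _ _ (fun x => (q x, to_hemisphere i1 x)) (fun sx => wdil k sx.1 sx.2)).
      exact: (cvg_pair cq cl).
    exact: continuous_wdil.
  apply: within_continuous_at => z /inS[ez hz]; have [z0 _ _] := gP z ez hz.
  have cc : {for z, continuous chi'} by exact: (chart_inv_continuous ch).
  apply: (@continuous_comp _ _ _ (fun z => wdil k (rho k 1 (chi' z)) (chi' z)) (of_hemisphere i1)); last exact: of_hemisphere_continuous.
  apply: (@continuous_comp _ _ _ (fun z => (rho k 1 (chi' z), chi' z)) (fun sx => wdil k sx.1 sx.2)).
    have cr : {for z, continuous (fun z => rho k 1 (chi' z))}.
      by apply: (@continuous_comp _ _ _ chi' (rho k 1)) => //; exact: rho_continuous.
    exact: (cvg_pair cr cc).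
  exact: continuous_wdil.
move=> x Bx; have [q0 qr] := qP x Bx; rewrite (chart_cell_int ch) wdilE.
by rewrite pmulr_rgt0 ?exprn_gt0 // to_hemisphere_gt0.
Qed.

End CellData.

(** * Cellular structures *)

Section Cellular.
Context {R : realType} {d : nat} (alpha : R).
Local Open Scope complex_scope.
Local Notation V := 'rV[R]_d.

Lemma Omega_le_positive w : Omega_le d w -> positive w.
Proof. by case. Qed.

(** Positive entries with sum at most d bound both the length and the entries by d, so w comes from
    a tuple over a finite type. *)
Lemma finite_Omega_le : finite_set (Omega_le d).
Proof.
pose f (t : {n : 'I_d.+1 & n.-tuple 'I_d.+1}) : seq nat := [seq val i | i <- tagged t].
apply: (@sub_finite_set _ _ (f @` setT)); last exact/finite_image/finite_finset.
move=> w [w0 sw _].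
have le_size : (size w <= sumn w)%N.
  elim: (w) w0 => //= k v IHv /andP[k0 /IHv]; lia.
have le_sum k : k \in w -> (k <= sumn w)%N.
  elim: (w) => //= k' v IHv; rewrite inE => /orP[/eqP->|/IHv]; lia.
have lt_size : (size w < d.+1)%N by lia.
have st : size [seq inord k : 'I_d.+1 | k <- w] == Ordinal lt_size by rewrite size_map.
exists (existT (fun n : 'I_d.+1 => n.-tuple 'I_d.+1) (Ordinal lt_size) (Tuple st)) => //.
rewrite /f /= -map_comp -[RHS]map_id; apply/eq_in_map => k kw /=.
by rewrite inordK // ltnS (leq_trans (le_sum k kw)).
Qed.

(** The condition on unordered points is expressed by the continuous function [minIm], whose
    nonnegativity criterion is valid also for m = 0. *)
Lemma closed_cell_e w : Omega_le d w -> closed (cell_e d alpha w).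
Proof.
move=> w_in.
have -> : cell_e d alpha w = [set x : @cell_ambient R d w | bal x = alpha * d%:R] `&`
    ((\bigcap_(i : 'I_(size w)) \bigcap_(j in [set j : 'I_(size w) | (i <= j)%N])
       [set x : @cell_ambient R d w | x.1 0 i <= x.1 0 j]) `&`
     [set x : @cell_ambient R d w | 0 <= minIm x.2]).
  apply/seteqP; split=> x.
    move=> [px sx /(balancedE w_in) bx]; split=> //; split.
      by move=> i _ j ij; exact: px.
    by rewrite /= minIm_ge0; exact/(Sym_inE x.2 (fun z => iff_refl _)).
  move=> [bx [px sx]]; split; [by move=> i j ij; exact: px| |exact/(balancedE w_in)].
  by move: sx; rewrite /= minIm_ge0 => /(Sym_inE x.2 (fun z => iff_refl _)).
have cc i : continuous (fun x : @cell_ambient R d w => x.1 0 i : R).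
  exact: (continuous_comp_fun (@continuous_fst _ _) (@continuous_coord _ _ _ _ _)).
apply: closedI; first by apply: closed_eq_fun; [exact: continuous_bal|exact: cst_continuous].
apply: closedI.
  by apply: closed_bigI => i _; apply: closed_bigI => j _; exact: closed_le_fun.
apply: closed_le_fun; first exact: cst_continuous.
exact: (continuous_comp_fun (@continuous_snd _ _) (@continuous_minIm _ _ _)).
Qed.

(** One argument for the affine space, with S the whole space, and for the sphere. Properness of
    [Phi] makes images of relatively closed sets closed; since there are finitely many types, this
    yields both the homeomorphisms on open cells and the weak topology. *)
Lemma cellular_criterion (S Z : set V) (J : set (seq nat)) (dim : seq nat -> nat) :
    J `<=` Omega_le d ->
    (forall w w' c, J w -> Omega_le d w' -> succeq w w' ->
       stratum d alpha w' c -> S c -> J w') ->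
    (forall w w', J w -> J w' -> (norm_red w < norm_red w')%N -> (dim w' < dim w)%N) ->
    Z = \bigcup_(w in J) (stratum d alpha w `&` S) ->
    (forall w, J w -> closed (cell_e d alpha w `&` Phi d w @^-1` S)) ->
    (forall w, J w -> exists (B : set 'rV[R]_(dim w)) (h : 'rV[R]_(dim w) -> cell_ambient d w),
       [/\ cell_domain B, is_homeo B (cell_e d alpha w `&` Phi d w @^-1` S) h &
           forall x, B x -> cell_int alpha (h x) <-> eball (dim w) x]) ->
  cellular_via_Phi Z J (fun w => stratum d alpha w `&` S) dim
    (fun w => cell_e d alpha w `&` Phi d w @^-1` S)
    (fun w => cell_bd d alpha w `&` Phi d w @^-1` S).
Proof.
move=> JO Jdown Jdim ZE eS_closed data.
(* The structure asks for families over all w, so dummy data are supplied outside J before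
   choosing. *)
have data' w : exists Bh : set 'rV[R]_(dim w) * ('rV[R]_(dim w) -> cell_ambient d w),
    J w -> [/\ cell_domain Bh.1, is_homeo Bh.1 (cell_e d alpha w `&` Phi d w @^-1` S) Bh.2 &
           forall x, Bh.1 x -> cell_int alpha (Bh.2 x) <-> eball (dim w) x].
  have [/data[B [h H]]|nJ] := pselect (J w); first by exists (B, h).
  by exists (set0, fun=> (0, symW 0)).
pose B w := (projT1 (cid (data' w))).1.
pose h w := (projT1 (cid (data' w))).2.
have Bh w : J w -> [/\ cell_domain (B w),
    is_homeo (B w) (cell_e d alpha w `&` Phi d w @^-1` S) (h w) &
    forall x, B w x -> cell_int alpha (h w x) <-> eball (dim w) x].
  by rewrite /B /h; case: (cid (data' w)).
have hin w x : J w -> B w x -> cell_e d alpha w (h w x) /\ S (Phi d w (h w x)).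
  by move=> /Bh[_ [[hB _ _] _ _] _] /hB.
have hsurj w z : J w -> cell_e d alpha w z -> S (Phi d w z) -> exists2 x, B w x & h w x = z.
  by move=> /Bh[_ [[_ _ hs] _ _] _] ez Sz; exact: hs.
have eballB w : J w -> eball (dim w) `<=` B w.
  move=> /Bh[[->|[u _ ->]] _ _] x; first by move=> /ltW.
  by left.
have bd_below w z : J w -> cell_bd d alpha w z -> S (Phi d w z) ->
    exists w', [/\ J w', succeq w w', (norm_red w < norm_red w')%N & stratum d alpha w' (Phi d w z)].
  move=> Jw bz Sz; have [_ [w' [Ow' ww' lt_n st]]] := Phi_bd (JO w Jw) (imageP (Phi d w) bz).
  by exists w'; split=> //; exact: Jdown Ow' ww' st Sz.
have phiZ w x : J w -> B w x -> Z (Phi d w (h w x)).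
  move=> Jw Bx; have [ex Sx] := hin w x Jw Bx; rewrite ZE.
  have [ix|nx] := pselect (cell_int alpha (h w x)).
    exists w => //; split=> //.
    by rewrite -(Phi_cell_int (JO w Jw)); exists (h w x).
  have [|w' [Jw' _ _ st]] := bd_below w (h w x) Jw _ Sx; last by exists w'.
  by rewrite cell_bdE.
have phi_int w z : J w -> cell_int alpha z -> stratum d alpha w (Phi d w z).
  by move=> Jw iz; rewrite -(Phi_cell_int (JO w Jw)); exists z.
have int_st w z : J w -> cell_e d alpha w z -> stratum d alpha w (Phi d w z) -> cell_int alpha z.
  move=> Jw ez /(stratumP _ _ (Omega_le_positive (JO w Jw)))[_].
  exact: (srep_cell_int (JO w Jw)).
exists B, h; split.
  move=> w Jw; have [Bd hB hint] := Bh w Jw; split=> //.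
  apply/seteqP; split=> [_ [x [Bx nx] <-]|z [+ Sz]]; rewrite cell_bdE.
    have [ex Sx] := hin w x Jw Bx; split=> //; split=> //.
    by move=> /(hint x Bx).
  move=> [ez nz]; have [x Bx xz] := hsurj w z Jw ez Sz; exists x => //; split=> //.
  by move=> /(hint x Bx); rewrite xz.
split.
- by apply: subspace_hausdorff; exact: norm_hausdorff.
- by rewrite ZE.
- apply/trivIsetP => w w' Jw Jw' /eqP ww'.
  apply/seteqP; split=> // c [[[_ cw] _] [[_ cw'] _]]; apply: ww'.
  by rewrite -cw cw'.
- by move=> w /Bh[].
- move=> w Jw; have [Bd [[hB hI hS] hc [g gc gK]] hint] := Bh w Jw.
  apply: closed_map_homeo.
  + split.
    * move=> x bx /=; have Bx := eballB w Jw x bx.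
      have [ex Sx] := hin w x Jw Bx; split=> //.
      by apply: phi_int => //; exact/(hint x Bx).
    * move=> x x'; rewrite !inE => bx bx' /= E.
      have Bx := eballB w Jw x bx; have Bx' := eballB w Jw x' bx'.
      apply: hI; rewrite ?inE //; apply: (Phi_int_inj (JO w Jw) (alpha := alpha)) E.
        by rewrite inE; exact/(hint x Bx).
      by rewrite inE; exact/(hint x' Bx').
    * move=> c [st Sc]; move: st; rewrite -(Phi_cell_int (JO w Jw)) => -[z iz zc].
      have [|x Bx xz] := hsurj w z Jw (cell_int_e iz); first by rewrite zc.
      by exists x; [apply/(hint x Bx); rewrite xz|rewrite /= xz].
  + apply: (@continuous_subspaceW _ _ _ (B w)); first exact: eballB.
    apply: (@continuous_comp_fun (subspace (B w)) _ _ (h w) (Phi d w)); first exact: hc.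
    exact: continuous_Phi.
  move=> C cC.
  (* Take the image from the whole closed cell, where [Phi] is closed. It meets the stratum only in
     images of open ball points, as boundary points never land in the stratum. *)
  exists (Phi d w @` (h w @` (C `&` B w))).
    apply: (closed_Phi (JO w Jw)).
    by apply: (is_homeo_closed_image _ (eS_closed w Jw) cC); case: (Bh w Jw).
  apply/seteqP; split=> [_ [[_ [x [Cx Bx] <-] <-] [st Sx]]|_ [x [Cx bx] <-]].
    have [ex _] := hin w x Jw Bx; exists x => //; split=> //.
    by apply/(hint x Bx); exact: int_st.
  have Bx := eballB w Jw x bx; have [ex Sx] := hin w x Jw Bx.
  split; first by exists (h w x) => //; exists x.
  by split=> //; apply: phi_int => //; exact/(hint x Bx).
- move=> w Jw; have [_ [_ hc _] _] := Bh w Jw.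
  apply: (@continuous_comp_fun (subspace (B w)) _ _ (h w) (Phi d w)); first exact: hc.
  exact: continuous_Phi.
- by move=> w Jw _ [x Bx <-]; exact: phiZ.
- move=> w Jw; have [_ _ hint] := Bh w Jw.
  (* All cells of smaller dimension may be taken, being finite in number. *)
  exists (J `&` [set w' | (dim w' < dim w)%N]); split.
  + by apply: sub_finite_set finite_Omega_le => w' [/JO].
  + by move=> w' [].
  + by move=> w' [].
  move=> _ [x [Bx nx] <-]; have [ex Sx] := hin w x Jw Bx.
  have [|w' [Jw' _ lt_n st]] := bd_below w (h w x) Jw _ Sx.
    by rewrite cell_bdE; split=> // /(hint x Bx).
  by exists w' => //; split=> //=; exact: Jdim.
move=> Y YZ Yc; apply: closed_subspaceW.
(* Y is the finite union of the images of its preimages in the closed cells, each of which is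
   closed. *)
pose Cw w := B w `&` (Phi d w \o h w) @^-1` (Y `&` (Phi d w \o h w) @` B w).
have -> : Y = \bigcup_(w in J) (Phi d w @` (h w @` Cw w)).
  apply/seteqP; split=> [c Yc'|_ [w Jw [_ [x [Bx [Yx _]] <-] <-]] //].
  have := YZ c Yc'; rewrite ZE => -[w Jw [+ Sc]].
  rewrite -(Phi_cell_int (JO w Jw)) => -[z iz zc].
  have [|x Bx xz] := hsurj w z Jw (cell_int_e iz); first by rewrite zc.
  exists w => //; exists z => //; exists x => //; split=> //=.
  by split; [rewrite xz zc|exists x].
apply: closed_bigcup; first by apply: sub_finite_set finite_Omega_le.
move=> w Jw; apply: (closed_Phi (JO w Jw)).
have [D cD DE] := (closed_subspaceP _ _).1 (Yc w Jw).
have -> : Cw w = D `&` B w.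
  by rewrite DE; apply/seteqP; split=> [x [Bx H]|x [[Bx H] _]].
apply: (is_homeo_closed_image _ (eS_closed w Jw) cD).
by case: (Bh w Jw).
Qed.

End Cellular.

(** * The strata *)

Section Strata.
Context {R : realType} {d : nat} (alpha : R).
Context (d_gt0 : (0 < d)%N).
Local Open Scope complex_scope.
Local Notation C := (R[i]^o).
Local Notation V := 'rV[R]_d.
Local Notation O := (O_pt d alpha).
Implicit Types (w : seq nat) (c : V) (r s : R).

Lemma norm_redE w : positive w -> (norm_red w + size w = sumn w)%N.
Proof.
rewrite /norm_red; elim: w => [|k w IHw] /=; first by rewrite big_nil.
by move=> /andP[k0 /IHw]; rewrite big_cons; lia.
Qed.

(** The difference of |w| and |w|' counts the entries of w, so d - |w|' = p + 2m; balance removes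
    one dimension. *)
Lemma dimE w : Omega_le d w ->
  ((d.-1 - norm_red w).+1 = size w + (d - sumn w)./2 + (d - sumn w)./2)%N.
Proof.
move=> w_in; have := Omega_leE w_in; have := norm_redE (Omega_le_positive w_in).
case: w w_in => [|k w] w_in; first by rewrite /= /norm_red big_nil; lia.
by rewrite /=; lia.
Qed.

Lemma norm_red_le w : Omega_le d w -> (norm_red w <= d.-1)%N.
Proof.
move=> w_in; have := norm_redE (Omega_le_positive w_in); case: (w_in) => _.
case: w w_in => [|k w] w_in /=; first by rewrite /norm_red big_nil.
by lia.
Qed.

(** Only (d) has codimension d - 1. This makes the truncated dimension d - 2 - |w|' of the sphere
    cells the true one. *)
Lemma norm_red_lt w : Omega_le d w -> w != omega_star d -> (norm_red w < d.-1)%N.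
Proof.
move=> w_in; have := norm_redE (Omega_le_positive w_in); have := Omega_leE w_in.
have w_pos := Omega_le_positive w_in.
case: w w_in w_pos => [|k [|k' w]] w_in w_pos /=; first by rewrite /norm_red big_nil; lia.
  move=> dE nr kd; have kd' : k != d by apply: contra kd => /eqP ->.
  by rewrite /omega_star in kd; move/eqP: kd'; lia.
by move=> *; lia.
Qed.

Lemma stratum_cover c : coef_space d alpha c ->
  exists2 w, Omega_le d w & stratum d alpha w c.
Proof.
move=> cc; exists (comb_type (monic_of c)); last by split.
exact: rep_Omega (positive_comb_type c) (srep_rep (comb_type_srep c)).
Qed.

Lemma stratum_star : stratum d alpha (omega_star d) = [set O].
Proof.
have ps : positive (omega_star d) by rewrite /positive /= d_gt0.
have dE : root_divisor (monic_of O) (nseq d (alpha%:C : C)).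
  rewrite /root_divisor monic_of_O big_nseq iter_mulr_1 -[LHS]/(map_poly (real_complex R) _).
  by rewrite rmorphXn /= rmorphB /= map_polyX map_polyC.
have sO : srep (omega_star d) O.
  exists [:: alpha], [::]; split=> //.
  by rewrite /full_div /rdiv /= !cats0.
have bal_nseq (y : R) : balanced alpha (nseq d (y%:C : C)) <-> y = alpha.
  rewrite /balanced size_nseq big_nseq iter_addr_0 -raddfMn /=.
  split=> [/complexI E|->]; last by rewrite mulr_natr.
  have d0 : d%:R != 0 :> R by rewrite pnatr_eq0 -lt0n.
  by apply: (mulIf d0); rewrite mulr_natr.
apply/seteqP; split=> c; last first.
  move=> ->; apply/(stratumP _ _ ps); split=> //.
  by apply/(coef_spaceP alpha dE)/bal_nseq.
move=> /(stratumP _ _ ps)[cc [ys [zs [sw _ _ rD]]]] /=.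
case: ys sw rD => [//|y [|//]] _ rD.
have zs0 : zs = [::].
  have := root_divisor_size rD; rewrite size_monic_of size_full_div // /= addn0.
  by case: zs {rD} => //= z zs; lia.
move: rD; rewrite zs0 /full_div /rdiv /= !cats0 => rD.
have /bal_nseq yE := (coef_spaceP alpha rD).1 cc.
by rewrite yE in rD; apply: monic_of_inj; exact: root_divisor_inj rD dE.
Qed.

Lemma O_coef_space : coef_space d alpha O.
Proof.
have : stratum d alpha (omega_star d) O by rewrite stratum_star.
by case.
Qed.

Lemma Phi_cell_closed w : Omega_le d w -> closed (Phi d w @` cell_e d alpha w).
Proof. by move=> w_in; apply: closed_Phi => //; exact: closed_cell_e. Qed.

Lemma closure_stratum w : Omega_le d w ->
  closure (stratum d alpha w) = Phi d w @` cell_e d alpha w.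
Proof.
move=> w_in; rewrite -(Phi_cell_int w_in); apply/seteqP; split.
  rewrite [X in _ `<=` X](closure_id _).1; last exact: Phi_cell_closed.
  by apply: closure_subset; apply: image_subset; exact: cell_int_e.
move=> _ [x ex <-].
have [nondeg|deg] := boolP ((0 < (d - sumn w)./2)%N || (1 < size w)%N); last first.
  by apply: subset_closure; exists x => //; exact: degenerate_int.
(* Spreading by a small positive time makes the margin positive without changing the balance, so
   every point of the closed cell is a limit of points of the open one. *)
have ct : continuous (fun t : R => Phi d w (spread t x)).
  apply: (@continuous_comp_fun _ _ _ (fun t => spread t x) (Phi d w)); last exact: continuous_Phi.
  by apply: continuous_spread; [move=> ?; exact: cvg_id|exact: cst_continuous].
move=> N Nx; have : nbhs (0 : R) ((fun t => Phi d w (spread t x)) @^-1` N).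
  by apply: ct; rewrite /= spread0.
move=> /nbhs_ballP[e /= e0 eN]; exists (Phi d w (spread (e / 2) x)); split; last first.
  apply: eN; rewrite /ball /= sub0r normrN ger0_norm ?divr_ge0 ?ltW //.
  by rewrite ltr_pdivrMr // ltr_pMr // ltr1n.
exists (spread (e / 2) x) => //; case: ex => px sx bx.
have [px' sx'] : Pi_cone_int (spread (e / 2) x).1 /\ Sym_in Hplane_int (spread (e / 2) x).2.
  apply/(margin_gt0 nondeg); rewrite (margin_spread nondeg) ltr_wpDl ?divr_gt0 //.
  exact/(margin_ge0 nondeg).
by split=> //; apply/(balancedE w_in); rewrite (bal_spread w_in); exact/(balancedE w_in).
Qed.

Lemma Phi_cell_strata w : Omega_le d w -> Phi d w @` cell_e d alpha w =
  \bigcup_(w' in Omega_below d w) stratum d alpha w'.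
Proof.
move=> w_in; have w_pos := Omega_le_positive w_in.
rewrite (Phi_cell_e w_in); apply/seteqP; split=> c.
  move=> [cc rc]; have [w' [w'0 ww' sw' _]] := rep_degenerate w_pos rc.
  exists w'; last exact/stratumP.
  by split=> //; exact: rep_Omega w'0 (srep_rep sw').
move=> [w' [Ow' ww'] /(stratumP _ _ (Omega_le_positive Ow'))[cc sc]].
by split=> //; apply: rep_succeq ww' (srep_rep sc).
Qed.

Lemma strata_cellularP (Z : set V) (J : set (seq nat)) :
    J `<=` Omega_le d ->
    (forall w w' c, J w -> Omega_le d w' -> succeq w w' -> J w') ->
    Z = \bigcup_(w in J) stratum d alpha w ->
  strata_cellular d alpha J Z.
Proof.
move=> JO Jdown ZE.
have := @cellular_criterion R d alpha setT Z J (fun w => (d.-1 - norm_red w)%N) JO.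
have -> : (fun w => stratum d alpha w `&` setT) = stratum d alpha.
  by apply/funext => w; rewrite setIT.
(* The ambient type depends on w, hence dependent extensionality. *)
have -> : (fun w => cell_e d alpha w `&` Phi d w @^-1` setT) = cell_e d alpha.
  by apply/functional_extensionality_dep => w; apply/seteqP; split=> x // [].
have -> : (fun w => cell_bd d alpha w `&` Phi d w @^-1` setT) = cell_bd d alpha.
  by apply/functional_extensionality_dep => w; apply/seteqP; split=> x // [].
apply.
- by move=> w w' c Jw Ow' ww' _ _; exact: Jdown Jw Ow' ww'.
- move=> w w' /JO Ow /JO Ow' lt_n; have := norm_red_le Ow'; lia.
- exact: ZE.
- by move=> w /JO Ow; rewrite preimage_setT setIT; exact: closed_cell_e.
move=> w /JO Ow; rewrite preimage_setT setIT.
by apply: cell_data => //; exact: dimE.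
Qed.

Lemma sphere_cellularP r : 0 < r -> sphere_cellular d alpha r (Omega_le d `\ omega_star d).
Proof.
move=> r0; have JO : Omega_le d `\ omega_star d `<=` Omega_le d by move=> w [].
have JP w : (Omega_le d `\ omega_star d) w -> Omega_le d w /\ w != omega_star d.
  by move=> [Ow /eqP].
have nO : ~ coef_sphere d alpha r O.
  move=> /coef_sphereE[_]; rewrite frame_O /dotp big1 => [/esym/eqP|i _]; last by rewrite mxE mul0r.
  by rewrite expf_eq0 /= gt_eqF.
apply: cellular_criterion => //.
(* The type (d) cannot appear: its stratum is the apex, which lies on no sphere of positive
   radius. *)
- move=> w w' c _ Ow' _ sc Sc; split=> // w'E; apply: nO.
  by move: sc; rewrite w'E stratum_star => <-.
- move=> w w' /JP[Ow nw] /JP[Ow' nw'] lt_n.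
  by have := norm_red_lt Ow' nw'; lia.
- apply/seteqP; split=> c; last by move=> [w _ []].
  move=> Sc; have [cc _] := Sc; have [w Ow sc] := stratum_cover cc.
  exists w => //; split=> // wE; apply: nO.
  by move: sc; rewrite wE stratum_star => <-.
- move=> w /JP[Ow nw].
  have -> : cell_e d alpha w `&` Phi d w @^-1` coef_sphere d alpha r =
      cell_e d alpha w `&` [set x | dotp (frame alpha (Phi d w x)) (frame alpha (Phi d w x)) = r ^+ 2].
    apply/seteqP; split=> x [ex]; first by move=> /coef_sphereE[].
    by move=> h; split=> //; apply/coef_sphereE; split=> //; exact: cell_e_coef_space.
  apply: closedI; first exact: closed_cell_e.
  apply: closed_eq_fun; last exact: cst_continuous.
  apply: dotp_continuous.
  exact: (continuous_comp_fun (@continuous_Phi R d w) (@continuous_frame R d alpha)).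
move=> w /JP[Ow nw]; apply: sphere_cell_data => //.
by rewrite -(dimE Ow); have := norm_red_lt Ow nw; lia.
Qed.

Lemma closed_coef_space : closed (coef_space d alpha).
Proof.
have -> : coef_space d alpha = \bigcup_(w in Omega_le d) (Phi d w @` cell_e d alpha w).
  apply/seteqP; split=> [c /stratum_cover[w Ow sc]|c [w Ow [x ex <-]]].
    exists w => //; rewrite -closure_stratum //; exact: subset_closure.
  exact: cell_e_coef_space.
by apply: closed_bigcup; [exact: finite_Omega_le|exact: Phi_cell_closed].
Qed.

Lemma frame_sqr_continuous : continuous (fun c : V => dotp (frame alpha c) (frame alpha c)).
Proof. by apply: dotp_continuous; exact: continuous_frame. Qed.

(** It is closed, and in the frame it lies in the box of half-width r. *)
Lemma compact_coef_sphere r : 0 < r -> compact (coef_sphere d alpha r).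
Proof.
move=> r0; pose f (v : V) : V := O + taylor (- alpha) v.
have cf : continuous f.
  by apply: continuous_addv; [exact: cst_continuous|exact: continuous_taylor].
apply: (@subclosed_compact _ _ (f @` [set v : V | forall j, `|v 0 j| <= r])).
- have -> : coef_sphere d alpha r = coef_space d alpha `&`
      [set c | dotp (frame alpha c) (frame alpha c) = r ^+ 2].
    by apply/seteqP; split=> c.
  apply: closedI; first exact: closed_coef_space.
  by apply: closed_eq_fun; [exact: frame_sqr_continuous|exact: cst_continuous].
- apply: continuous_compact; last exact: compact_rballs.
  exact: continuous_subspaceT.
move=> c /coef_sphereE[_ cr]; exists (frame alpha c); last first.
  by rewrite /f /frame taylorK addrC subrK.
move=> j; rewrite -ler_sqr ?nnegrE ?(ltW r0) // real_normK ?num_real // -cr.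
rewrite /dotp (bigD1 j) //= -expr2 lerDl.
by apply: sumr_ge0 => i _; rewrite -expr2 sqr_ge0.
Qed.

Local Notation W := (@dweight d).

Lemma wnorm_frame s c : wnorm W s (frame alpha c) =
  dotp (frame alpha (dilate alpha s c)) (frame alpha (dilate alpha s c)).
Proof. by rewrite frame_dilate. Qed.

Lemma frame_neq0 c : c <> O -> frame alpha c != 0.
Proof. by move=> cO; apply/eqP => /frame_eq0. Qed.

Lemma sphere_neq_O r c : 0 < r -> coef_sphere d alpha r c -> c <> O.
Proof.
move=> r0 /coef_sphereE[_ +] cO; rewrite cO frame_O /dotp big1 => [/esym/eqP|i _]; last by rewrite mxE mul0r.
by rewrite expf_eq0 /= gt_eqF.
Qed.

Lemma dilate_to_sphere r c : 0 < r -> coef_space d alpha c -> c <> O ->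
  exists s e, [/\ 0 < s, coef_sphere d alpha r e, c = dilate alpha s e & e = dilate alpha s^-1 c].
Proof.
move=> r0 cc /frame_neq0 c0; have [q0 qr] := rhoP (@dweight_gt0 d) r0 c0.
exists (rho W r (frame alpha c))^-1, (dilate alpha (rho W r (frame alpha c)) c).
split.
- by rewrite invr_gt0.
- by apply/coef_sphereE; split; [exact: dilate_coef_space|rewrite -wnorm_frame].
- by rewrite dilateM mulVf ?gt_eqF // dilate1.
by rewrite invrK.
Qed.

Lemma flow_open_cone r : 0 < r ->
  is_open_cone (coef_space d alpha) (coef_sphere d alpha r) O (flow_cone alpha (flow alpha)).
Proof.
move=> r0; have coneE (e : V) (s : R) : 0 <= s -> flow_cone alpha (flow alpha) (e, s) = dilate alpha s e.
  exact: flow_coneE.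
have cd : continuous (fun es : V * R => dilate alpha es.2 es.1).
  apply: (@continuous_comp_fun _ _ _ (fun es : V * R => (es.2, es.1)) (fun sc => dilate alpha sc.1 sc.2)).
    by apply: continuous_pair; [exact: continuous_snd|exact: continuous_fst].
  exact: continuous_dilate.
split.
- apply: (@subspace_eq_continuous _ _ _ (fun es : V * R => dilate alpha es.2 es.1)).
    by move=> [e s]; rewrite inE => -[_ /= s0]; rewrite /from_subspace coneE.
  exact: continuous_subspaceT.
- by move=> e _; rewrite coneE // dilate0.
- apply/seteqP; split=> c.
    move=> cc; have [->|/eqP cO] := eqVneq c O; first by left.
    have [s [e [s0 Se -> _]]] := dilate_to_sphere r0 cc cO.
    by right; exists (e, s); rewrite ?coneE ?ltW //; split=> //=; exact: ltW.
  move=> [->|[[e s] [[ce _] /= s0] <-]]; first exact: O_coef_space.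
  by rewrite coneE //; exact: dilate_coef_space.
- move=> [e s] [e' s']; rewrite !inE => -[/= Se s0] [/= Se' s'0].
  rewrite (coneE e s (ltW s0)) (coneE e' s' (ltW s'0)) => E.
  have s_neq0 := lt0r_neq0 s0.
  have eE : e = dilate alpha (s^-1 * s') e'.
    have := congr1 (dilate alpha s^-1) E.
    by rewrite (dilateM alpha s^-1 s e) (dilateM alpha s^-1 s' e') (mulVf s_neq0) dilate1.
  have er := (coef_sphereE alpha r e).1 Se; have er' := (coef_sphereE alpha r e').1 Se'.
  (* Two points of the sphere on one orbit coincide, as the norm is strictly increasing along the
     orbit. *)
  have s1 : s^-1 * s' = 1.
    apply: (@wnorm_inj _ _ _ (@dweight_gt0 d) _ _ (frame alpha e')).
    - exact: (frame_neq0 (sphere_neq_O r0 Se')).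
    - by rewrite mulr_ge0 // ?invr_ge0 ltW.
    - exact: ler01.
    by rewrite (wnorm_frame _ e') -eE wnorm1 er.2 er'.2.
  congr pair; first by rewrite eE s1 dilate1.
  by rewrite -[s]mulr1 -s1 mulrA (mulfV s_neq0) mul1r.
- move=> e s Se s0; rewrite (coneE e s (ltW s0)) => E; apply: (sphere_neq_O r0 Se).
  have := congr1 (dilate alpha s^-1) E.
  by rewrite (dilateM alpha s^-1 s e) (mulVf (lt0r_neq0 s0)) dilate1 dilate_O.
move=> Y YX Yc; apply: closed_subspaceW.
pose D : set (V * R) := coef_sphere d alpha r `*` [set s | 0 <= s].
have cS : closed (coef_sphere d alpha r).
  by apply: compact_closed; [exact: norm_hausdorff|exact: compact_coef_sphere].
have cD : closed D.
  have -> : D = (@fst V R @^-1` coef_sphere d alpha r) `&` (@snd V R @^-1` [set s | 0 <= s]).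
    by apply/seteqP; split=> es.
  apply: closedI.
    exact: ((continuous_closedP (fst : V * R -> V)).1 (@continuous_fst _ _) _ cS).
  apply: closed_le_fun; [exact: cst_continuous|exact: continuous_snd].
pose A : set (V * R) := D `&` flow_cone alpha (flow alpha) @^-1` Y.
have cA : closed A.
  have [G cG GE] := (closed_subspaceP _ _).1 Yc.
  have -> : A = G `&` D by rewrite GE; apply/seteqP; split=> [es H|es [H _]] //; split=> //; case: H.
  exact: closedI.
(* The apex is added separately: for an empty sphere, as when d = 1, it is not in the image of A. *)
have -> : Y = (fun es : V * R => dilate alpha es.2 es.1) @` A `|` (Y `&` [set O]).
  apply/seteqP; split=> c.
    move=> Yc'; have [cO|/eqP cO] := eqVneq c O; first by right.
    left; have [s [e [s0 Se cE _]]] := dilate_to_sphere r0 (YX c Yc') cO.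
    exists (e, s) => //=; split; first by split=> //=; exact: ltW.
    by rewrite /= coneE ?ltW // -cE.
  by move=> [[[e s] [[Se /= s0] +] <-]|[]//]; rewrite /= coneE.
apply: closedU; last first.
  have [YO|nYO] := pselect (Y O).
    rewrite (_ : Y `&` [set O] = [set O]); last by apply/seteqP; split=> [c []//|c /= ->].
    by apply: compact_closed; [exact: norm_hausdorff|exact: compact_set1].
  have -> : Y `&` [set O] = set0.
    by apply/seteqP; split=> // c [Yc' cO]; apply: nYO; rewrite -cO.
  exact: closed0.
apply: closed_image_proper; [exact: norm_hausdorff|exact: cd|exact: cA|].
move=> u; pose M := dotp (frame alpha u) (frame alpha u) + 1.
exists [set u' : V | dotp (frame alpha u') (frame alpha u') < M].
  have uM : dotp (frame alpha u) (frame alpha u) < M by rewrite ltrDl.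
  exact: (cvgr_lt _ (@frame_sqr_continuous u) _ uM).
(* For s > 1, [wnorm_ge] gives s r^2 < M, so the parameter stays bounded over this neighbourhood and
   the dilation map is proper on A. *)
exists (coef_sphere d alpha r `*` `[0, 1 + M / r ^+ 2]%classic).
  by apply: compact_setX; [exact: compact_coef_sphere|exact: segment_compact].
move=> [e s] [[[/= Se s0] _] /= lt_M]; split=> //=.
rewrite in_itv /= s0 /=; have [le_s1|lt_1s] := leP s 1.
  rewrite (le_trans le_s1) // lerDl divr_ge0 ?sqr_ge0 // ltW //.
  by rewrite (le_lt_trans _ lt_M) // dotp_ge0.
have := wnorm_ge (@dweight_gt0 d) (frame alpha e) (ltW lt_1s).
rewrite wnorm_frame => /le_lt_trans/(_ lt_M).
have [_] := Se; rewrite /dot_at => ->; rewrite -ltr_pdivlMr ?exprn_gt0 // => /ltW le_s.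
by rewrite (le_trans le_s) // lerDr.
Qed.

(** Such a stratum avoids the apex and is invariant under positive dilations, so it is swept out by
    the orbits through its points on the sphere. *)
Lemma stratum_flow_cone r w : 0 < r -> (Omega_le d `\ omega_star d) w ->
  stratum d alpha w = flow_cone alpha (flow alpha) @`
    ((stratum d alpha w `&` coef_sphere d alpha r) `*` [set s | 0 < s]).
Proof.
move=> r0 [Ow nw]; have w_pos := Omega_le_positive Ow; apply/seteqP; split=> c.
  move=> sc; have [cc cw] := sc.
  have cO : c <> O.
    move=> cO; apply: nw; rewrite /= -cw cO.
    by have : stratum d alpha (omega_star d) O by [rewrite stratum_star]; case.
  have [s [e [s0 Se cE eE]]] := dilate_to_sphere r0 cc cO.
  exists (e, s); last by rewrite flow_coneE ?ltW.
  split=> //=; split=> //; rewrite eE.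
  by apply: stratum_dilate; rewrite ?invr_gt0.
move=> [[e s] [[se _] /= s0] <-]; rewrite flow_coneE ?ltW //.
exact: stratum_dilate.
Qed.

End Strata.

Theorem theorem4p2 (R : realType) (d : nat) (w : seq nat) (alpha : R)
    (d_ge1 : (1 <= d)%N) (w_in : Omega_le d w) :
  [/\ exists2 n : nat, (n + norm_red w = d - 1)%N &
        homeomorphic (@eball R n) (stratum d alpha w),
      forall what, Omega_le d what ->
        strata_cellular d alpha (Omega_below d what)
          (closure (stratum d alpha what)) /\
        (forall w', Omega_below d what w' ->
           {within cell_bd d alpha w', continuous (Phi d w')} /\
           Phi d w' @` cell_bd d alpha w' `<=`
             closure (stratum d alpha w') `\` stratum d alpha w')
    & exists Psi : R -> 'rV[R]_d -> 'rV[R]_d,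
        [/\ is_flow (coef_space d alpha) Psi,
            forall c, coef_space d alpha c ->
              ((forall t, Psi t c = c) <-> c = O_pt d alpha),
            is_source (coef_space d alpha) Psi (O_pt d alpha),
            forall r, 0 < r -> transversal_to_sphere alpha r Psi
          & (forall w', Omega_le d w' -> forall t,
               Psi t @` stratum d alpha w' = stratum d alpha w') /\
            [/\ strata_cellular d alpha (Omega_le d) (coef_space d alpha),
                stratum d alpha (omega_star d) = [set O_pt d alpha]
              & forall r, 0 < r ->
                  [/\ sphere_cellular d alpha r
                        (Omega_le d `\ omega_star d),
                      is_open_cone (coef_space d alpha) (coef_sphere d alpha r)
                        (O_pt d alpha) (flow_cone alpha Psi)
                    & forall w', (Omega_le d `\ omega_star d) w' ->
                        stratum d alpha w' =
                        flow_cone alpha Psi @`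
                          ((stratum d alpha w' `&` coef_sphere d alpha r)
                             `*` [set s | 0 < s])]]]].
Proof.
have cell_all : strata_cellular d alpha (Omega_le d) (coef_space d alpha).
  apply: strata_cellularP => //.
  apply/seteqP; split=> c; first by move=> /stratum_cover[w' Ow' sc]; exists w'.
  by move=> [w' _ []].
split.
(* That the stratum is an open ball is read off from the cellular structure of the whole space,
   whose characteristic map is a homeomorphism on the interior. *)
- exists (d.-1 - norm_red w)%N; first by have := norm_red_le d_ge1 w_in; lia.
  have [B [h [_ cs]]] := cell_all.
  by exists (Phi d w \o h w); exact: (cs_interior cs).
- move=> what what_in; split.
    apply: strata_cellularP => //.
    + by move=> w' [].
    + by move=> w1 w2 c [_ ww1] Ow2 w12; split=> //; exact: succeq_trans w12.
    by rewrite closure_stratum // Phi_cell_strata.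
  move=> w' [Ow' _]; split; first by apply: continuous_subspaceT; exact: continuous_Phi.
  move=> _ [x bx <-]; split; last exact: Phi_bd_stratum.
  by rewrite closure_stratum //; exists x => //; case: bx.
exists (flow alpha); split.
- exact: flow_is_flow.
- by move=> c _; exact: flow_stationary.
- exact: flow_source.
- by move=> r; exact: flow_transversal.
split; first by move=> w' Ow' t; apply: flow_stratum; exact: Omega_le_positive Ow'.
split=> //; first exact: stratum_star.
move=> r r0; split; [exact: sphere_cellularP|exact: flow_open_cone|].
by move=> w'; exact: stratum_flow_cone.
Qed.
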